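(* Let $m\ge 0$ be an integer and let $\Phi=\{\varphi_j(x)=\lambda_j x+t_j\}_{j=0}^m$ be a self-similar iterated function system on $\mathbb{R}$, i.e. $\lambda_j\in(-1,1)\setminus\{0\}$ and $t_j\in\mathbb{R}$ for each $0\le j\le m$. Suppose that $\lambda_0,\dots,\lambda_m$ are all algebraic numbers and that $\Phi$ has no exact overlaps. Let $K$ be the attractor of $\Phi$. Then $$\dim_H K=\min\{1,\dim_s\Phi\}.$$
   Context: The attractor $K$ is the unique nonempty compact subset of $\mathbb{R}$ with $K=\bigcup_{j=0}^m\varphi_j(K)$. $\dim_H$ denotes Hausdorff dimension. The similarity dimension $\dim_s\Phi$ is the unique $s\ge0$ satisfying $\sum_{j=0}^m|\lambda_j|^s=1$. Write $\Lambda=\{0,\dots,m\}$, and for $w=j_1\dots j_n\in\Lambda^n$ write $\varphi_w=\varphi_{j_1}\circ\dots\circ\varphi_{j_n}$. The system $\Phi$ has exact overlaps if there exist $n\ge1$ and distinct words $w_1,w_2\in\Lambda^n$ with $\varphi_{w_1}=\varphi_{w_2}$. *)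

(* Defs.v *)
From HB Require Import structures.
From mathcomp Require Import all_boot all_order all_algebra.
From mathcomp Require Import all_classical all_reals all_analysis.
Set Implicit Arguments.
Unset Strict Implicit.
Unset Printing Implicit Defensive.
Import Order.TTheory GRing.Theory Num.Theory.
Import numFieldNormedType.Exports.
Local Open Scope classical_set_scope.
Local Open Scope ring_scope.

Section Hausdorff.
Context {R : realType}.
Implicit Types (U A : set R) (F : nat -> set R) (s delta : R).
Local Open Scope ereal_scope.

(* The element 0 only matters for [U = set0], whose supremum would be -oo. *)
Definition diam U : \bar R :=
  ereal_sup ([set 0] `|` [set `|x - y|%R%:E | x in U & y in U]).

(* Convention: |U|^0 = 1 for every nonempty U, singletons included, and the
   empty set contributes 0 for every exponent. *)
Definition hausdorff_gauge s U : \bar R :=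
  if U == set0 then 0 else diam U `^ s.

Definition delta_cover delta A F : Prop :=
  A `<=` \bigcup_i F i /\ forall i, diam (F i) <= delta%:E.

Definition hausdorff_premeasure s delta A : \bar R :=
  ereal_inf [set \sum_(0 <= i <oo) hausdorff_gauge s (F i)
            | F in [set F | delta_cover delta A F]].

Definition hausdorff_measure s A : \bar R :=
  ereal_sup [set hausdorff_premeasure s delta A
            | delta in [set delta : R | (0 < delta)%R]].

Definition hausdorff_dim A : \bar R :=
  ereal_inf [set s%:E | s in [set s : R | (0 <= s)%R /\
                                          hausdorff_measure s A = 0]].

End Hausdorff.

Section SelfSimilarIFS.
Context {R : realType} {m : nat}.
Implicit Types (lambda t : 'I_m.+1 -> R) (K : set R).

Definition ifs_map lambda t (j : 'I_m.+1) : R -> R :=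
  fun x => lambda j * x + t j.

Definition word_map lambda t (w : seq 'I_m.+1) : R -> R :=
  foldr (fun j f => ifs_map lambda t j \o f) idfun w.

Definition exact_overlaps lambda t : Prop :=
  exists n : nat, (1 <= n)%N /\
    exists w1 w2 : n.-tuple 'I_m.+1,
      w1 <> w2 /\ word_map lambda t w1 = word_map lambda t w2.

Definition is_attractor lambda t K : Prop :=
  [/\ compact K, K !=set0 & K = \bigcup_j (ifs_map lambda t j @` K)].

Definition is_similarity_dim lambda (s : R) : Prop :=
  0 <= s /\ \sum_(j < m.+1) `|lambda j| `^ s = 1.

(* The default value 0 is never used for contracting nonzero ratios: see
   [is_similarity_dim_inj] and [similarity_dimP]. *)
Definition similarity_dim lambda : R :=
  xget 0 [set s | is_similarity_dim lambda s].

Definition contraction_ratios lambda : Prop :=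
  forall j, [/\ -1 < lambda j, lambda j < 1 & lambda j != 0].

Lemma is_similarity_dim_inj lambda s s' : contraction_ratios lambda ->
  is_similarity_dim lambda s -> is_similarity_dim lambda s' -> s = s'.
Proof.
move=> lamP.
wlog ss' : s s' / s < s' => [H sP s'P|[_ s1] [_ s'1]].
  by case: (ltgtP s s') => // h; [|symmetry]; exact: (H _ _ h).
suff : \sum_(j < m.+1) `|lambda j| `^ s' < \sum_(j < m.+1) `|lambda j| `^ s.
  by rewrite s1 s'1 ltxx.
apply: ltr_sum => [|j _]; first by apply/hasP; exists ord0; rewrite ?mem_index_enum.
have [l1 l2 l0] := lamP j.
rewrite /powR normr_eq0 (negbTE l0) ltr_expR ltr_nM2r //.
by rewrite ln_lt0 // normr_gt0 l0 /= ltr_norml l1 l2.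
Qed.

Lemma similarity_dimP lambda : contraction_ratios lambda ->
  is_similarity_dim lambda (similarity_dim lambda).
Proof.
move=> lamP; apply: (@xgetPex _ 0 [set s | is_similarity_dim lambda s]).
pose f (s : R) := \sum_(j < m.+1) `|lambda j| `^ s.
have ln_lt j : ln `|lambda j| < 0.
  have [l1 l2 l0] := lamP j.
  by rewrite ln_lt0 // normr_gt0 l0 /= ltr_norml l1 l2.
have fE s : f s = \sum_(j < m.+1) expR (s * ln `|lambda j|).
  by apply: eq_bigr => j _; have [_ _ /negbTE l0] := lamP j;
    rewrite /powR normr_eq0 l0.
have fc : continuous f.
  have -> : f = fun s => \sum_(j < m.+1) expR (s * ln `|lambda j|).
    by apply/funext => s; exact: fE.
  move=> x; apply: cvg_big => [|j _]; first exact: add_continuous.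
  apply: (@continuous_comp _ _ _ (fun s : R => s * ln `|lambda j|) expR).
    exact: mulrr_continuous.
  exact: continuous_expR.
have f0 : 1 <= f 0.
  by rewrite fE; under eq_bigr do rewrite mul0r expR0;
    rewrite sumr_const card_ord ler1n.
pose T := \sum_(j < m.+1) (m.+1%:R / - ln `|lambda j|).
have T_ge j : m.+1%:R / - ln `|lambda j| <= T.
  rewrite /T (bigD1 j) //= lerDl sumr_ge0 // => i _.
  by rewrite divr_ge0 // oppr_ge0 ltW.
have T0 : 0 <= T.
  by apply: le_trans (T_ge ord0); rewrite divr_ge0 // oppr_ge0 ltW.
have fT : f T <= 1.
  rewrite fE; apply: (@le_trans _ _ (\sum_(j < m.+1) m.+1%:R^-1)); last first.
    by rewrite sumr_const card_ord -(mulr_natl m.+1%:R^-1) divff ?pnatr_eq0.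
  apply: ler_sum => j _.
  have: m.+1%:R <= T * - ln `|lambda j|.
    by rewrite -ler_pdivrMr // oppr_gt0.
  rewrite mulrN => h.
  rewrite -[T * _]opprK expRN lef_pV2 ?posrE ?expR_gt0 //.
  by apply: (le_trans h); apply: le_trans (expR_ge1Dx _); rewrite lerDr.
have [c c0T fc1] : exists2 c, c \in `[0, T] & f c = 1.
  apply: IVT => //; first exact: continuous_subspaceT.
  by rewrite ge_min le_max f0 fT orbT.
by exists c; split => //; move: c0T; rewrite in_itv /= => /andP[].
Qed.

End SelfSimilarIFS.

(* Main.v *)
(** The upper bound comes from covering [K] by its cylinders of level [n], or
    by intervals of equal length for exponents above 1.  For the lower bound,
    let [s' < min (1, dim_s)].  Grouping the words of a large length by the
    number of occurrences of each letter gives a homogeneous subsystem, of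
    algebraic ratio [lam], whose similarity dimension still exceeds [s'].  The
    point is that the entropy [H n n] of its [n]-letter sums at scale
    [|lam| ^ n] grows at rate at least [min (log #maps, - log |lam|)]; then
    there are enough separated words to bound a finite cover of [K] by counting.

    Suppose that the rate [h] is less than [- log |lam|].  In the sum of [k]
    independent copies of the [n]-letter sums, the Kaimanovich-Vershik
    inequality limits the growth of entropy, whereas exchanging the two members
    of pairs of close words (Littlewood-Offord) creates entropy at every scale
    where a single copy has some; hence [H n (n + p n) <= n (h + o(1))] for
    every [p].  The differences of [n]-letter sums that are smaller than
    [|lam| ^ (n + p n)] span a space of linear forms in the translations; for
    large [p], Cramer's rule and Liouville's bound for [lam] show that every
    difference in this span is tiny as well.  Submodularity of the entropy
    modulo these spaces makes them stabilize along [n = 2 ^ k n0] while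
    the entropy stays at most [n (h + o(1))].  If [h < log #maps], some
    difference of two words then lies in all of them, so it vanishes, which is
    an exact overlap. *)
Require Import Defs.
From HB Require Import structures.
From mathcomp Require Import all_boot all_order all_algebra perm.
From mathcomp Require Import all_classical all_reals all_analysis.
From mathcomp Require Import ring lra zify.
Set Implicit Arguments.
Unset Strict Implicit.
Unset Printing Implicit Defensive.
Import Order.TTheory GRing.Theory Num.Theory.
Import numFieldNormedType.Exports.
Local Open Scope ring_scope.

(** * Entropy of functions on finite uniform spaces *)

Section Entropy.
Context {R : realType}.

(** Replacing a sum by its grid cell costs a bounded amount of entropy, so the inequalities carry
    additive constants; division by [n] removes them, except where scales are compared, since there
    a constant is paid at every scale. The steps across scales therefore have a length [l = l0 + l']
    that makes this payment relatively small. With [L = - log |lam|], exchanging close words in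
    about [|lam| ^ (- 2 * l0)] copies yields entropy about [l0 * L], while the self-similar tail
    alone yields about [l * h]; the strict inequality [h < L] makes the exchange the larger source.
    Each copy also carries as a tag its own cell at scale [|lam| ^ n]: the tags account for
    [k * H n n] at both ends of the range of scales and cancel, which leaves only the
    superadditivity defect of [H n n], an [o(n)]. The spaces spanned by close differences need not
    be nested, hence they are intersected one after another. A drop of rank costs an error
    proportional to [n * eps], and the rank drops at most as often as there are translations; [eps]
    is chosen so that all drops together stay below the gap between [h] and [log #maps]. *)

Definition fsize (Om : finType) (T : eqType) (f : Om -> T) (w : Om) : nat :=
  #|[pred w' | f w' == f w]|.

Definition avg (Om : finType) (F : Om -> R) : R :=
  #|Om|%:R^-1 * \sum_w F w.

(** Shannon entropy of [f] under the uniform measure on [Om]. The average runs over points and not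
    over values, so [T] may be infinite. *)
Definition ent (Om : finType) (T : eqType) (f : Om -> T) : R :=
  avg (fun w => ln (#|Om|%:R / (fsize f w)%:R)).

Lemma fsize_gt0 (Om : finType) (T : eqType) (f : Om -> T) w :
  (0 < fsize f w)%N.
Proof. by apply/card_gt0P; exists w; rewrite !inE. Qed.

Lemma fsizeR_gt0 (Om : finType) (T : eqType) (f : Om -> T) w :
  0 < (fsize f w)%:R :> R.
Proof. by rewrite ltr0n fsize_gt0. Qed.

Lemma fsizeE (Om : finType) (T : eqType) (f : Om -> T) w :
  (fsize f w)%:R = \sum_w' (f w' == f w)%:R :> R.
Proof.
rewrite /fsize -sum1_card natr_sum big_mkcond; apply: eq_bigr => w' _.
by rewrite inE; case: eqP.
Qed.

Lemma cardR_gt0 (Om : finType) (w : Om) : 0 < #|Om|%:R :> R.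
Proof. by rewrite ltr0n; apply/card_gt0P; exists w. Qed.

Lemma ler_avg (Om : finType) (F G : Om -> R) :
  (forall w, F w <= G w) -> avg F <= avg G.
Proof. by move=> FG; rewrite ler_wpM2l ?invr_ge0//; apply: ler_sum => w _. Qed.

Lemma avgD (Om : finType) (F G : Om -> R) :
  avg (fun w => F w + G w) = avg F + avg G.
Proof. by rewrite /avg big_split/= mulrDr. Qed.

Lemma avgZ (Om : finType) (c : R) (F : Om -> R) :
  avg (fun w => c * F w) = c * avg F.
Proof. by rewrite /avg -mulr_sumr mulrCA. Qed.

Lemma avgB (Om : finType) (F G : Om -> R) :
  avg (fun w => F w - G w) = avg F - avg G.
Proof. by rewrite /avg sumrB mulrBr. Qed.

Lemma avg_cst (Om : finType) (c : R) : (0 < #|Om|)%N ->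
  avg (fun _ : Om => c) = c.
Proof.
by move=> Om0; rewrite /avg sumr_const -[c *+ _]mulr_natl mulKf// pnatr_eq0 -lt0n.
Qed.

Lemma avg_le (Om : finType) (F : Om -> R) (c : R) : 0 <= c ->
  (forall w, F w <= c) -> avg F <= c.
Proof.
move=> c0 Fc; have [Om0|Om0] := posnP #|Om|.
  by rewrite /avg Om0 invr0 mul0r.
by rewrite -[leRHS](avg_cst c Om0); exact: ler_avg.
Qed.

Lemma ln_le_subr1 (x : R) : 0 < x -> ln x <= x - 1.
Proof. by move=> x0; rewrite -{1}(subrKC 1 x) le_ln1Dx// ltrBrDl subrr. Qed.

Lemma sum_inv_fsize1 (Om : finType) (T : eqType) (f : Om -> T) (t : T) :
  \sum_w (f w == t)%:R / (fsize f w)%:R <= 1 :> R.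
Proof.
have [[w0 /eqP ft]|nt] := pselect (exists w, f w == t); last first.
  rewrite big1 ?ler01// => w _; case: eqP => [e|]; last by rewrite mul0r.
  by case: nt; exists w; rewrite e.
rewrite -ft (eq_bigr (fun w => (f w == f w0)%:R / (fsize f w0)%:R)).
  by rewrite -mulr_suml -fsizeE divff// gt_eqF// fsizeR_gt0.
move=> w _; case: eqP => [e|]; last by rewrite !mul0r.
by rewrite /fsize e.
Qed.

Lemma sum_inv_fsize (Om T : finType) (f : Om -> T) (F : T -> R) :
  (forall t, 0 <= F t) ->
  \sum_w F (f w) / (fsize f w)%:R <= \sum_t F t.
Proof.
move=> F0.
have E w : F (f w) / (fsize f w)%:R =
    \sum_t F t * ((f w == t)%:R / (fsize f w)%:R).
  rewrite (bigD1 (f w))//= eqxx mul1r big1 ?addr0// => t /negbTE.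
  by rewrite eq_sym => ->; rewrite mul0r mulr0.
rewrite (eq_bigr _ (fun w _ => E w)) exchange_big/=.
apply: ler_sum => t _; rewrite -mulr_sumr ler_piMr//.
exact: sum_inv_fsize1.
Qed.

Lemma ent_ge0 (Om : finType) (T : eqType) (f : Om -> T) : 0 <= ent f.
Proof.
rewrite mulr_ge0 ?invr_ge0// sumr_ge0// => w _.
rewrite ln_ge0// ler_pdivlMr ?fsizeR_gt0// mul1r ler_nat.
exact: max_card.
Qed.

Lemma ent_det (Om : finType) (S T : eqType) (f : Om -> S) (g : Om -> T) :
  (forall w w', f w = f w' -> g w = g w') -> ent g <= ent f.
Proof.
move=> fg; apply: ler_avg => w.
rewrite ler_ln ?posrE ?divr_gt0 ?fsizeR_gt0 ?(cardR_gt0 w)//.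
rewrite ler_wpM2l// lef_pV2 ?posrE ?fsizeR_gt0// ler_nat.
by apply/subset_leq_card/fintype.subsetP => w'; rewrite !inE => /eqP/fg ->.
Qed.

Lemma eq_ent (Om : finType) (S T : eqType) (f : Om -> S) (g : Om -> T) :
  (forall w w', f w = f w' <-> g w = g w') -> ent f = ent g.
Proof.
move=> fg; apply/eqP; rewrite eq_le !ent_det// => w w' /fg//.
Qed.

(* Gibbs' inequality; [q] need only be a sub-probability on the range of [f]. *)
Lemma ent_gibbs (Om : finType) (T : eqType) (f : Om -> T) (q : T -> R) :
  (forall w, 0 < q (f w)) -> \sum_w q (f w) / (fsize f w)%:R <= 1 ->
  ent f <= avg (fun w => - ln (q (f w))).
Proof.
move=> q0 q1; rewrite -subr_le0 /ent /avg -mulrBr -sumrB.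
have [Om0|/card_gt0P[w0 _]] := posnP #|Om|.
  by rewrite Om0 invr0 mul0r.
rewrite pmulr_rle0 ?invr_gt0 ?(cardR_gt0 w0)//.
apply: (@le_trans _ _ (\sum_w (#|Om|%:R * (q (f w) / (fsize f w)%:R) - 1))).
  apply: ler_sum => w _; rewrite opprK -lnM ?posrE ?divr_gt0 ?cardR_gt0 ?fsizeR_gt0//.
  rewrite -mulrA [_^-1 * _]mulrC.
  by rewrite ln_le_subr1// mulr_gt0 ?(cardR_gt0 w)// divr_gt0// fsizeR_gt0.
rewrite sumrB -mulr_sumr sumr_const subr_le0.
by rewrite -[X in _ <= X]mulr1 ler_wpM2l.
Qed.

Lemma ent_gibbs_fin (Om T : finType) (f : Om -> T) (q : T -> R) :
  (forall t, 0 < q t) -> \sum_t q t <= 1 ->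
  ent f <= avg (fun w => - ln (q (f w))).
Proof.
move=> q0 q1; apply: ent_gibbs => //.
by apply: le_trans q1; apply: sum_inv_fsize => t; exact/ltW.
Qed.

Lemma ent_le_card (Om T : finType) (f : Om -> T) : (0 < #|T|)%N ->
  ent f <= ln #|T|%:R.
Proof.
move=> T0; have T0' : 0 < #|T|%:R :> R by rewrite ltr0n.
have := @ent_gibbs_fin Om T f (fun=> #|T|%:R^-1) (fun _ => _).
rewrite lnV ?posrE// opprK => /(_ _ _)/le_trans; apply.
- by rewrite invr_gt0.
- by rewrite sumr_const -[_^-1 *+ _]mulr_natl divff// gt_eqF.
- by apply: avg_le => //; rewrite ln_ge0// ler1n.
Qed.

Lemma submod_ratio (N e h f g : R) :
  N != 0 -> e != 0 -> h != 0 -> f != 0 -> g != 0 ->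
  N / e * (N / h) / (N / f * (N / g)) = f * g / (e * h).
Proof. by move=> *; field; apply/and5P; split. Qed.

(** Shannon's submodularity. By [ln x <= x - 1] it is enough that the ratios of products of class
    sizes sum to at most [#|Om|]. *)
Lemma ent_submod (Om : finType) (S1 S2 S3 S4 : eqType)
    (f : Om -> S1) (g : Om -> S2) (h : Om -> S3) (e : Om -> S4) :
  (forall w w', f w = f w' -> h w = h w') ->
  (forall w w', g w = g w' -> h w = h w') ->
  (forall w w', f w = f w' -> g w = g w' -> e w = e w') ->
  ent e + ent h <= ent f + ent g.
Proof.
move=> fh gh fge; rewrite -subr_le0 /ent /avg -!mulrDr -mulrBr -!big_split -sumrB/=.
have [Om0|/card_gt0P[w0 _]] := posnP #|Om|.
  by rewrite Om0 invr0 mul0r.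
have N0 := cardR_gt0 w0.
rewrite pmulr_rle0 ?invr_gt0//.
pose P (S : eqType) (x : Om -> S) w : R := (fsize x w)%:R.
have P0 (S : eqType) (x : Om -> S) w : 0 < P S x w by exact: fsizeR_gt0.
pose j w := (f w, g w).
apply: (@le_trans _ _ (\sum_w (P _ f w * P _ g w / (P _ j w * P _ h w) - 1))).
  apply: ler_sum => w _.
  have Q0 (S : eqType) (x : Om -> S) : 0 < #|Om|%:R / (fsize x w)%:R :> R.
    by rewrite divr_gt0// fsizeR_gt0.
  rewrite -!lnM ?posrE ?Q0// -ln_div ?posrE ?(mulr_gt0 (Q0 _ _) (Q0 _ _))//.
  have -> : #|Om|%:R / (fsize e w)%:R * (#|Om|%:R / (fsize h w)%:R) /
      (#|Om|%:R / (fsize f w)%:R * (#|Om|%:R / (fsize g w)%:R)) =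
      P _ f w * P _ g w / (P _ e w * P _ h w).
    by apply: submod_ratio; rewrite lt0r_neq0// fsizeR_gt0.
  apply: le_trans (ln_le_subr1 _) _; first by rewrite divr_gt0 ?mulr_gt0.
  rewrite lerD2r; apply: ler_wpM2l; first by rewrite ltW// mulr_gt0.
  rewrite lef_pV2 ?posrE ?mulr_gt0//.
  apply: ler_wpM2r; first exact: ltW.
  rewrite ler_nat.
  by apply/subset_leq_card/fintype.subsetP => w'; rewrite !inE => /eqP[? ?]; exact/eqP/fge.
rewrite sumrB sumr_const subr_le0.
(* The product of the two class sizes at [w] counts pairs [u], [v]. When the sum over [w] is taken
   first, a pair with [h v = h u] keeps weight at most [1 / P _ h u], and the sum over [v] is then
   at most 1 for each [u]. *)
have E w : P _ f w * P _ g w / (P _ j w * P _ h w) =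
    \sum_u \sum_v (h v == h u)%:R / P _ h u * ((j w == (f u, g v))%:R / P _ j w).
  rewrite /P (fsizeE f) (fsizeE g) mulr_suml mulr_suml.
  apply: eq_bigr => u _; rewrite mulr_sumr mulr_suml; apply: eq_bigr => v _.
  rewrite xpair_eqE [f w == _]eq_sym [g w == _]eq_sym.
  case: (f u =P f w) => [fu|]; last by rewrite /= !(mul0r, mulr0).
  case: (g v =P g w) => [gv|]; last by rewrite /= !(mul0r, mulr0).
  rewrite (gh _ _ gv) (fh _ _ fu) eqxx /= mul1r !mul1r.
  by rewrite invfM mulrC /P /fsize (fh _ _ fu).
rewrite (eq_bigr _ (fun w _ => E w)) exchange_big/=.
apply: (@le_trans _ _ (\sum_(u : Om) (1 : R))); last by rewrite sumr_const.
apply: ler_sum => u _; rewrite exchange_big/=.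
apply: (@le_trans _ _ (\sum_v (h v == h u)%:R / P _ h u)); last first.
  by rewrite -mulr_suml /P -fsizeE divff// lt0r_neq0// fsizeR_gt0.
apply: ler_sum => v _; rewrite -mulr_sumr; apply: ler_piMr.
  by rewrite divr_ge0// ltW.
exact: sum_inv_fsize1.
Qed.

Lemma ent_pair_le (Om : finType) (S T : eqType) (f : Om -> S) (g : Om -> T) :
  ent (fun w => (f w, g w)) <= ent f + ent g.
Proof.
apply: (@le_trans _ _ (ent (fun w => (f w, g w)) + ent (fun _ : Om => tt))).
  by rewrite lerDl ent_ge0.
by apply: ent_submod => // w w' -> ->.
Qed.

Lemma avg_pair (A B : finType) (F : A * B -> R) :
  avg F = avg (fun a => avg (fun b => F (a, b))).
Proof.
rewrite /avg card_prod natrM invfM -mulrA -mulr_sumr; congr (_ * (_ * _)).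
by rewrite pair_bigA; apply: eq_bigr => -[].
Qed.

Lemma eq_avg (Om : finType) (F G : Om -> R) : F =1 G -> avg F = avg G.
Proof. by move=> FG; congr (_ * _); apply: eq_bigr => w _. Qed.

(** Chain rule: the average on the right is the entropy of [F] conditional on the first
    coordinate. *)
Lemma ent_prodl (A B : finType) (T : eqType) (F : A * B -> T) :
  (0 < #|A|)%N -> (0 < #|B|)%N ->
  ent (fun w => (w.1, F w)) = ln #|A|%:R + avg (fun a => ent (fun b => F (a, b))).
Proof.
move=> A0 B0.
have A0' : 0 < #|A|%:R :> R by rewrite ltr0n.
have B0' : 0 < #|B|%:R :> R by rewrite ltr0n.
rewrite -(avg_cst (ln #|A|%:R) A0) -avgD {1}/ent avg_pair; apply: eq_avg => a.
rewrite -[X in X + _](avg_cst _ B0) -avgD; apply: eq_avg => b.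
rewrite -lnM ?posrE ?divr_gt0 ?fsizeR_gt0// mulrA card_prod natrM.
congr (ln (_ / _%:R)).
rewrite /fsize -[RHS](card_imset _ (fun x y : B => (fun e : (a, x) = (a, y) => congr1 snd e))).
apply: eq_card => -[a' b'] /=; rewrite !inE xpair_eqE/=.
apply/andP/imsetP => [[/eqP -> Fb]|[x]]; first by exists b' => //; rewrite inE.
by rewrite inE => ? [-> ->].
Qed.

(** Equal fibers carry the uniform measure to the uniform measure. Invariance under bijections and
    the removal of independent coordinates are the two uses. *)
Lemma ent_constfiber (A B : finType) (T : eqType) (p : A -> B) (N : nat)
    (f : B -> T) : (0 < N)%N -> (forall b, #|[pred a | p a == b]| = N) ->
  ent (f \o p) = ent f.
Proof.
move=> N0 pN.
have sumE (F : B -> R) : \sum_a F (p a) = N%:R * \sum_b F b.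
  rewrite (partition_big p xpredT)//= mulr_sumr; apply: eq_bigr => b _.
  rewrite (eq_bigr (fun=> F b)); last by move=> a /eqP ->.
  by rewrite sumr_const mulr_natl -(pN b).
have cardE : #|A|%:R = N%:R * #|B|%:R :> R.
  by have := sumE (fun=> 1); rewrite !sumr_const.
have fibE a : (fsize (f \o p) a)%:R = N%:R * (fsize f (p a))%:R :> R.
  by rewrite !fsizeE/= (sumE (fun b => (f b == f (p a))%:R)).
have N0' : N%:R != 0 :> R by rewrite pnatr_eq0 -lt0n.
rewrite /ent /avg cardE.
rewrite (eq_bigr (fun a => ln (#|B|%:R / (fsize f (p a))%:R))).
  by rewrite (sumE (fun b => ln (#|B|%:R / (fsize f b)%:R))) invfM mulrACA mulVf// mul1r.
by move=> a _; rewrite fibE invfM mulrACA divff// mul1r.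
Qed.

Lemma ent_comp_bij (A B : finType) (T : eqType) (p : A -> B) (f : B -> T) :
  bijective p -> ent (f \o p) = ent f.
Proof.
move=> [q pq qp]; apply: (@ent_constfiber _ _ _ p 1) => // b.
rewrite (@eq_card _ _ (pred1 (q b))) ?card1// => a; rewrite !inE.
by apply/eqP/eqP => [<-|->].
Qed.

Lemma ent_fst (A B : finType) (T : eqType) (f : A -> T) : (0 < #|B|)%N ->
  ent (fun w : A * B => f w.1) = ent f.
Proof.
move=> B0; apply: (@ent_constfiber _ _ _ fst #|B|) => // a.
rewrite -[RHS](card_imset _ (fun x y : B => (fun e : (a, x) = (a, y) => congr1 snd e))).
apply: eq_card => -[a' b]; rewrite !inE/=; apply/eqP/imsetP => [->|[x _ [-> _]]//].
by exists b.
Qed.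

Lemma ent_snd (A B : finType) (T : eqType) (f : B -> T) : (0 < #|A|)%N ->
  ent (fun w : A * B => f w.2) = ent f.
Proof.
move=> A0; rewrite -(@ent_fst B A T f A0).
rewrite -(@ent_comp_bij (A * B)%type (B * A)%type _ (fun w => (w.2, w.1))) //.
by exists (fun w => (w.2, w.1)) => -[].
Qed.

Lemma fsize_prod (A B : finType) (S T : eqType) (f : A -> S) (g : B -> T) w :
  fsize (fun w : A * B => (f w.1, g w.2)) w = (fsize f w.1 * fsize g w.2)%N.
Proof.
rewrite /fsize -cardX; apply: eq_card => -[a b].
by rewrite !inE xpair_eqE.
Qed.

Lemma ent_prod (A B : finType) (S T : eqType) (f : A -> S) (g : B -> T) :
  (0 < #|A|)%N -> (0 < #|B|)%N ->
  ent (fun w : A * B => (f w.1, g w.2)) = ent f + ent g.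
Proof.
move=> A0 B0; have A0' : 0 < #|A|%:R :> R by rewrite ltr0n.
have B0' : 0 < #|B|%:R :> R by rewrite ltr0n.
rewrite -(avg_cst (ent g) A0) -avgD {1}/ent avg_pair; apply: eq_avg => a.
rewrite -[X in X + _](avg_cst _ B0) -avgD; apply: eq_avg => b.
rewrite fsize_prod card_prod !natrM invfM mulrACA lnM// posrE divr_gt0//.
  exact: fsizeR_gt0.
exact: fsizeR_gt0.
Qed.

(* The offset of [f] from a representative of its [g]-class takes at most
   [2 N + 1] values. *)
Lemma ent_close (Om : finType) (S T : eqType) (N : nat) (f : Om -> int)
    (g : Om -> T) (e : Om -> S) :
  (forall w w', g w = g w' -> e w = e w' /\ `|f w - f w'| <= N%:Z) ->
  ent (fun w => (f w, e w)) <= ent g + ln N.*2.+1%:R.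
Proof.
move=> gP.
pose rep w := odflt w [pick w' | g w' == g w].
have repP w : g (rep w) = g w.
  by rewrite /rep; case: pickP => [w' /eqP//|/(_ w)]; rewrite eqxx.
have rep_eq w w' : g w = g w' -> rep w = rep w'.
  rewrite /rep => gg; rewrite (@eq_pick _ _ (fun v => g v == g w')); last first.
    by move=> v /=; rewrite gg.
  by case: pickP => [//|/(_ w')]; rewrite eqxx.
pose c w : 'I_N.*2.+1 := inord (absz (f w - f (rep w) + N%:Z)).
have cE w : (c w : int) = f w - f (rep w) + N%:Z.
  have [_] := gP _ _ (esym (repP w)); rewrite ler_norml => /andP[l u].
  rewrite /c inordK; first by rewrite gez0_abs//; lia.
  by lia.
apply: (@le_trans _ _ (ent (fun w => (g w, c w)))).
  apply: ent_det => w w' [gg cc].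
  have [ee _] := gP _ _ gg; rewrite ee; congr (_, _).
  have := cE w; rewrite cc cE (rep_eq _ _ gg); lia.
apply: le_trans (ent_pair_le _ _) _; rewrite lerD2l.
by rewrite (le_trans (ent_le_card _ _))// card_ord.
Qed.

(** Gibbs' inequality against the geometric weights [2 ^- i.+1]; it turns a bound on a mean into a
    bound on entropy. *)
Lemma ent_nat (Om : finType) (f : Om -> nat) :
  ent f <= ln 2 * avg (fun w => (f w).+1%:R).
Proof.
pose N := (\max_w f w).+1.
have fN w : (f w < N)%N by rewrite ltnS leq_bigmax.
pose g w : 'I_N := Ordinal (fN w).
have -> : ent f = ent g.
  by apply: eq_ent => w w'; split => [fw|[]//]; exact/val_inj.
apply: le_trans (@ent_gibbs_fin _ _ g (fun i => (2 ^- i.+1)) _ _) _.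
- by move=> i; rewrite invr_gt0 exprn_gt0.
- suff E n : \sum_(i < n) (2 ^- i.+1 : R) = 1 - 2 ^- n.
    by rewrite E lerBlDr lerDl invr_ge0 exprn_ge0.
  elim: n => [|n IH]; first by rewrite big_ord0 expr0 invr1 subrr.
  rewrite big_ord_recr/= IH exprS invfM; lra.
- rewrite -avgZ; apply: ler_avg => w.
  by rewrite lnV ?posrE ?exprn_gt0// opprK lnXn// mulr_natr.
Qed.

End Entropy.

(** * Littlewood-Offord bound *)

Section LittlewoodOfford.
Context {R : realType}.

(** Consecutive central coefficients have ratio [2 * (2 * k + 1) / (k + 1)], and [4 * (2 * k + 1) *
    (2 * k + 3) <= 16 * (k + 1) ^ 2]. The squared form keeps a bound of order [4 ^ k / sqrt k]
    within the integers. *)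
Lemma central_bin_le (k : nat) : ('C(k.*2, k) ^ 2 * k.*2.+1 <= 16 ^ k)%N.
Proof.
elim: k => [//|k IH].
have E1 : 'C(k.+1.*2, k.+1) = ('C(k.*2.+1, k).*2)%N.
  have -> : (k.+1.*2 = k.*2.+2)%N by lia.
  rewrite binS (_ : 'C(k.*2.+1, k.+1) = 'C(k.*2.+1, k)) ?addnn//.
  by rewrite -bin_sub; [congr binomial; lia | lia].
have E2 : (k.+1 * 'C(k.*2.+1, k) = k.*2.+1 * 'C(k.*2, k))%N.
  by rewrite (mul_bin_down k.*2.+1 k); congr (_ * _)%N; lia.
rewrite -(@leq_pmul2l (k.+1 ^ 2)) ?expn_gt0// mulnA -expnMn E1 -doubleMr E2.
rewrite [(16 ^ k.+1)%N]expnS; move: ('C(k.*2, k)) (16 ^ k)%N IH => c N IH.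
have -> : ((k.*2.+1 * c).*2 ^ 2 * k.+1.*2.+1 =
  (4 * k.*2.+1 * k.*2.+3) * (c ^ 2 * k.*2.+1))%N.
  have -> : (k.+1.*2.+1 = k.*2.+3)%N by lia.
  by rewrite -[_.*2 in LHS]muln2; move: k.*2.+1 k.*2.+3 => a b; lia.
have H : (4 * k.*2.+1 * k.*2.+3 <= k.+1 ^ 2 * 16)%N by lia.
by apply: leq_trans (leq_mul (leqnn _) IH) _; rewrite mulnA; apply: leq_mul.
Qed.

Lemma bin_le_central (k s : nat) : ('C(k.*2, s) <= 'C(k.*2, k))%N.
Proof.
suff H i : ('C(k.*2, k - i) <= 'C(k.*2, k))%N.
  have [sk|ks] := leqP s k; first by have := H (k - s)%N; rewrite subKn.
  have [s2|s2] := leqP s k.*2; last by rewrite bin_small.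
  rewrite -bin_sub//; have := H (s - k)%N; congr (_ <= _)%N; congr binomial; lia.
elim: i => [|i IH]; first by rewrite subn0.
apply: leq_trans IH; have [ik|ki] := leqP k i.
  by rewrite (_ : (k - i.+1 = k - i)%N)//; lia.
have -> : (k - i = (k - i.+1).+1)%N by lia.
have := mul_bin_left k.*2 (k - i.+1); move: ('C(_, _)) ('C(_, _)) => a b E.
have : (0 < (k - i.+1).+1)%N by [].
nia.
Qed.

Lemma bin_sqr_le (n s : nat) : ('C(n, s) ^ 2 * n <= 4 ^ n)%N.
Proof.
have E (k : nat) : (4 ^ k.*2 = 16 ^ k)%N by rewrite -muln2 mulnC expnM.
have := odd_double_half n; move: (odd n) n./2 => b k <-.
have C0 := central_bin_le k.
case: b; last first.
  rewrite add0n E; apply: leq_trans C0; apply: leq_mul => //.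
  by rewrite leq_exp2r// bin_le_central.
rewrite add1n [(4 ^ _)%N]expnS E; apply: (@leq_trans ((2 * 'C(k.*2, k)) ^ 2 * k.*2.+1)%N).
  rewrite leq_mul2r/= leq_exp2r//; case: s => [|s].
    by rewrite bin0 muln_gt0 bin_gt0; lia.
  by rewrite binS; have := bin_le_central k s; have := bin_le_central k s.+1; lia.
by rewrite expnMn -mulnA leq_mul2l/=.
Qed.

(* The Lubell-Yamamoto-Meshalkin inequality. *)
Lemma lym (J : finType) (P : pred {set J}) :
  (forall A B, P A -> P B -> A \subset B -> A = B) ->
  forall E : {set J},
    \sum_(A : {set J} | (A \subset E) && P A) ('C(#|E|, #|A|)%:R)^-1 <= 1 :> R.
Proof.
move=> antiP E; have [n En] := ubnP #|E|.
elim: n E En => // n IH E /ltnSE En.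
have [PE|nPE] := boolP (P E).
  rewrite (big_pred1 E) ?binn ?invr1// => A /=.
  apply/andP/eqP => [[AE PA]|->]; last by rewrite fintype.subxx.
  exact: antiP.
have [E0|E0] := posnP #|E|.
  rewrite big1 ?ler01// => A /andP[AE PA].
  move/eqP: E0; rewrite cards_eq0 => /eqP E0; move: AE nPE.
  by rewrite E0 finset.subset0 => /eqP <-; rewrite PA.
have En0 : 0 < #|E|%:R :> R by rewrite ltr0n.
(* Deletion of a random point of [E]: each inverse binomial for [E] is an average of those for the
   sets [E :\ j], where the induction hypothesis applies. *)
have step (A : {set J}) : (A \subset E) && P A ->
    ('C(#|E|, #|A|)%:R)^-1 =
    #|E|%:R^-1 * \sum_(j in E | A \subset E :\ j) ('C(#|E|.-1, #|A|)%:R)^-1 :> R.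
  move=> /andP[AE PA].
  have AltE : (#|A| < #|E|)%N.
    rewrite proper_card// finset.properEneq AE andbT.
    by apply: contraNneq nPE => <-.
  rewrite sumr_const -[_^-1 *+ _]mulr_natl.
  have -> : #|[pred j | (j \in E) && (A \subset E :\ j)]| = (#|E| - #|A|)%N.
    rewrite -cardsDS//; apply: eq_card => j; rewrite !inE subsetD1 AE/= andbC.
    by [].
  have C0 : 0 < 'C(#|E|, #|A|)%:R :> R by rewrite ltr0n bin_gt0 ltnW.
  have C1 : 0 < 'C(#|E|.-1, #|A|)%:R :> R by rewrite ltr0n bin_gt0; lia.
  have -> : (#|E| - #|A|)%:R =
      #|E|%:R * 'C(#|E|.-1, #|A|)%:R / 'C(#|E|, #|A|)%:R :> R.
    by rewrite -natrM mul_bin_down natrM mulfK// lt0r_neq0.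
  by field; rewrite !lt0r_neq0.
rewrite (eq_bigr _ step) -mulr_sumr ler_pdivrMl// mulr1.
rewrite (exchange_big_dep (mem E))/=; last by move=> A j _ /andP[].
apply: (@le_trans _ _ (\sum_(j in E) (1 : R))); last first.
  by rewrite sumr_const.
apply: ler_sum => j jE.
have cj : #|E :\ j| = #|E|.-1 by rewrite (cardsD1 j E) jE.
rewrite -cj (le_trans _ (IH (E :\ j) _))//; last by rewrite cj; lia.
rewrite le_eqVlt (eq_bigl (fun A : {set J} => (A \subset E :\ j) && P A)) ?eqxx// => A.
rewrite jE/= subsetD1.
by case: (A \subset E); case: (P A); case: (j \notin A).
Qed.

Lemma sperner (J : finType) (P : pred {set J}) (E : {set J}) :
  (forall A B, P A -> P B -> A \subset B -> A = B) ->
  (#|[pred A : {set J} | (A \subset E) && P A]| ^ 2 * #|E| <= 4 ^ #|E|)%N.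
Proof.
move=> antiP; set N := #|[pred A : {set J} | _]|; have [E0|E0] := posnP #|E|.
  by rewrite E0 muln0.
have [N0|N0] := posnP N; first by rewrite N0.
have := lym antiP E.
have C (A : {set J}) : (A \subset E) && P A -> (#|E|%:R : R) <= 4 ^+ #|E| * ('C(#|E|, #|A|)%:R^-1) ^+ 2.
  move=> /andP[AE _]; have C0 : 0 < 'C(#|E|, #|A|)%:R :> R.
    by rewrite ltr0n bin_gt0 subset_leq_card.
  rewrite exprVn ler_pdivlMr ?exprn_gt0// mulrC -!natrX -natrM ler_nat.
  exact: bin_sqr_le.
set m := #|E| in C E0 *.
have m0 : 0 < m%:R :> R by rewrite ltr0n.
have D (A : {set J}) : (A \subset E) && P A -> Num.sqrt m%:R / 2 ^+ m <= 'C(m, #|A|)%:R^-1 :> R.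
  move=> /C h; rewrite ler_pdivrMr ?exprn_gt0//.
  rewrite -(@ler_pXn2r _ 2)// ?nnegrE ?sqrtr_ge0 ?mulr_ge0 ?invr_ge0 ?exprn_ge0//.
  rewrite sqr_sqrtr ?ler0n// exprMn -exprM mulnC exprM mulrC.
  by have -> : 2 ^+ 2 = 4%:R :> R; [rewrite -natrX | move: h; lra].
move=> le1; have : (N%:R * (Num.sqrt m%:R / 2 ^+ m)) <= 1 :> R.
  apply: le_trans le1; rewrite /N mulr_natl -sumr_const.
  by apply: ler_sum => A; exact: D.
rewrite mulrA ler_pdivrMr ?exprn_gt0// mul1r.
rewrite -(@ler_pXn2r _ 2)// ?nnegrE ?mulr_ge0 ?sqrtr_ge0 ?exprn_ge0//.
rewrite exprMn sqr_sqrtr ?ler0n// -exprM mulnC exprM.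
by have -> : 2 ^+ 2 = 4%:R :> R; [rewrite -natrX | rewrite -!natrX -natrM ler_nat].
Qed.

End LittlewoodOfford.

Section RandomSigns.
Context {R : realType}.

Definition cell (rho x : R) : int := Num.floor (x / rho).

Lemma cell_itv (rho x : R) : 0 < rho ->
  (cell rho x)%:~R * rho <= x < (cell rho x)%:~R * rho + rho.
Proof.
move=> r0; have /andP[l u] := floor_itv (x / rho).
rewrite -ler_pdivlMr// l/=; move: u; rewrite ltr_pdivrMr// intrD mulrDl mul1r.
by [].
Qed.

Lemma eq_cell (rho x y : R) : 0 < rho -> cell rho x = cell rho y ->
  `|x - y| < rho.
Proof.
move=> r0 xy; have /andP[] := cell_itv x r0; have /andP[] := cell_itv y r0.
rewrite xy; move: (_ * rho) => c; rewrite ltr_norml => *; apply/andP; split; lra.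
Qed.

Lemma cell_close (N : nat) (rho x y : R) : 0 < rho ->
  `|x - y| <= N%:R * rho -> `|cell rho x - cell rho y| <= N.+1%:Z.
Proof.
move=> r0; have /andP[] := cell_itv x r0; have /andP[] := cell_itv y r0.
rewrite !ler_norml => h1 h2 h3 h4 /andP[h5 h6].
have N2 : (N.+2%:Z%:~R : R) * rho = N%:R * rho + 2 * rho.
  by rewrite -pmulrn -[N.+2]addn2 natrD mulrDl.
have : (- N.+2%:Z < cell rho x - cell rho y).
  by rewrite -(ltr_int R) -(ltr_pM2r r0) intrN intrB mulNr mulrBl N2; lra.
have : (cell rho x - cell rho y < N.+2%:Z).
  by rewrite -(ltr_int R) -(ltr_pM2r r0) intrB mulrBl N2; lra.
lia.
Qed.

Lemma ent_cell_le (Om : finType) (T S : eqType) (N : nat) (rho : R)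
    (f : Om -> R) (g : Om -> T) (e : Om -> S) : 0 < rho ->
  (forall w w', g w = g w' -> e w = e w' /\ `|f w - f w'| <= N%:R * rho) ->
  ent (fun w => (cell rho (f w), e w)) <= ent g + ln (N.+1).*2.+1%:R :> R.
Proof.
move=> r0 H; apply: ent_close => w w' /H[ee ff]; split => //.
exact: cell_close.
Qed.

(** Erdos' argument. Fix the part of [A] outside [J0]. Inside [J0] every new element raises the sum
    by at least [a], the length of the half-open window, so the admissible sets form an antichain
    and [sperner] counts them. *)
Lemma subset_sum_count (J : finType) (d : J -> R) (a x : R) :
  (forall j, 0 <= d j) ->
  #|[pred A : {set J} | x <= \sum_(j in A) d j < x + a]|%:R *
    Num.sqrt #|[set j | a <= d j]|%:R <= 2 ^+ #|J| :> R.
Proof.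
move=> d0; set J0 := [set j | a <= d j]; set P := [pred A : {set J} | _].
have [m0|m0] := posnP #|J0|; first by rewrite m0 sqrtr0 mulr0 exprn_ge0.
have m0' : 0 < Num.sqrt #|J0|%:R :> R by rewrite sqrtr_gt0 ltr0n.
have -> : #|P|%:R = \sum_(A | P A) (1 : R) by rewrite sumr_const.
rewrite -ler_pdivlMr// (partition_big (fun A : {set J} => A :\: J0)
  (mem (powerset (~: J0))))/=; last by move=> A _; rewrite powersetE subsetDr.
apply: (@le_trans _ _ (\sum_(C in powerset (~: J0))
    2 ^+ #|J0| / Num.sqrt #|J0|%:R)); last first.
  rewrite sumr_const card_powerset -[_ *+ _]mulr_natl mulrA ler_wpM2r ?invr_ge0 ?sqrtr_ge0//.
  by rewrite natrX -exprD addnC cardsC.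
apply: ler_sum => C; rewrite powersetE -finset.disjoints_subset => CJ.
rewrite sumr_const ler_pdivlMr//.
pose Q := [pred A : {set J} | (A \subset J0) && P (C :|: A)].
have antiQ A B : Q A -> Q B -> A \subset B -> A = B.
  move=> /andP[AJ /andP[xA _]] /andP[BJ /andP[_ Bx]] AB; apply/eqP.
  rewrite finset.eqEsubset AB/=; apply/fintype.subsetP => j jB; apply: contraT => jA.
  have sumU (D : {set J}) : D \subset J0 ->
      \sum_(i in C :|: D) d i = \sum_(i in C) d i + \sum_(i in D) d i.
    move=> DJ; rewrite -bigU ?(disjointWr DJ CJ)//=.
    by apply: eq_bigl => i; rewrite !inE.
  move: xA Bx; rewrite !sumU// (big_setD1 j jB)/= => xA Bx.
  have ad : a <= d j by have := fintype.subsetP BJ _ jB; rewrite inE.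
  have : \sum_(i in A) d i <= \sum_(i in B :\ j) d i.
    have jBA : A \subset B :\ j by rewrite subsetD1 AB jA.
    rewrite [leRHS](big_setID A)/= (finset.setIidPr jBA) lerDl.
    by apply: sumr_ge0 => i _.
  lra.
have CQ : #|[pred A : {set J} | P A & A :\: J0 == C]| = #|[pred A : {set J} | (A \subset J0) && Q A]|.
  rewrite -[RHS](card_in_imset (f := fun A : {set J} => C :|: A)); last first.
    move=> A B; rewrite !inE => /andP[AJ _] /andP[BJ _] /setP E.
    apply/setP => j; have := E j; rewrite !inE.
    case: (boolP (j \in C)) => //= jC _.
    have jJ : (j \in J0) = false by apply: (disjointFr CJ).
    have nin (D : {set J}) : D \subset J0 -> (j \in D) = false.
      by move=> DJ; apply: contraFF jJ => /(fintype.subsetP DJ).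
    by rewrite (nin A AJ) (nin B BJ).
  apply: eq_card => A; rewrite !inE; apply/andP/imsetP => [[PA /eqP AC]|[B]].
    exists (A :&: J0); last by rewrite -AC finset.setUC finset.setID.
    by rewrite !inE subsetIr/= -AC finset.setUC finset.setID.
  rewrite !inE => /and3P[BJ _ PB] ->; split => //.
  apply/eqP/setP => j; rewrite finset.in_setD finset.in_setU.
  case: (boolP (j \in C)) => /= jC; first by rewrite (disjointFr CJ jC).
  by apply/andP => -[jJ /(fintype.subsetP BJ)]; rewrite (negbTE jJ).
rewrite [#|_|]CQ; have := @sperner R J Q J0 antiQ; move: #|_| #|J0| => N m.
rewrite -(ler_nat R) natrM !natrX => H.
rewrite -(@ler_pXn2r _ 2)// ?nnegrE ?mulr_ge0 ?sqrtr_ge0 ?exprn_ge0//.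
rewrite exprMn sqr_sqrtr ?ler0n// (le_trans H)// -!exprM mulnC exprM.
by have -> : 2 ^+ 2 = 4%:R :> R by rewrite -natrX.
Qed.

(** Reduction to subset sums: the sum of the minima is the base point, and [h b] is the set of
    indices where the larger value is taken. *)
Lemma signed_sum_count (J : finType) (u v : J -> R) (a x : R) :
  #|[pred b : {ffun J -> bool} |
      x <= \sum_j (if b j then u j else v j) < x + a]|%:R *
    Num.sqrt #|[set j | a <= `|u j - v j|]|%:R <= 2 ^+ #|J| :> R.
Proof.
set m := \sum_j Num.min (u j) (v j).
apply: le_trans (@subset_sum_count J (fun j => `|u j - v j|) a (x - m) _); last by [].
rewrite ler_wpM2r ?sqrtr_ge0// ler_nat.
pose h (b : {ffun J -> bool}) : {set J} := [set j | b j == (v j <= u j)].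
have hinj : injective h.
  move=> b c /setP E; apply/ffunP => j; have := E j; rewrite !inE.
  by case: (b j); case: (c j); case: (_ <= _).
rewrite -(card_imset _ hinj); apply/subset_leq_card/fintype.subsetP => A /imsetP[b].
rewrite !inE => bx ->.
suff -> : \sum_(j in h b) `|u j - v j| = \sum_j (if b j then u j else v j) - m.
  by move: bx => /andP[? ?]; apply/andP; split; lra.
rewrite /m -sumrB [LHS]big_mkcond; apply: eq_bigr => j _; rewrite inE.
case: (leP (v j) (u j)) => vu; case: (b j) => /=.
- by rewrite ger0_norm ?subr_ge0.
- by rewrite subrr.
- by rewrite subrr.
- by rewrite ltr0_norm ?subr_lt0// opprB.
Qed.

(** No cell holds more than a fraction [1 / sqrt m] of the sign vectors, which bounds every term of
    the average defining the entropy. *)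
Lemma ent_signed_sum_ge (J : finType) (u v : J -> R) (a : R) : 0 < a ->
  (0 < #|[set j | (a <= `|u j - v j|)%R]|)%N ->
  ln (#|[set j | a <= `|u j - v j|]|%:R : R) / 2 <=
  ent (fun b : {ffun J -> bool} => cell a (\sum_j (if b j then u j else v j))).
Proof.
move=> a0 m0; set m : R := #|_|%:R.
have m0' : 0 < m :> R by rewrite ltr0n.
have c0 : (0 < #|{ffun J -> bool}|)%N by rewrite card_ffun card_bool expn_gt0.
rewrite -(avg_cst (ln m / 2) c0); apply: ler_avg => b.
have -> : ln m / 2 = ln (Num.sqrt m).
  have : ln (Num.sqrt m ^+ 2) = ln (Num.sqrt m) *+ 2 by rewrite lnXn ?sqrtr_gt0.
  by rewrite sqr_sqrtr ?ltW// => ->; rewrite mulr2n; lra.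
set S := fun b : {ffun J -> bool} => _.
have f0 := @fsizeR_gt0 R _ _ S b.
rewrite ler_ln ?posrE ?sqrtr_gt0 ?divr_gt0 ?ltr0n ?fsize_gt0//.
rewrite ler_pdivlMr// mulrC card_ffun card_bool natrX.
apply: le_trans (@signed_sum_count J u v a ((S b)%:~R * a)).
rewrite ler_wpM2r ?sqrtr_ge0// ler_nat.
apply/subset_leq_card/fintype.subsetP => b'; rewrite !inE => /eqP <-.
exact: cell_itv.
Qed.

Lemma sign_second_moment (J : finType) (d : J -> R) :
  avg (fun b : {ffun J -> bool} => (\sum_j (if b j then d j else - d j)) ^+ 2) =
  \sum_j d j ^+ 2.
Proof.
have c0 : (0 < #|{ffun J -> bool}|)%N by rewrite card_ffun card_bool expn_gt0.
rewrite -[RHS](avg_cst _ c0) /avg; congr (_ * _).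
pose s (b : {ffun J -> bool}) j := if b j then d j else - d j.
rewrite (eq_bigr (fun b => \sum_i \sum_j s b i * s b j)); last first.
  by move=> b _; rewrite expr2 big_distrlr.
rewrite exchange_big [RHS]exchange_big/=; apply: eq_bigr => i _.
rewrite exchange_big (bigD1 i)//= [X in _ + X]big1 ?addr0.
  by apply: eq_bigr => b _; rewrite /s; case: (b i); rewrite expr2// mulrNN.
move=> j ji.
(* Changing the sign at [i] alone negates every cross term. *)
pose flip (b : {ffun J -> bool}) : {ffun J -> bool} := [ffun l => b l (+) (l == i)].
have flipK : involutive flip.
  by move=> b; apply/ffunP => l; rewrite !ffunE addbK.
suff : \sum_b s b i * s b j = - \sum_b s b i * s b j by lra.
rewrite {1}(reindex_inj (inv_inj flipK)) -sumrN; apply: eq_bigr => b _.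
rewrite /s !ffunE eqxx (negbTE ji) addbF addbT.
by case: (b i) => /=; rewrite ?mulNr ?opprK.
Qed.

(** The centred sum [W] has standard deviation at most [rho / 2], so its cell index is bounded in
    mean: [3 * ln 2] pays for the absolute value, [ln 2] for the sign, and [ln 5] for undoing the
    centring. *)
Lemma ent_signed_sum_le (J : finType) (u v : J -> R) (rho : R) : 0 < rho ->
  \sum_j (u j - v j) ^+ 2 <= rho ^+ 2 ->
  ent (fun b : {ffun J -> bool} => cell rho (\sum_j (if b j then u j else v j)))
    <= ln 2 * 4 + ln 5 :> R.
Proof.
move=> r0 var.
pose d j := (u j - v j) / 2.
pose W (b : {ffun J -> bool}) := \sum_j (if b j then d j else - d j).
pose c := \sum_j (u j + v j) / 2.
have SE (b : {ffun J -> bool}) : \sum_j (if b j then u j else v j) = c + W b.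
  rewrite /c /W -big_split; apply: eq_bigr => j _; rewrite /d; case: (b j) => /=; lra.
pose g b := (absz (cell rho (W b)), cell rho (W b) < 0).
have c0 : (0 < #|{ffun J -> bool}|)%N by rewrite card_ffun card_bool expn_gt0.
apply: (@le_trans _ _ (ent g + ln 5)); last first.
  rewrite lerD2r (le_trans (ent_pair_le _ _))//.
  have : ent (fun b => cell rho (W b) < 0) <= ln 2 :> R.
    by rewrite (le_trans (ent_le_card _ _))// card_bool.
  have := @ent_nat R _ (fun b => absz (cell rho (W b))).
  have : avg (fun b => (absz (cell rho (W b))).+1%:R) <= 3 :> R.
    (* The absolute cell index is at most [|y| + 1], and [|y| <= (1 + y ^ 2) / 2]. *)
    apply: (@le_trans _ _ (avg (fun b => 5 / 2 + (2 * rho ^+ 2)^-1 * W b ^+ 2))).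
      apply: ler_avg => b; rewrite -natr1 natr_absz.
      set y := W b / rho.
      have -> : (2 * rho ^+ 2)^-1 * W b ^+ 2 = y ^+ 2 / 2.
        by rewrite /y exprMn exprVn; field; rewrite lt0r_neq0.
      have /andP[l1 l2] := floor_itv y.
      rewrite intr_norm; move: l1 l2; rewrite -/(cell _ _) intrD.
      have := sqr_ge0 (y - 1); have := sqr_ge0 (y + 1); rewrite !expr2.
      move: (_%:~R) => z s1 s2 l1 l2; rewrite -lerBrDr ler_norml.
      by apply/andP; split; lra.
    rewrite avgD avg_cst// (avgZ _ (fun b => W b ^+ 2)) [avg _]sign_second_moment.
    rewrite (eq_bigr (fun j => 4^-1 * (u j - v j) ^+ 2)); last first.
      by move=> j _; rewrite /d; field.
    rewrite -mulr_sumr; have r2 : 0 < rho ^+ 2 by rewrite exprn_gt0.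
    have : (2 * rho ^+ 2)^-1 * (4^-1 * \sum_j (u j - v j) ^+ 2) <= 1 / 2.
      by rewrite ler_pdivrMl ?mulr_gt0//; lra.
    lra.
  have : 0 < ln 2 :> R by rewrite ln_gt0// ltr1n.
  nra.
pose S (b : {ffun J -> bool}) := \sum_j (if b j then u j else v j).
apply: (@le_trans _ _ (ent (fun b => (cell rho (S b), tt)))).
  by apply: ent_det => b b' [].
apply: (@ent_cell_le _ _ _ 1) => // b b' [ab sb]; split=> //.
rewrite mul1r /S !SE.
suff /(eq_cell r0) : cell rho (W b) = cell rho (W b').
  by move=> /ltW; congr (`|_| <= _); lra.
move: ab sb; lia.
Qed.

End RandomSigns.

(** * Sums of independent copies *)

Section KaimanovichVershik.
Context {R : realType}.

(** Submodularity for the pairs (second point, [x + z]) and (first point, [y + z]): each determines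
    the triple sum with its tags, and together they determine [z]. *)
Lemma ent_sum3 (A B C : finType) (V : zmodType) (S T : eqType)
    (x : A -> V) (y : B -> V) (z : C -> V) (c : A -> S) (d : B -> T) :
  (0 < #|A|)%N -> (0 < #|B|)%N -> (0 < #|C|)%N ->
  ent (fun w : A * (B * C) => (x w.1 + (y w.2.1 + z w.2.2), (c w.1, d w.2.1)))
    + ent z <=
  ent (fun w : A * C => (x w.1 + z w.2, c w.1)) +
  ent (fun w : B * C => (y w.1 + z w.2, d w.1)) :> R.
Proof.
move=> A0 B0 C0; have AC0 : (0 < #|{: A * C}|)%N by rewrite card_prod muln_gt0 A0.
have BC0 : (0 < #|{: B * C}|)%N by rewrite card_prod muln_gt0 B0.
pose f (w : A * (B * C)) := (w.2.1, (x w.1 + z w.2.2, c w.1)).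
pose g (w : A * (B * C)) := (w.1, (y w.2.1 + z w.2.2, d w.2.1)).
pose e (w : A * (B * C)) := (w.1, (w.2.1, z w.2.2)).
have fE : ent f = ent (@id B) + ent (fun w : A * C => (x w.1 + z w.2, c w.1)) :> R.
  rewrite -ent_prod// -(@ent_comp_bij _ (A * (B * C))%type _ _
    (fun w => (w.2.1, (w.1, w.2.2))))//.
  by exists (fun w => (w.2.1, (w.1, w.2.2))) => -[? []].
have gE : ent g = ent (@id A) + ent (fun w : B * C => (y w.1 + z w.2, d w.1)) :> R.
  by rewrite -ent_prod.
have eE : ent e = ent (@id A) + (ent (@id B) + ent z) :> R.
  by rewrite -ent_prod// -ent_prod.
have := @ent_submod R _ _ _ _ _ f g
  (fun w => (x w.1 + (y w.2.1 + z w.2.2), (c w.1, d w.2.1))) e.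
rewrite fE gE eE => /(_ _ _ _) H.
suff : ent (@id A) + (ent (@id B) + ent z) +
    ent (fun w : A * (B * C) => (x w.1 + (y w.2.1 + z w.2.2), (c w.1, d w.2.1))) <=
    ent (@id B) + ent (fun w : A * C => (x w.1 + z w.2, c w.1)) +
    (ent (@id A) + ent (fun w : B * C => (y w.1 + z w.2, d w.1))) :> R by lra.
apply: H => -[a [b t]] [a' [b' t']] /=.
- by case=> -> xz ->; congr (_, _); rewrite addrCA xz addrCA.
- by case=> -> -> ->.
- by case=> -> xz _; rewrite /g /= => -[aa _]; move: xz; rewrite /e /= aa => /addrI ->.
Qed.

Definition ffcons (k : nat) (W : finType) (w : W * {ffun 'I_k -> W}) :
  {ffun 'I_k.+1 -> W} :=
  [ffun i => if unlift ord0 i is Some j then w.2 j else w.1].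

Lemma ffcons0 k (W : finType) (w : W * {ffun 'I_k -> W}) : ffcons w ord0 = w.1.
Proof. by rewrite ffunE unlift_none. Qed.

Lemma ffconsS k (W : finType) (w : W * {ffun 'I_k -> W}) j :
  ffcons w (lift ord0 j) = w.2 j.
Proof. by rewrite ffunE liftK. Qed.

Lemma ffcons_bij k (W : finType) : bijective (@ffcons k W).
Proof.
pose q (v : {ffun 'I_k.+1 -> W}) : W * {ffun 'I_k -> W} :=
  (v ord0, [ffun j : 'I_k => v (lift ord0 j)]).
exists q => [[w u]|v].
  rewrite /q ffcons0; congr (_, _).
  by apply/ffunP => j; rewrite ffunE ffconsS.
apply/ffunP => i; rewrite ffunE /=; case: unliftP => [j|] -> //.
by rewrite ffunE.
Qed.

Lemma card_ffun_gt0 k (W : finType) : (0 < #|W|)%N -> (0 < #|{ffun 'I_k -> W}|)%N.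
Proof. by move=> W0; rewrite card_ffun expn_gt0 W0. Qed.

(* The Kaimanovich-Vershik inequality, conditionally on the tags [c]. *)
Lemma ent_iter_sum (W C : finType) (V : zmodType) (S : eqType)
    (x : W -> V) (z : C -> V) (c : W -> S) (k : nat) :
  (0 < #|W|)%N -> (0 < #|C|)%N ->
  ent (fun w : {ffun 'I_k -> W} * C =>
         (\sum_j x (w.1 j) + z w.2, [ffun j => c (w.1 j)])) <=
  ent z + k%:R * (ent (fun w : W * C => (x w.1 + z w.2, c w.1)) - ent z) :> R.
Proof.
move=> W0 C0; elim: k => [|k IH].
  rewrite mul0r addr0 -(ent_snd z (card_ffun_gt0 0 W0)).
  by apply: ent_det => -[u a] [v b] /= ->; rewrite !big_ord0; congr (_, _);
    apply/ffunP => -[].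
have := ent_sum3 x (fun u : {ffun 'I_k -> W} => \sum_j x (u j)) z c
  (fun u : {ffun 'I_k -> W} => [ffun j => c (u j)] : {ffun 'I_k -> S})
  W0 (card_ffun_gt0 k W0) C0.
set e3 := ent _; set e1 := ent _ in IH *; set e2 := ent _ in IH *.
move=> H; rewrite -natr1 mulrDl mul1r.
suff : ent (fun w : {ffun 'I_k.+1 -> W} * C =>
         (\sum_j x (w.1 j) + z w.2, [ffun j => c (w.1 j)])) <= e3.
  by move=> H2; lra.
pose p (w : W * ({ffun 'I_k -> W} * C)) := (ffcons (w.1, w.2.1), w.2.2).
have pbij : bijective p.
  have [q pq qp] := ffcons_bij k W.
  exists (fun v => ((q v.1).1, ((q v.1).2, v.2))) => [[w [u a]]|[v a]].
    by rewrite /p/= pq.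
  by rewrite /p/= -surjective_pairing qp.
rewrite -(ent_comp_bij _ pbij); apply: ent_det => -[w [u a]] [w' [u' a']] /=.
have xsum v : \sum_j x (ffcons v (lift ord0 j)) = \sum_j x (v.2 j).
  by apply: eq_bigr => j _; rewrite ffconsS.
rewrite !big_ord_recl !ffcons0 !xsum -!addrA => -[E1 E2 E3]; congr (_, _) => //.
apply/ffunP => i; rewrite !ffunE.
case: unliftP => [j _|_] //=.
by have /ffunP/(_ j) := E3; rewrite !ffunE.
Qed.

Lemma ent_iter_indep (W : finType) (S : eqType) (c : W -> S) (k : nat) :
  (0 < #|W|)%N ->
  ent (fun w : {ffun 'I_k -> W} => [ffun j => c (w j)]) = k%:R * ent c :> R.
Proof.
move=> W0; elim: k => [|k IH].
  rewrite mul0r /ent /avg big1 ?mulr0// => w _.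
  have -> : fsize (fun w : {ffun 'I_0 -> W} => [ffun j => c (w j)]) w =
      #|{ffun 'I_0 -> W}|.
    by apply: eq_card => v; rewrite !inE; apply/eqP/ffunP => -[].
  by rewrite divff ?ln1// lt0r_neq0// ltr0n card_ffun_gt0.
rewrite -(ent_comp_bij _ (ffcons_bij k W)) -natr1 mulrDl mul1r -IH addrC.
rewrite -ent_prod ?card_ffun_gt0//; apply: eq_ent => -[w u] [w' u'] /=; split.
  move=> /ffunP E; congr (_, _).
    by have := E ord0; rewrite !ffunE !unlift_none.
  by apply/ffunP => j; have := E (lift ord0 j); rewrite !ffunE !liftK.
move=> [E1 /ffunP E2]; apply/ffunP => i; rewrite !ffunE.
case: unliftP => [j _|_] //=.
by have := E2 j; rewrite !ffunE.
Qed.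

End KaimanovichVershik.

(** * Matchings of close words *)

Section Matching.
Context {R : realType}.

(** Take an involution that moves as many points as possible: two related fixed points could be
    exchanged as well. *)
Lemma maximal_matching (W : finType) (r : rel W) :
  symmetric r -> irreflexive r ->
  exists p : W -> W, [/\ involutive p, forall w, p w != w -> r w (p w) &
    forall w w', p w = w -> p w' = w' -> ~~ r w w'].
Proof.
move=> rsym rirr.
pose P (p : {ffun W -> W}) :=
  [forall w, (p (p w) == w) && ((p w != w) ==> r w (p w))].
pose F (p : {ffun W -> W}) := #|[pred w | p w != w]|.
have P0 : P [ffun w => w] by apply/forallP => w; rewrite !ffunE !eqxx.
case: (arg_maxnP F P0) => p /forallP Pp pmax; exists p; split.
- by move=> w; have /andP[/eqP] := Pp w.
- by move=> w; have /andP[_ /implyP] := Pp w.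
move=> w w' pw pw'; apply/negP => rww'.
have ww' : w != w' by apply: contraTneq rww' => ->; rewrite rirr.
pose q : {ffun W -> W} := [ffun v => if v == w then w' else if v == w' then w else p v].
have pK v : p (p v) = v by have /andP[/eqP] := Pp v.
have Pq : P q.
  apply/forallP => v; rewrite !ffunE.
  have [->|vw] := eqVneq v w.
    by rewrite ?eqxx [w' == w]eq_sym (negbTE ww') ?eqxx rww' implybT.
  have [->|vw'] := eqVneq v w'; first by rewrite ?eqxx rsym rww' implybT.
  have pvw : p v != w by apply: contraNneq vw => h; rewrite -(pK v) h pw.
  have pvw' : p v != w' by apply: contraNneq vw' => h; rewrite -(pK v) h pw'.
  rewrite (negbTE pvw) (negbTE pvw'); exact: Pp.
have := pmax _ Pq; apply/negP; rewrite -ltnNge; apply: proper_card.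
apply/properP; split; last first.
  by exists w; rewrite !inE ?ffunE ?eqxx ?pw ?eqxx// eq_sym.
apply/fintype.subsetP => v; rewrite !inE ffunE.
have [->|vw] := eqVneq v w; first by rewrite pw eqxx.
by have [->|//] := eqVneq v w'; rewrite pw' eqxx.
Qed.

(** All unmatched points of a [kap]-class lie within [a] of each other; only matched points need an
    offset from the representative. The Gibbs weights give one half to the value [ord0] reserved for
    unmatched points and share the rest among [M] offsets, hence the price [ln 2] plus [ln M] times
    the proportion of matched points. *)
Lemma ent_unmatched_le (W : finType) (T : eqType) (X : W -> R) (kap : W -> T)
    (a : R) (N : nat) (p : W -> W) : 0 < a ->
  (forall w w', kap w = kap w' -> `|X w - X w'| <= N%:R * a) ->
  (forall w w', p w = w -> p w' = w' -> kap w = kap w' -> `|X w - X w'| < a) ->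
  ent (fun w => (cell a (X w), kap w)) <=
  ent kap + ln 5 + ln 2 +
    avg (fun w => (p w != w)%:R) * ln (N.+1).*2.+1%:R :> R.
Proof.
move=> a0 kapX punm; pose M := (N.+1).*2.+1.
pose rep w := odflt w [pick w' | kap w' == kap w].
have repP w : kap (rep w) = kap w.
  by rewrite /rep; case: pickP => [w' /eqP//|/(_ w)]; rewrite eqxx.
have rep_eq w w' : kap w = kap w' -> rep w = rep w'.
  rewrite /rep => gg; rewrite (@eq_pick _ _ (fun v => kap v == kap w')); last first.
    by move=> v /=; rewrite gg.
  by case: pickP => [//|/(_ w')]; rewrite eqxx.
pose o w : 'I_M.+1 := if p w == w then ord0 else
  lift ord0 (inord (absz (cell a (X w) - cell a (X (rep w)) + N.+1%:Z))).
pose g w := (kap w, o w).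
have : ent o <= ln 2 + avg (fun w => (p w != w)%:R) * ln M%:R :> R.
  pose q (i : 'I_M.+1) : R := if i == ord0 then 2^-1 else (2 * M%:R)^-1.
  have M0 : 0 < M%:R :> R by rewrite ltr0n.
  have q0 i : 0 < q i by rewrite /q; case: ifP => _; rewrite invr_gt0 ?mulr_gt0.
  have q1 : \sum_i q i <= 1.
    rewrite big_ord_recl /q eqxx (eq_bigr (fun=> (2 * M%:R)^-1))//.
    rewrite sumr_const card_ord -[_^-1 *+ _]mulr_natl invfM.
    by rewrite mulrCA divff ?gt_eqF// mulr1; lra.
  apply: le_trans (ent_gibbs_fin o q0 q1) _.
  have [W0|W0] := posnP #|W|.
    rewrite /avg W0 invr0 !mul0r addr0; apply/ltW/ln_gt0; lra.
  rewrite -[ln 2 in leRHS](avg_cst _ W0) mulrC -avgZ -avgD; apply: ler_avg => w.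
  rewrite /o /q; case: (p w =P w) => _ /=.
    by rewrite lnV ?posrE// opprK mulr0 addr0.
  by rewrite lnV ?posrE ?mulr_gt0// opprK lnM ?posrE// mulr1.
have : ent g <= ent kap + ent o :> R by exact: ent_pair_le.
suff : ent (fun w => (cell a (X w), kap w)) <= ent g + ln 5 :> R by rewrite -/M; lra.
apply: (@ent_close _ _ _ _ 2) => w w' [kk oo]; split=> //.
have range v : `|cell a (X v) - cell a (X (rep v))| <= N.+1%:Z.
  by apply: cell_close => //; apply: kapX; rewrite repP.
move: oo; rewrite /o; case: eqP => pw; case: eqP => pw' //.
  by move=> _; apply: (@cell_close _ 1) => //; rewrite mul1r ltW// punm.
move=> /lift_inj/(congr1 val); rewrite /= !inordK.
- rewrite (rep_eq _ _ kk); have := range w; have := range w'.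
  by rewrite (rep_eq _ _ kk); lia.
- by have := range w'; rewrite /M; lia.
- by have := range w; rewrite /M; lia.
Qed.

End Matching.

Section EntropyExtras.
Context {R : realType}.

Lemma ent_cell_le1 (Om : finType) (T : eqType) (N : nat) (rho : R)
    (f : Om -> R) (g : Om -> T) : 0 < rho ->
  (forall w w', g w = g w' -> `|f w - f w'| <= N%:R * rho) ->
  ent (fun w => cell rho (f w)) <= ent g + ln (N.+1).*2.+1%:R :> R.
Proof.
move=> r0 H; apply: (@le_trans _ _ (ent (fun w => (cell rho (f w), tt)))).
  by apply: ent_det => w w' [].
by apply: ent_cell_le => // w w' /H.
Qed.

Lemma ent_cell_shift (Om : finType) (rho : R) (f g : Om -> R) (c : R) : 0 < rho ->
  (forall w, f w = c + g w) ->
  ent (fun w => cell rho (g w)) <= ent (fun w => cell rho (f w)) + ln 5 :> R.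
Proof.
move=> r0 fg; apply: (@ent_cell_le1 _ _ 1) => // w w' /(eq_cell r0)/ltW.
by rewrite !fg mul1r; congr (`|_| <= _); lra.
Qed.

(** Conditioning does not increase entropy, so a lower bound on every fiber is inherited. *)
Lemma ent_ge_cond (A B : finType) (T : eqType) (F : A * B -> T) (c : R) :
  (0 < #|A|)%N -> (0 < #|B|)%N ->
  (forall a, c <= ent (fun b => F (a, b))) -> c <= ent F.
Proof.
move=> A0 B0 H.
have := ent_pair_le (R := R) (fun w : A * B => w.1) F.
rewrite ent_prodl// => h.
have := @ent_fst R A B A id B0; have := @ent_le_card R _ _ (@id A) A0.
have : c <= avg (fun a => ent (fun b => F (a, b))).
  by rewrite -(avg_cst c A0); exact: ler_avg.
by move: h => /=; lra.
Qed.

Lemma ent_ge_condr (A B : finType) (T : eqType) (F : A * B -> T) (c : R) :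
  (0 < #|A|)%N -> (0 < #|B|)%N ->
  (forall b, c <= ent (fun a => F (a, b))) -> c <= ent F.
Proof.
move=> A0 B0 H; pose sw (w : B * A) := (w.2, w.1).
rewrite -(@ent_comp_bij _ (B * A)%type _ _ sw); last first.
  by exists (fun w => (w.2, w.1)) => -[].
exact: ent_ge_cond.
Qed.

Lemma avg_bij (A B : finType) (p : A -> B) (F : B -> R) : bijective p ->
  avg (F \o p) = avg F.
Proof.
by move=> pb; rewrite /avg (bij_eq_card pb) [in RHS](reindex p) //; apply: onW_bij.
Qed.

Lemma avg_ffun_sum (W : finType) (F : W -> R) (k : nat) : (0 < #|W|)%N ->
  avg (fun u : {ffun 'I_k -> W} => \sum_j F (u j)) = k%:R * avg F.
Proof.
move=> W0; elim: k => [|k IH].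
  by rewrite mul0r /avg big1 ?mulr0// => u _; rewrite big_ord0.
rewrite -(avg_bij _ (ffcons_bij k W)) avg_pair -natr1 mulrDl mul1r -IH addrC.
rewrite -[X in _ + X](avg_cst _ W0) -avgD; apply: eq_avg => w /=.
rewrite -[X in X + _](avg_cst _ (card_ffun_gt0 k W0)) -avgD; apply: eq_avg => u.
rewrite big_ord_recl ffcons0; congr (_ + _).
by apply: eq_bigr => j _; rewrite ffconsS.
Qed.

(** The loss in [ent_cell_le] for a displacement of [2 * N0 + 1] cells: two tails differ by at most
    [2 * N0] after rescaling, and one more cell is the uncertainty inside a cell. *)
Definition Cw (N0 : nat) : R := ln (N0.*2.+2).*2.+1%:R.

Lemma Cw_ge5 (N0 : nat) : ln 5 <= Cw N0.
Proof. by rewrite ler_ln ?posrE// ler_nat; lia. Qed.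

Lemma ln5_gt0 : 0 < ln 5 :> R. Proof. by rewrite ln_gt0// ltr1n. Qed.

End EntropyExtras.

(** * Entropy of word sums at a given scale *)

Section Words.
Context {R : realType} {I : finType}.
Implicit Types (lam : R) (t : I -> R) (s : seq I).

(** The image of 0 under the composition of the maps [x -> lam * x + t a]; together with the length
    of the word it determines the composed map. *)
Definition rsum lam t s : R := foldr (fun a v => t a + lam * v) 0 s.

Lemma rsum_cat lam t s1 s2 :
  rsum lam t (s1 ++ s2) = rsum lam t s1 + lam ^+ size s1 * rsum lam t s2.
Proof.
elim: s1 => [|a s1 IH] /=; first by rewrite add0r mul1r.
by rewrite IH mulrDr addrA exprS mulrA.
Qed.

Lemma rsum_bounded lam t : `|lam| < 1 ->
  exists N : nat, forall s, `|rsum lam t s| <= N%:R.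
Proof.
move=> l1; pose T := \sum_i `|t i|; pose B := T / (1 - `|lam|).
have T0 : 0 <= T by apply: sumr_ge0.
have l1' : 0 < 1 - `|lam| by rewrite subr_gt0.
have BB s : `|rsum lam t s| <= B.
  elim: s => [|a s IH] /=; first by rewrite normr0 divr_ge0// ltW.
  apply: le_trans (ler_normD _ _) _; rewrite normrM.
  have tT : `|t a| <= T by rewrite /T (bigD1 a)//= lerDl sumr_ge0.
  have : B = T + `|lam| * B by rewrite /B; field; rewrite lt0r_neq0.
  by have := ler_wpM2l (normr_ge0 lam) IH; lra.
exists (Num.truncn B).+1 => s; apply: le_trans (BB s) _.
by apply/ltW/truncnS_gt.
Qed.

Definition catw n m (w : n.-tuple I * m.-tuple I) : (n + m).-tuple I :=
  [tuple of w.1 ++ w.2].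

Lemma catw_bij n m : bijective (@catw n m).
Proof.
apply: inj_card_bij; last by rewrite card_prod !card_tuple expnD.
move=> [w v] [w' v'] /(congr1 val)/= /eqP.
by rewrite eqseq_cat ?size_tuple// => /andP[/eqP ? /eqP ?]; congr (_, _); exact/val_inj.
Qed.

Lemma card_word n : (0 < #|I|)%N -> (0 < #|{: n.-tuple I}|)%N.
Proof. by move=> I0; rewrite card_tuple expn_gt0 I0. Qed.

Definition went lam t (n i : nat) : R :=
  ent (fun s : n.-tuple I => cell (`|lam| ^+ i) (rsum lam t s)).

End Words.

Section WordEntropy.
Context {R : realType} {I : finType}.
Context (lam : R) (t : I -> R) (N0 : nat).
Context (I0 : (0 < #|I|)%N).
Context (lam0 : lam != 0).
Context (lam1 : `|lam| < 1).
Context (N0P : forall s, `|rsum lam t s| <= N0%:R).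
Local Notation r := `|lam|.
Local Notation X := (rsum lam t).
Local Notation H := (went lam t).

Lemma rX_gt0 i : 0 < r ^+ i.
Proof. by rewrite exprn_gt0// normr_gt0. Qed.

Lemma rX_le i j : (i <= j)%N -> r ^+ j <= r ^+ i.
Proof. by move=> ij; apply: ler_wiXn2l => //; exact: ltW. Qed.

Lemma went_ge0 n i : 0 <= H n i. Proof. exact: ent_ge0. Qed.

Lemma rsum_dist s s' : `|X s - X s'| <= N0.*2%:R.
Proof.
apply: le_trans (ler_normB _ _) _; have := N0P s; have := N0P s'.
by rewrite -addnn natrD; lra.
Qed.

(** At a scale [i <= n], a change in the letters after the first [n] moves the sum by at most
    [2 * N0] cells. *)
Lemma went_prefix_le n m i : (i <= n)%N -> H n i <= H (n + m) i + Cw N0.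
Proof.
move=> i_n; have r0 := rX_gt0 i.
rewrite /went -(ent_comp_bij _ (catw_bij n m)).
rewrite -(@ent_fst R _ (m.-tuple I))//; last exact: card_word.
apply: (@ent_cell_le1 _ _ _ N0.*2.+1) => // -[w v] [w' v'] /= /(eq_cell r0).
rewrite !rsum_cat !size_tuple => lt1.
have := rsum_dist v v'; have := rX_le i_n.
set y := X v - X v'; have -> : X w - X w' =
  (X w + lam ^+ n * X v - (X w' + lam ^+ n * X v')) - lam ^+ n * y by rewrite /y; lra.
move=> rn ym; apply: le_trans (ler_normB _ _) _; rewrite normrM normrX.
rewrite -natr1 mulrDl mul1r addrC; apply: lerD; last exact: ltW.
by rewrite mulrC; apply: ler_pM.
Qed.

Lemma went_prefix_ge n m i : (i <= n)%N -> H (n + m) i <= H n i + Cw N0.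
Proof.
move=> i_n; have r0 := rX_gt0 i.
rewrite /went -(ent_comp_bij _ (catw_bij n m)).
rewrite -(@ent_fst R _ (m.-tuple I) _ (fun s : n.-tuple I => cell _ (X s)))//; last exact: card_word.
apply: (@ent_cell_le1 _ _ _ N0.*2.+1) => // -[w v] [w' v'] /= /(eq_cell r0).
rewrite !rsum_cat !size_tuple => lt1.
have := rsum_dist v v'; have := rX_le i_n.
set y := X v - X v'; have -> : (X w + lam ^+ n * X v - (X w' + lam ^+ n * X v')) =
  X w - X w' + lam ^+ n * y by rewrite /y; lra.
move=> rn ym; apply: le_trans (ler_normD _ _) _; rewrite normrM normrX.
rewrite -natr1 mulrDl mul1r addrC; apply: lerD; last exact: ltW.
by rewrite mulrC; apply: ler_pM.
Qed.

Lemma went_scaled n m i (c : R) (f : m.-tuple I -> R) :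
  (forall v, f v = c + lam ^+ n * X v) ->
  H m i <= ent (fun v => cell (r ^+ (n + i)) (f v)) + ln 5.
Proof.
move=> fE; apply: (@ent_cell_le1 _ _ _ 1); first exact: rX_gt0.
move=> v v' /(eq_cell (rX_gt0 _)); rewrite !fE mul1r.
have -> : c + lam ^+ n * X v - (c + lam ^+ n * X v') = lam ^+ n * (X v - X v').
  by rewrite mulrBr; lra.
by rewrite normrM normrX exprD ltr_pM2l ?rX_gt0// => /ltW.
Qed.

Lemma went_scaled_le n m i :
  ent (fun v : m.-tuple I => cell (r ^+ (n + i)) (lam ^+ n * X v)) <= H m i + ln 5.
Proof.
apply: (@ent_cell_le1 _ _ _ 1); first exact: rX_gt0.
move=> v v' /(eq_cell (rX_gt0 _)); rewrite mul1r -mulrBr.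
by rewrite normrM normrX exprD ler_pM2l ?rX_gt0// => /ltW.
Qed.

(** Given the first [n] letters, the rest is a copy of the system scaled by [lam ^+ n].
    Submodularity, with the coarse cell [G] of the prefix as the common function, compares this
    conditional entropy with the total one. *)
Lemma went_superadd n m : H n n + H m m <= H (n + m) (n + m) + (Cw N0 + ln 5).
Proof.
pose F (w : n.-tuple I * m.-tuple I) := cell (r ^+ (n + m)) (X w.1 + lam ^+ n * X w.2).
pose G (w : n.-tuple I * m.-tuple I) := cell (r ^+ n) (X w.1).
have n0 := card_word n I0; have m0 := card_word m I0.
have HE : H (n + m) (n + m) = ent F.
  rewrite /went -(ent_comp_bij _ (catw_bij n m)); congr ent.
  by apply/funext => -[w v]; rewrite /= rsum_cat size_tuple.
have HG : H n n = ent G by rewrite /went -(@ent_fst R _ (m.-tuple I) _ (fun s : n.-tuple I => cell _ (X s))).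
have FG : ent (fun w => (G w, F w)) <= ent F + Cw N0 :> R.
  rewrite /Cw; apply: (@ent_cell_le _ _ _ _ N0.*2.+1); first exact: rX_gt0.
  move=> [w v] [w' v'] FF; split=> //; move: FF => /(eq_cell (rX_gt0 _)) /= lt1.
  have := rsum_dist v v'; have := rX_le (leq_addr m n).
  set y := X v - X v'; have -> : X w - X w' =
    (X w + lam ^+ n * X v - (X w' + lam ^+ n * X v')) - lam ^+ n * y by rewrite /y; lra.
  move=> rn ym; apply: le_trans (ler_normB _ _) _; rewrite normrM normrX.
  rewrite -natr1 mulrDl mul1r [leRHS]addrC; apply: lerD; first exact: le_trans (ltW lt1) rn.
  by rewrite mulrC; apply: ler_pM.
have := @ent_submod R _ _ _ _ _ (fun w => (G w, F w)) (fun w => w.1) G (fun w => (w.1, F w)).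
move=> /(_ _ _ _) sm.
have : ent (fun w => (w.1, F w)) + ent G <=
    ent (fun w => (G w, F w)) + ent (fun w : n.-tuple I * m.-tuple I => w.1) :> R.
  apply: sm => w w'; first by case.
    by rewrite /G => ->.
  by case=> _ -> ->.
rewrite ent_prodl// HE HG.
have : H m m <= avg (fun w => ent (fun v => F (w, v))) + ln 5.
  rewrite -lerBlDr -[X in X <= _](avg_cst _ n0); apply: ler_avg => w.
  by rewrite lerBlDr; apply: (@went_scaled n m m (X w) (fun v => X w + lam ^+ n * X v)).
have := ent_le_card (R := R) (@id (n.-tuple I)) n0.
have := @ent_fst R _ (m.-tuple I) _ (@id (n.-tuple I)) m0.
by move: FG; lra.
Qed.

End WordEntropy.

(** * Entropy gained by exchanging close words *)

Section Block.
Context {R : realType} {I : finType}.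
Context (lam : R) (t : I -> R) (N0 : nat).
Context (I0 : (0 < #|I|)%N) (lam0 : lam != 0) (lam1 : `|lam| < 1).
Context (N0P : forall s, `|rsum lam t s| <= N0%:R).
Local Notation r := `|lam|.
Local Notation X := (rsum lam t).
Local Notation H := (went lam t).

(** The last summand plays two parts: it is the smoothing variable in the Kaimanovich-Vershik
    inequality, and it supplies entropy at the scales beyond [n]. *)
Definition multi_sum (k n m : nat) (w : {ffun 'I_k -> n.-tuple I} * m.-tuple I) : R :=
  \sum_j X (w.1 j) + lam ^+ n * X w.2.

Definition tags (T : eqType) (k n : nat) (c : n.-tuple I -> T)
    (u : {ffun 'I_k -> n.-tuple I}) : {ffun 'I_k -> T} :=
  [ffun j => c (u j)].

Definition swapw (k n : nat) (p : n.-tuple I -> n.-tuple I)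
    (u : {ffun 'I_k -> n.-tuple I}) (b : {ffun 'I_k -> bool}) :=
  [ffun j => if b j then p (u j) else u j].

(** Exchange along independent signs preserves the uniform measure, so the signs can be introduced
    without changing any entropy of the sum. *)
Lemma swapw_bij (k n m1 m2 : nat) (p : n.-tuple I -> n.-tuple I) : involutive p ->
  bijective (fun w : ({ffun 'I_k -> n.-tuple I} * m1.-tuple I) *
                     ({ffun 'I_k -> bool} * m2.-tuple I) =>
    ((swapw p w.1.1 w.2.1, catw (w.1.2, w.2.2)), w.2.1)).
Proof.
move=> pK; have [g gK Kg] := @catw_bij I m1 m2.
have sK (u : {ffun 'I_k -> n.-tuple I}) b : swapw p (swapw p u b) b = u.
  by apply/ffunP => j; rewrite !ffunE; case: (b j).
exists (fun w => ((swapw p w.1.1 w.2, (g w.1.2).1), (w.2, (g w.1.2).2))).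
  by move=> [[u v1] [b v2]] /=; rewrite sK gK.
by move=> [[u v] b] /=; rewrite sK -surjective_pairing Kg.
Qed.

Definition Cb : R := ln 2 * 4 + 3 * ln 5 + ln (N0.*2.+2).*2.+1%:R.

(* Given the pair [(w_j, p w_j)] and the first letters of the tail, the
   remaining randomness consists of independent signs and of a small copy of
   the system; each of the two sources bounds the fine entropy from below, and
   the signs do not contribute to the coarse entropy. *)
Lemma block_gain (k n i n2 l0 l : nat) (T : eqType) (c : n.-tuple I -> T)
    (p : n.-tuple I -> n.-tuple I) :
  involutive p -> (forall w, c (p w) = c w) ->
  (forall w, `|X (p w) - X w| <= r ^+ (n + i + l0)) ->
  k%:R * (r ^+ l0) ^+ 2 <= 1 ->
  avg (fun u : {ffun 'I_k -> n.-tuple I} => Num.max (H n2 l)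
    (ln #|[set j | r ^+ (n + i + l) <= `|X (p (u j)) - X (u j)|]|%:R / 2)) <=
  ent (fun w => (cell (r ^+ (n + i + l)) (multi_sum (k := k) (n := n) (m := i + n2) w), tags c w.1)) -
  ent (fun w => (cell (r ^+ (n + i)) (multi_sum (k := k) (n := n) (m := i + n2) w), tags c w.1)) + Cb.
Proof.
move=> pK cp pX kr.
have n0 := card_word n I0; have n20 := card_word n2 I0; have i0 := card_word i I0.
have u0 := card_ffun_gt0 k n0.
have b0 : (0 < #|{ffun 'I_k -> bool}|)%N by apply: card_ffun_gt0; rewrite card_bool.
have rl0 := rX_gt0 lam0 (n + i + l); have ri0 := rX_gt0 lam0 (n + i).
pose Y := @multi_sum k n (i + n2).
pose phi w := cell (r ^+ (n + i + l)) (Y w).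
pose psi w := cell (r ^+ (n + i)) (Y w).
pose tag (w : {ffun 'I_k -> n.-tuple I} * (i + n2).-tuple I) := tags c w.1.
rewrite -/Y.
have step1 : ent (fun w => (psi w, (phi w, tag w))) <= ent (fun w => (phi w, tag w)) + ln 5 :> R.
  apply: (@ent_cell_le _ _ _ _ 1) => // w w' E; split=> //.
  case: E => /(eq_cell rl0)/ltW h _; apply: le_trans h _; rewrite mul1r.
  by apply: rX_le => //; exact: leq_addr.
pose q (w : ({ffun 'I_k -> n.-tuple I} * i.-tuple I) *
            ({ffun 'I_k -> bool} * n2.-tuple I)) :=
   (swapw p w.1.1 w.2.1, catw (w.1.2, w.2.2)).
have entq (S : eqType) (F : _ -> S) : ent (F \o q) = ent F :> R.
  have /= <- := @ent_fst R _ {ffun 'I_k -> bool} _ F b0.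
  by rewrite -(ent_comp_bij _ (swapw_bij k i n2 pK)).
have tagq w : tag (q w) = tags c w.1.1.
  by apply/ffunP => j; rewrite !ffunE; case: (w.2.1 j).
(* Once [w.1] is given the tags are fixed, because [p] preserves [c]; hence the gain from [psi] to
   [phi] is at least the gain conditional on [w.1], up to [step1]. *)
have sm : ent (fun w => (w.1, phi (q w))) + ent (fun w => (psi (q w), tag (q w))) <=
    ent (fun w => (psi (q w), (phi (q w), tag (q w)))) +
    ent (fun w => (w.1, psi (q w))) :> R.
  apply: ent_submod => w w'; first by case=> -> _ ->.
    by rewrite !tagq => -[-> ->].
  by case=> _ -> _ [-> _].
rewrite (entq _ (fun w => (psi w, tag w))) (entq _ (fun w => (psi w, (phi w, tag w)))) in sm.
rewrite !ent_prodl// in sm; try by rewrite card_prod muln_gt0 ?u0 ?b0.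
pose e0 := ({ffun 'I_k -> n.-tuple I} * i.-tuple I)%type.
have YqE (e : e0) b v2 : Y (q (e, (b, v2))) =
    \sum_j (if b j then X (p (e.1 j)) else X (e.1 j)) + (lam ^+ n * X e.2 + lam ^+ (n + i) * X v2).
  rewrite /Y /multi_sum /q /= rsum_cat size_tuple mulrDr mulrA -exprD.
  by congr (_ + _); apply: eq_bigr => j _; rewrite ffunE; case: (b j).
have coarse (e : e0) : ent (fun w => psi (q (e, w))) <=
    ln 2 * 4 + ln 5 + ln (N0.*2.+2).*2.+1%:R :> R.
  pose S (b : {ffun 'I_k -> bool}) := \sum_j (if b j then X (p (e.1 j)) else X (e.1 j)).
  (* By [kr] the squared displacements of the [k] exchanges sum to at most the square of one
     cell. *)
  have h1 : ent (fun b => cell (r ^+ (n + i)) (S b)) <= ln 2 * 4 + ln 5 :> R.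
    apply: ent_signed_sum_le => //.
    apply: (@le_trans _ _ (\sum_(j < k) (r ^+ (n + i + l0)) ^+ 2)).
      apply: ler_sum => j _; rewrite -(real_normK (num_real _)) ler_pXn2r ?nnegrE ?exprn_ge0//.
    rewrite sumr_const card_ord -[_ *+ k]mulr_natl exprD exprMn mulrCA.
    by rewrite ler_piMr// exprn_ge0// ltW.
  have h2 : ent (fun w => psi (q (e, w))) <=
      ent (fun w : _ * n2.-tuple I => cell (r ^+ (n + i)) (S w.1)) + ln (N0.*2.+2).*2.+1%:R :> R.
    apply: (@ent_cell_le1 _ _ _ N0.*2.+1) => // -[b v] [b' v'] /= /(eq_cell ri0) lt1.
    rewrite !YqE -/(S b) -/(S b').
    set y := X v - X v'.
    have -> : S b + (lam ^+ n * X e.2 + lam ^+ (n + i) * X v) -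
      (S b' + (lam ^+ n * X e.2 + lam ^+ (n + i) * X v')) =
      (S b - S b') + lam ^+ (n + i) * y by rewrite /y; lra.
    apply: le_trans (ler_normD _ _) _; rewrite normrM normrX.
    rewrite -natr1 mulrDl mul1r [leRHS]addrC; apply: lerD; first exact: ltW.
    by rewrite mulrC; apply: ler_pM => //; exact: (rsum_dist N0P).
  rewrite (@ent_fst R _ (n2.-tuple I) _ (fun b => cell (r ^+ (n + i)) (S b)) n20) in h2.
  lra.
have fine1 (e : e0) : H n2 l <= ent (fun w => phi (q (e, w))) + ln 5 :> R.
  rewrite -lerBlDr; apply: ent_ge_cond => // b; rewrite lerBlDr.
  set a := \sum_j (if b j then X (p (e.1 j)) else X (e.1 j)) + lam ^+ n * X e.2.
  apply: (@went_scaled _ _ _ t lam0 _ _ _ a) => v.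
  by rewrite YqE addrA.
have fine2 (e : e0) :
    ln #|[set j | r ^+ (n + i + l) <= `|X (p (e.1 j)) - X (e.1 j)|]|%:R / 2 <=
    ent (fun w => phi (q (e, w))) + ln 5 :> R.
  set m := #|_|; have [m0|m0] := posnP m.
    by rewrite m0 ln0// mul0r addr_ge0 ?ent_ge0// ltW// ln5_gt0.
  rewrite -lerBlDr; apply: ent_ge_condr => // v; rewrite lerBlDr.
  apply: le_trans (ent_signed_sum_ge rl0 m0) _.
  apply: (@ent_cell_shift _ _ _ _ _ (lam ^+ n * X e.2 + lam ^+ (n + i) * X v)) => // b.
  by rewrite YqE addrC.
pose G (u : {ffun 'I_k -> n.-tuple I}) := Num.max (H n2 l)
    (ln #|[set j | r ^+ (n + i + l) <= `|X (p (u j)) - X (u j)|]|%:R / 2).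
have avgG : avg G - ln 5 <= avg (fun e : e0 => ent (fun w => phi (q (e, w)))) :> R.
  rewrite avg_pair -[X in _ - X](avg_cst _ u0) -avgB; apply: ler_avg => u.
  rewrite -[X in X <= _](avg_cst _ i0); apply: ler_avg => v.
  by rewrite lerBlDr ge_max fine1 (fine2 (u, v)).
have avgC : avg (fun e : e0 => ent (fun w => psi (q (e, w)))) <=
    ln 2 * 4 + ln 5 + ln (N0.*2.+2).*2.+1%:R :> R.
  have /card_gt0P[u _] := u0; have /card_gt0P[v _] := i0.
  by apply: avg_le => //; exact: le_trans (ent_ge0 _) (coarse (u, v)).
rewrite -/(avg G) /Cb; move: sm step1 avgG avgC.
rewrite /phi /psi /tag; lra.
Qed.

End Block.

(** * Growth of entropy across scales *)

(** Converts the gains over [A] overlapping steps of length [l] into [l] gains over the whole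
    range. *)
Lemma sum_shift_diff {V : zmodType} (F : nat -> V) (A l : nat) :
  \sum_(i < A) (F (i + l)%N - F i) = \sum_(j < l) (F (A + j)%N - F j).
Proof.
elim: A => [|A IH].
  by rewrite big_ord0 big1// => j _; rewrite add0n subrr.
rewrite big_ord_recr/= IH.
have -> : F (A + l)%N - F A = \sum_(j < l) (F (A.+1 + j)%N - F (A + j)%N).
  rewrite -(big_mkord xpredT (fun j => F (A.+1 + j)%N - F (A + j)%N)).
  under eq_bigr => j _ do rewrite addSnnS.
  by rewrite (telescope_sumr (fun j => F (A + j)%N))// addn0.
by rewrite -big_split; apply: eq_bigr => j _; rewrite /= addrC subrKA.
Qed.

Section ScaleGain.
Context {R : realType} {I : finType}.
Context (lam : R) (t : I -> R) (N0 : nat).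
Context (I0 : (0 < #|I|)%N) (lam0 : lam != 0) (lam1 : `|lam| < 1).
Context (N0P : forall s, `|rsum lam t s| <= N0%:R).
Local Notation r := `|lam|.
Local Notation X := (rsum lam t).
Local Notation H := (went lam t).

Definition ccell (n : nat) (w : n.-tuple I) : int := cell (r ^+ n) (X w).

Definition went_tag (n i : nat) : R :=
  ent (fun w : n.-tuple I => (cell (r ^+ i) (X w), ccell w)).

Definition multi_ent (k n m i : nat) : R :=
  ent (fun w => (cell (r ^+ i) (multi_sum lam t (k := k) (n := n) (m := m) w),
                 tags (@ccell n) w.1)).

(** A largest matching pairs words that share a cell at scale [n + i + l0] but are separated at
    scale [n + i + l]. Entropy of a single copy between these scales forces a proportion [theta] of
    matched words. If more than [eta * k] copies are matched, the signs beat the tail by [Q];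
    otherwise the tail is used. *)
Lemma gain_at (k n i n2 m l0 l' N : nat) (eta Q : R) :
  (m = i + n2)%N -> (l0 + l' <= n2)%N -> (0 < k)%N -> 0 <= Q -> 0 < eta ->
  k%:R * (r ^+ l0) ^+ 2 <= 1 -> 1 <= N%:R * r ^+ l' ->
  H (l0 + l') (l0 + l') + Cw N0 + Q <= ln (eta * k%:R) / 2 ->
  H (l0 + l') (l0 + l') - Cw N0 - Cb N0 - eta * Q +
    Q / ln (N.+1).*2.+1%:R *
      (went_tag n (n + i + (l0 + l')) - went_tag n (n + i + l0) - ln 5 - ln 2) <=
  multi_ent k n m (n + i + (l0 + l')) - multi_ent k n m (n + i).
Proof.
move=> -> {m}; set l := (l0 + l')%N => l_n2 k0 Q0 eta0 kr Nr HQ.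
have n0 := card_word n I0; have u0 := card_ffun_gt0 k n0.
have ra0 := rX_gt0 lam0 (n + i + l); have rb0 := rX_gt0 lam0 (n + i + l0).
pose kap (w : n.-tuple I) := (cell (r ^+ (n + i + l0)) (X w), ccell w).
pose R0 (w w' : n.-tuple I) :=
  (kap w == kap w') && (r ^+ (n + i + l) <= `|X w - X w'|).
have R0s : symmetric R0 by move=> w w'; rewrite /R0 eq_sym distrC.
have R0i : irreflexive R0.
  by move=> w; rewrite /R0 subrr normr0 leNgt ra0 andbF.
have [p [pK pmov pmax]] := maximal_matching R0s R0i.
have pkap w : kap (p w) = kap w.
  have [->//|/pmov/andP[/eqP <- //]] := eqVneq (p w) w.
have pX w : `|X (p w) - X w| <= r ^+ (n + i + l0).
  by have [/(eq_cell rb0)/ltW] := pkap w.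
have gain := block_gain I0 lam0 lam1 N0P n2 l pK
  (fun w => congr1 snd (pkap w)) pX kr.
set theta := avg (fun w : n.-tuple I => (p w != w)%:R : R).
have thetaP : went_tag n (n + i + l) <=
    went_tag n (n + i + l0) + ln 5 + ln 2 + theta * ln (N.+1).*2.+1%:R.
  apply: (@le_trans _ _ (ent (fun w : n.-tuple I => (cell (r ^+ (n + i + l)) (X w), kap w)) : R)).
    by apply: ent_det => w w' [-> _ ->].
  apply: (ent_unmatched_le ra0 (kap := kap) (p := p)) => w w'.
    case=> /(eq_cell rb0)/ltW h _; apply: le_trans h _.
    rewrite /l addnA [in leRHS]exprD mulrCA.
    by rewrite ler_peMr// ltW.
  move=> pw pw' kk; have := pmax w w' pw pw'.
  by rewrite /R0 kk eqxx/= -ltNge.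
have L0 : 0 < ln (N.+1).*2.+1%:R :> R by rewrite ln_gt0// ltr1n.
have Htail : H l l <= H n2 l + Cw N0.
  by have := went_prefix_le I0 lam0 lam1 N0P (n2 - l) (leqnn l); rewrite subnKC.
have Htail2 : H n2 l <= H l l + Cw N0.
  by have := went_prefix_ge I0 lam0 lam1 N0P (n2 - l) (leqnn l); rewrite subnKC.
have k0' : 0 < k%:R :> R by rewrite ltr0n.
(* In both cases the maximum dominates an affine function of the number [s] of matched copies, so
   averaging requires no concentration of [s]. *)
have avgmax : H n2 l - eta * Q + Q * theta <=
  avg (fun u : {ffun 'I_k -> n.-tuple I} => Num.max (H n2 l)
    (ln #|[set j | r ^+ (n + i + l) <= `|X (p (u j)) - X (u j)|]|%:R / 2)).
  have -> : Q * theta = avg (fun u : {ffun 'I_k -> n.-tuple I} =>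
      Q / k%:R * \sum_j (p (u j) != u j)%:R).
    by rewrite avgZ (avg_ffun_sum (fun w => (p w != w)%:R) k n0) -/theta; field; rewrite lt0r_neq0.
  rewrite -[X in X + _](avg_cst _ u0) -avgD; apply: ler_avg => u.
  set s := \sum_j _; set M := #|_|.
  have sM : s <= M%:R.
    rewrite /s /M -natr_sum ler_nat -sum1_card [leqRHS]big_mkcond leq_sum// => j _.
    rewrite inE; have [//|/pmov/andP[_]] := eqVneq (p (u j)) (u j).
    by rewrite distrC => ->.
  have sk : s <= k%:R.
    rewrite /s -[leRHS]mulr1 mulr_natl -[k in leRHS]card_ord -sumr_const.
    by apply: ler_sum => j _; case: (_ != _).
  have [s_small|s_big] := leP s (eta * k%:R).
    apply: le_trans (_ : H n2 l <= _); last by rewrite le_max lexx.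
    suff : Q / k%:R * s <= eta * Q by lra.
    rewrite mulrAC ler_pdivrMr//; have := ler_wpM2l Q0 s_small; lra.
  apply: le_trans (_ : ln M%:R / 2 <= _); last by rewrite le_max lexx orbT.
  have h1 : ln (eta * k%:R) <= ln M%:R.
    rewrite ler_ln ?posrE ?mulr_gt0//; first by apply: le_trans sM; exact: ltW.
    by apply: lt_le_trans sM; apply: lt_trans s_big; rewrite mulr_gt0.
  have h2 : Q / k%:R * s <= Q.
    by rewrite mulrAC ler_pdivrMr//; have := ler_wpM2l Q0 sk; lra.
  have : 0 <= eta * Q by rewrite mulr_ge0// ltW.
  lra.
have thetaQ : Q / ln (N.+1).*2.+1%:R *
    (went_tag n (n + i + l) - went_tag n (n + i + l0) - ln 5 - ln 2) <= Q * theta.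
  rewrite mulrAC ler_pdivrMr// -mulrA; apply: ler_wpM2l => //.
  by move: thetaP; lra.
move: gain avgmax thetaQ Htail; rewrite /multi_ent; lra.
Qed.

Lemma multi_ent_mono (k n m i j : nat) : (i <= j)%N ->
  multi_ent k n m i <= multi_ent k n m j + ln 5.
Proof.
move=> ij; apply: (@ent_cell_le _ _ _ _ 1); first exact: rX_gt0.
move=> w w' [/(eq_cell (rX_gt0 lam0 _))/ltW h tt]; split=> //.
by rewrite mul1r; apply: le_trans h _; apply: rX_le.
Qed.

Lemma went_tag_close (n i j l N : nat) : 1 <= N%:R * r ^+ l -> (j <= i + l)%N ->
  went_tag n j <= went_tag n i + ln (N.+1).*2.+1%:R.
Proof.
move=> Nr jil; apply: ent_cell_le; first exact: rX_gt0.
move=> w w' [/(eq_cell (rX_gt0 lam0 _))/ltW h cc]; split=> //.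
apply: le_trans h _; apply: (@le_trans _ _ (r ^+ i * (N%:R * r ^+ l))).
  by rewrite ler_peMr// ltW// rX_gt0.
rewrite mulrCA -exprD; apply: ler_wpM2l => //; exact: rX_le.
Qed.

Lemma multi_ent_lower (k n m i : nat) : k%:R * H n n <= multi_ent k n m i.
Proof.
have n0 := card_word n I0; have m0 := card_word m I0.
rewrite /went -(ent_iter_indep (@ccell n) k n0).
rewrite -(@ent_fst R _ (m.-tuple I) _ _ m0).
by apply: ent_det => w w' [_].
Qed.

(** [ent_iter_sum] for rounded summands. One copy plus the tail is an [(n + m)]-letter sum, so the
    increment per copy is [H n n] plus the defect of superadditivity. The term [ln 7] pays for
    rounding two summands, the last term for rounding [k + 1] of them. *)
Lemma multi_ent_upper (k n m : nat) :
  multi_ent k n m (n + m) <= H m m + ln 5 +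
    k%:R * (H (n + m) (n + m) - H m m - H n n + (Cw N0 + ln 5 + ln 7)) +
    k%:R * H n n + ln k.+2.*2.+1%:R.
Proof.
have n0 := card_word n I0; have m0 := card_word m I0.
set rho := r ^+ (n + m); have rho0 : 0 < rho by exact: rX_gt0.
pose x (w : n.-tuple I) := cell rho (X w).
pose z (v : m.-tuple I) := cell rho (lam ^+ n * X v).
have zle : ent z <= H m m + ln 5 by exact: went_scaled_le.
have zge : H m m <= ent z + ln 5.
  by apply: (@went_scaled _ _ _ t lam0 n _ m 0) => v; rewrite add0r.
have KV := ent_iter_sum (R := R) x z (@ccell n) k n0 m0.
have sum_close (w : {ffun 'I_k -> n.-tuple I} * m.-tuple I) :
    let s := (\sum_j x (w.1 j) + z w.2)%:~R * rho in
    s <= multi_sum lam t w <= s + k.+1%:R * rho.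
  rewrite /= /multi_sum intrD rmorph_sum/= mulrDl mulr_suml -natr1 mulrDl mul1r.
  have /andP[z1 z2] := cell_itv (lam ^+ n * X w.2) rho0.
  have x1 : \sum_j (x (w.1 j))%:~R * rho <= \sum_j X (w.1 j).
    by apply: ler_sum => j _; have /andP[] := cell_itv (X (w.1 j)) rho0.
  have x2 : \sum_j X (w.1 j) <= \sum_j (x (w.1 j))%:~R * rho + k%:R * rho.
    have -> : k%:R * rho = \sum_(j < k) rho by rewrite sumr_const card_ord mulr_natl.
    rewrite -big_split/=.
    by apply: ler_sum => j _; have /andP[_ /ltW] := cell_itv (X (w.1 j)) rho0.
  by move: z1 z2 x1 x2; rewrite -/(z _) => *; apply/andP; split; lra.
have up : multi_ent k n m (n + m) <=
    ent (fun w : {ffun 'I_k -> n.-tuple I} * m.-tuple I =>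
      (\sum_j x (w.1 j) + z w.2, tags (@ccell n) w.1)) + ln k.+2.*2.+1%:R.
  apply: ent_cell_le => // w w' [ss cc]; split => //.
  have /= /andP[] := sum_close w; have /= /andP[] := sum_close w'; rewrite ss.
  rewrite -/rho => *; rewrite ler_norml; apply/andP; split; lra.
have one : ent (fun w : n.-tuple I * m.-tuple I => (x w.1 + z w.2, ccell w.1)) <=
    H (n + m) (n + m) + (Cw N0 + ln 7).
  pose g (w : n.-tuple I * m.-tuple I) := cell rho (X w.1 + lam ^+ n * X w.2).
  have -> : H (n + m) (n + m) = ent g.
    rewrite /went -(ent_comp_bij _ (catw_bij n m)); congr ent.
    by apply/funext => -[w v]; rewrite /= rsum_cat size_tuple.
  have g1 : ent (fun w => (ccell w.1, g w)) <= ent g + Cw N0 :> R.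
    rewrite /Cw; apply: (@ent_cell_le _ _ _ _ N0.*2.+1); first exact: rX_gt0.
    move=> [w v] [w' v'] gg; split=> //; have lt1 := eq_cell rho0 gg.
    have := rsum_dist N0P v v'; have := rX_le lam1 (leq_addr m n).
    move: lt1 => /=.
    set y := X v - X v'; have -> : X w - X w' =
      (X w + lam ^+ n * X v - (X w' + lam ^+ n * X v')) - lam ^+ n * y by rewrite /y; lra.
    move=> lt1 rn ym; apply: le_trans (ler_normB _ _) _; rewrite normrM normrX.
    rewrite -natr1 mulrDl mul1r [leRHS]addrC; apply: lerD.
      exact: le_trans (ltW lt1) rn.
    by rewrite mulrC; apply: ler_pM.
  have g2 : ent (fun w => (x w.1 + z w.2, (ccell w.1, g w))) <=
      ent (fun w : n.-tuple I * m.-tuple I => (ccell w.1, g w)) + ln 7 :> R.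
    apply: (@ent_close _ _ _ _ 3) => -[w v] [w' v'] E; split=> //.
    case: E => _ /(eq_cell rho0) /=.
    have /andP[] := cell_itv (X w) rho0; have /andP[] := cell_itv (X w') rho0.
    have /andP[] := cell_itv (lam ^+ n * X v) rho0.
    have /andP[] := cell_itv (lam ^+ n * X v') rho0.
    rewrite -!/(x _) -!/(z _) ltr_norml => a1 a2 a3 a4 a5 a6 a7 a8 /andP[a9 a10].
    have : (x w + z v - (x w' + z v') < 4%:Z).
      by rewrite -(ltr_int R) -(ltr_pM2r rho0) !(intrB, intrD) !(mulrBl, mulrDl); lra.
    have : (- 4%:Z < x w + z v - (x w' + z v')).
      by rewrite -(ltr_int R) -(ltr_pM2r rho0) intrN !(intrB, intrD) !(mulrBl, mulrDl); lra.
    move: (x w + z v) (x w' + z v'); clear => a b; lia.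
  have g3 : ent (fun w : n.-tuple I * m.-tuple I => (x w.1 + z w.2, ccell w.1)) <=
      ent (fun w => (x w.1 + z w.2, (ccell w.1, g w))) :> R.
    by apply: ent_det => w w' [-> -> _].
  lra.
have kk : k%:R * (ent (fun w : n.-tuple I * m.-tuple I => (x w.1 + z w.2, ccell w.1)) - ent z) <=
    k%:R * (H (n + m) (n + m) - H m m + (Cw N0 + ln 5 + ln 7)).
  by apply: ler_wpM2l => //; lra.
have -> : k%:R * (H (n + m) (n + m) - H m m - H n n + (Cw N0 + ln 5 + ln 7)) =
  k%:R * (H (n + m) (n + m) - H m m + (Cw N0 + ln 5 + ln 7)) - k%:R * H n n.
  by rewrite -mulrBr; congr (_ * _); lra.
move: up KV; rewrite /tags; lra.
Qed.

(** [gain_at] summed over [A] consecutive scales. The range from [n] to [n + m] is covered [l] times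
    by the gains of the block and [l'] times by those of a single copy; the terms [k%:R * H n n] in
    the two bounds on [multi_ent] cancel. *)
Lemma scale_gain_inequality (k n A l0 l' l m N N' : nat) (eta Q : R) :
  l = (l0 + l')%N -> m = (A + l)%N ->
  (0 < k)%N -> 0 <= Q -> 0 < eta ->
  k%:R * (r ^+ l0) ^+ 2 <= 1 -> 1 <= N%:R * r ^+ l' ->
  1 <= N'%:R * r ^+ l ->
  H l l + Cw N0 + Q <= ln (eta * k%:R) / 2 ->
  A%:R * (H l l - Cw N0 - Cb N0 - eta * Q) +
    Q / ln (N.+1).*2.+1%:R *
     (l'%:R * (H n (n + m) - H n n - 2 * ln (N'.+1).*2.+1%:R) - A%:R * (ln 5 + ln 2)) <=
  l%:R * (H m m + k%:R * (H (n + m) (n + m) - H m m - H n n + (Cw N0 + ln 5 + ln 7))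
          + (ln k.+2.*2.+1%:R + 3 * ln 5)).
Proof.
move=> -> -> {l m}; set l := (l0 + l')%N; set m := (A + l)%N.
move=> k0 Q0 eta0 kr Nr Nr' HQ.
have L0 : 0 < ln (N.+1).*2.+1%:R :> R by rewrite ln_gt0// ltr1n.
set K := Q / ln (N.+1).*2.+1%:R; have K0 : 0 <= K by rewrite divr_ge0// ltW.
set D := ln (N'.+1).*2.+1%:R.
pose a i := went_tag n i; pose E i := multi_ent k n m i.
have gains : \sum_(i < A) (H l l - Cw N0 - Cb N0 - eta * Q +
     K * (a (n + i + l) - a (n + i + l0) - ln 5 - ln 2)) <=
   \sum_(i < A) (E (n + i + l) - E (n + i)).
  apply: ler_sum => i _; apply: (@gain_at _ _ _ (m - i)) => //.
    by rewrite subnKC// /m; move: (ltn_ord i); clear; lia.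
  by rewrite /m /l; move: (ltn_ord i); clear; lia.
have Esum : \sum_(i < A) (E (n + i + l) - E (n + i)) <= l%:R * (E (n + m) - E n + 2 * ln 5).
  have -> : \sum_(i < A) (E (n + i + l) - E (n + i)) =
      \sum_(j < l) (E (n + (A + j)) - E (n + j)).
    apply: etrans (sum_shift_diff (fun i => E (n + i)%N) A l).
    by apply: eq_bigr => i _; rewrite addnA.
  rewrite mulr_natl -[l in leRHS]card_ord -sumr_const; apply: ler_sum => j _.
  have h1 : E (n + (A + j))%N <= E (n + m)%N + ln 5.
    by apply: multi_ent_mono; move: (ltn_ord j); rewrite /m; clear; lia.
  have h2 : E n <= E (n + j)%N + ln 5 by apply: multi_ent_mono; exact: leq_addr.
  lra.
have asum : l'%:R * (H n (n + m) - H n n - 2 * D) <=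
    \sum_(i < A) (a (n + i + l) - a (n + i + l0)).
  have -> : \sum_(i < A) (a (n + i + l) - a (n + i + l0)) =
      \sum_(j < l') (a (n + l0 + (A + j)) - a (n + l0 + j)).
    apply: etrans (sum_shift_diff (fun i => a (n + l0 + i)%N) A l').
    by apply: eq_bigr => i _; congr (a _ - a _); rewrite /l; clear; lia.
  rewrite mulr_natl -[l' in leLHS]card_ord -sumr_const; apply: ler_sum => j _.
  have h1 : a (n + m)%N <= a (n + l0 + (A + j))%N + D.
    by apply: (went_tag_close _ Nr'); rewrite /m /l; clear; lia.
  have h2 : a (n + l0 + j)%N <= a n + D.
    by apply: (went_tag_close _ Nr'); rewrite /l; move: (ltn_ord j); clear; lia.
  have h3 : H n (n + m) <= a (n + m)%N by apply: ent_det => w w' [].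
  have h4 : a n <= H n n by apply: ent_det => w w' cc; rewrite /ccell cc.
  lra.
have Eu : E (n + m) <= _ := multi_ent_upper k n m.
have El : k%:R * H n n <= E n := multi_ent_lower k n m n.
have Eul : l%:R * (E (n + m) - E n + 2 * ln 5) <=
    l%:R * (H m m + k%:R * (H (n + m) (n + m) - H m m - H n n + (Cw N0 + ln 5 + ln 7))
          + (ln k.+2.*2.+1%:R + 3 * ln 5)).
  by apply: ler_wpM2l => //; lra.
apply: le_trans Eul; apply: le_trans Esum; apply: le_trans gains.
have cst (c : R) : A%:R * c = \sum_(i < A) c by rewrite sumr_const card_ord mulr_natl.
rewrite big_split/= -mulr_sumr -cst lerD2l; apply: ler_wpM2l => //.
suff -> : \sum_(i < A) (a (n + i + l) - a (n + i + l0) - ln 5 - ln 2) =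
  \sum_(i < A) (a (n + i + l) - a (n + i + l0)) - A%:R * (ln 5 + ln 2).
  by rewrite lerD2r.
by rewrite cst -sumrB; apply: eq_bigr => i _; rewrite -addrA -opprD.
Qed.

End ScaleGain.

Lemma nat_large {R : realType} (c d : R) : 0 < d ->
  exists N : nat, forall n, (N <= n)%N -> c <= n%:R * d.
Proof.
move=> d0; exists (Num.truncn (c / d)).+1 => n Nn.
rewrite -ler_pdivrMr//; apply: le_trans (_ : (Num.truncn (c / d)).+1%:R <= _).
  by apply/ltW/truncnS_gt.
by rewrite ler_nat.
Qed.

Section Growth.
Context {R : realType}.

(** Fekete's lemma for superadditivity up to [C]: the rate is the supremum of [(a n - C) / n], with
    0 adjoined to keep it nonnegative. *)
Lemma superadditive_rate (a : nat -> R) (C B : R) : 0 <= C -> 0 <= B ->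
  (forall n, 0 <= a n) -> (forall n, a n <= n%:R * B + C) ->
  (forall n m, a n + a m <= a (n + m)%N + C) ->
  exists2 h : R, 0 <= h &
    (forall n, a n <= n%:R * h + C) /\
    (forall d, 0 < d -> exists N, forall n, (N <= n)%N -> n%:R * (h - d) <= a n).
Proof.
move=> C0 B0 a0 aB asup.
pose E : set R := [set x | x = 0 \/ exists2 n : nat, (0 < n)%N & x = (a n - C) / n%:R]%classic.
have hE : has_sup E.
  split; first by exists 0; left.
  exists B => x [->//|[n n0 ->]].
  by rewrite ler_pdivrMr ?ltr0n// mulrC lerBlDr.
pose h := sup E.
have h0 : 0 <= h by apply: ub_le_sup; [case: hE|left].
have hup n : a n <= n%:R * h + C.
  have [->|n0] := posnP n.
    rewrite mul0r add0r; have := asup 0%N 0%N; rewrite addn0; lra.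
  rewrite -lerBlDr mulrC -ler_pdivrMr ?ltr0n//.
  by apply: ub_le_sup; [case: hE|right; exists n].
exists h => //; split=> // d d0.
have [x Ex hx] := sup_adherent (divr_gt0 d0 (ltr0Sn R 1)) hE.
rewrite -/h in hx.
case: Ex => [x0|[m m0 xE]].
  exists 0%N => n _; apply: le_trans (a0 n).
  by rewrite mulr_ge0_le0//; lra.
have mult k : (k%:R * (a m - C) <= a (k * m)%N).
  elim: k => [|k IH]; first by rewrite mul0r.
  by have := asup m (k * m)%N; rewrite mulSn -natr1; lra.
have m0' : 0 < m%:R :> R by rewrite ltr0n.
have [N NP] := nat_large (m%:R * h + C) (divr_gt0 d0 (ltr0Sn R 1)).
exists N => n /NP Nn.
have := asup (n %/ m * m)%N (n %% m)%N; rewrite -divn_eq.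
have := mult (n %/ m)%N; have := a0 (n %% m)%N.
have am : m%:R * (h - d / 2) <= a m - C.
  by move: hx; rewrite xE ltr_pdivlMr// mulrC => /ltW.
have nE : n%:R = (n %/ m)%:R * m%:R + (n %% m)%:R :> R.
  by rewrite -natrM -natrD -divn_eq.
have modm : (n %% m)%:R <= m%:R :> R by rewrite ler_nat ltnW// ltn_pmod.
have h1 := ler_wpM2l (ler0n R (n %/ m)) am.
have h2 := ler_wpM2r h0 modm.
have h3 : 0 <= (n %% m)%:R * d by rewrite mulr_ge0// ltW.
have h4 : (n %/ m)%:R * (m%:R * (h - d / 2)) = (n%:R - (n %% m)%:R) * (h - d / 2).
  by rewrite mulrA nE addrK.
move: h1; rewrite h4 => h1 h5 h6 h7.
have h8 : n%:R * (h - d) = (n%:R - (n %% m)%:R) * (h - d / 2) - n%:R * (d / 2) +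
  (n %% m)%:R * h - (n %% m)%:R * d / 2 by lra.
lra.
Qed.

End Growth.

Section FineScales.
Context {R : realType} {I : finType}.
Context (lam : R) (t : I -> R) (N0 : nat).
Context (I0 : (0 < #|I|)%N) (lam0 : lam != 0) (lam1 : `|lam| < 1).
Context (N0P : forall s, `|rsum lam t s| <= N0%:R).
Local Notation r := `|lam|.
Local Notation X := (rsum lam t).
Local Notation H := (went lam t).
Local Notation L := (- ln `|lam|).

Lemma L_gt0 : 0 < L.
Proof. by rewrite oppr_gt0 ln_lt0// normr_gt0 lam0. Qed.

Lemma lnrX (i : nat) : ln (r ^- i) = i%:R * L.
Proof.
by rewrite lnV ?posrE ?rX_gt0// lnXn ?normr_gt0// mulrN mulr_natl.
Qed.

Lemma went_le_card (n i : nat) : H n i <= n%:R * ln #|I|%:R.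
Proof.
have := ent_le_card (R := R) (@id (n.-tuple I)) (card_word n I0).
rewrite card_tuple natrX lnXn ?ltr0n// mulr_natl; apply: le_trans.
by apply: ent_det => w w' /= ->.
Qed.

Lemma went_rate : exists2 h : R, 0 <= h & exists2 C : R, 0 <= C &
  (forall n, H n n <= n%:R * h + C) /\
  (forall d, 0 < d -> exists N, forall n, (N <= n)%N -> n%:R * (h - d) <= H n n).
Proof.
have C0 : 0 <= Cw N0 + ln 5 :> R.
  by have := Cw_ge5 (R := R) N0; have := ln5_gt0 (R := R); lra.
have B0 : 0 <= ln #|I|%:R :> R by rewrite ln_ge0// ler1n.
have ub n : H n n <= n%:R * ln #|I|%:R + (Cw N0 + ln 5).
  by apply: le_trans (went_le_card n n) _; rewrite lerDl.
have [h h0 hP] := superadditive_rate C0 B0 (fun n => went_ge0 lam t n n) ub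
  (went_superadd I0 lam0 lam1 N0P).
by exists h => //; exists (Cw N0 + ln 5).
Qed.

(** By contradiction from [scale_gain_inequality], where the leading terms [p * n * l * h] cancel.
    The parameters are fixed in the order [l'], [l0], [k], [n]: the cost [ln 5 + ln 2] per scale is
    absorbed by [l'], the constants [Cw N0] and [Cb N0] by [l0], and everything depending on [k] by
    [n]. *)
Lemma went_fine_le (h C : R) (p : nat) (eps : R) : 0 <= h -> 0 <= C -> h < L ->
  (forall n, H n n <= n%:R * h + C) ->
  (forall d, 0 < d -> exists N, forall n, (N <= n)%N -> n%:R * (h - d) <= H n n) ->
  (0 < p)%N -> 0 < eps ->
  exists N, forall n, (N <= n)%N -> H n (n + p * n) <= n%:R * (h + eps).
Proof.
move=> h0 C0 hL Hup Hlow p0 e0.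
have L0 := L_gt0; set G := L - h; have G0 : 0 < G by rewrite subr_gt0.
have P0 : 0 < p%:R :> R by rewrite ltr0n.
set P : R := p%:R in P0 *.
pose eta := eps / (64 * L * P); pose del := eps * G / (256 * L * P).
have eta0 : 0 < eta by rewrite divr_gt0// !mulr_gt0.
have c256 : 0 < 256 :> R by rewrite ltr0n.
have del0 : 0 < del by rewrite divr_gt0 ?mulr_gt0.
have [n1 n1P] := Hlow _ del0.
have e4 : 0 < eps / 4 by lra.
have [l1 l1P] := nat_large (P * (ln 5 + ln 2)) e4.
have [l2 l2P] := nat_large (ln 7) L0.
pose l' := (maxn 1 (maxn l1 l2)).
have l'0 : 0 < l'%:R :> R by rewrite ltr0n /l'; clear; lia.
have c1l : P * (ln 5 + ln 2) <= l'%:R * (eps / 4) by apply: l1P; rewrite /l'; clear; lia.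
have ln7l : ln 7 <= l'%:R * L by apply: l2P; rewrite /l'; clear; lia.
pose N := (Num.truncn (r ^- l')).+1.
have ri i : 0 < r ^- i by rewrite invr_gt0 rX_gt0.
have ri1 i : 1 <= r ^- i.
  by rewrite invf_ge1 ?rX_gt0// exprn_ile1// ltW.
have Nge : r ^- l' <= N%:R by apply/ltW/truncnS_gt.
have Nle : N%:R <= r ^- l' + 1.
  by rewrite /N -natr1 lerD2r truncn_le// ltW.
have Nr : 1 <= N%:R * r ^+ l' by rewrite -ler_pdivrMr ?rX_gt0// mul1r.
pose NN : R := ln (N.+1).*2.+1%:R.
have NN0 : 0 < NN by rewrite /NN ln_gt0// ltr1n.
have NNle : NN <= 2 * (l'%:R * L).
  apply: (@le_trans _ _ (ln (7 * r ^- l'))); last first.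
    by rewrite lnM ?posrE// lnrX; lra.
  rewrite ler_ln ?posrE ?mulr_gt0// -natr1 -mul2n natrM -natr1.
  by have := ri1 l'; lra.
have G2 : 0 < G / 2 by lra.
have [l3 l3P] := nat_large (l'%:R * h + C + Cw N0 - ln (eta / 2) / 2) G2.
have eG : 0 < eps * G / (128 * L) by rewrite divr_gt0 ?mulr_gt0.
have [l4 l4P] := nat_large (P * (Cw N0 + Cb N0)) eG.
have L2 : 0 < 2 * L by lra.
have [l5 l5P] := nat_large (ln 2) L2.
pose l0 := (maxn l' (maxn n1 (maxn l3 (maxn l4 l5)))).
have l0l' : l'%:R <= l0%:R :> R by rewrite ler_nat /l0; clear; lia.
have A3 : l'%:R * h + C + Cw N0 - ln (eta / 2) / 2 <= l0%:R * (G / 2).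
  by apply: l3P; rewrite /l0; clear; lia.
have A4 : P * (Cw N0 + Cb N0) <= l0%:R * (eps * G / (128 * L)).
  by apply: l4P; rewrite /l0; clear; lia.
have A5 : ln 2 <= l0%:R * (2 * L) by apply: l5P; rewrite /l0; clear; lia.
pose l := (l0 + l')%N.
have lE : l%:R = l0%:R + l'%:R :> R by rewrite natrD.
have Hl : l%:R * (h - del) <= H l l by apply: n1P; rewrite /l /l0; clear; lia.
have l00 : 0 < l0%:R :> R by apply: lt_le_trans l0l'.
(* The excess of the signs over the tail is about [l0 * G]; the other half covers the terms without
   [l0]. *)
pose Q := l0%:R * (G / 2); have Q0 : 0 < Q by rewrite mulr_gt0.
(* As many copies as the condition [kr] permits. *)
pose y := r ^- (l0 * 2); pose k := Num.truncn y.
have y2 : 2 <= y.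
  rewrite -ler_ln ?posrE ?ri// lnrX natrM; move: A5; clear; lra.
have ky : k%:R <= y by rewrite truncn_le// ltW// ri.
have yk : y < k%:R + 1 by rewrite natr1; apply: truncnS_gt.
have k1 : y / 2 <= k%:R by move: y2 yk; clear; lra.
have k0' : 0 < k%:R :> R by move: y2 yk; clear; lra.
have k0 : (0 < k)%N by rewrite ltr0n in k0'.
have kr : k%:R * (r ^+ l0) ^+ 2 <= 1.
  by rewrite -exprM -ler_pdivlMr ?rX_gt0// mul1r.
have HQ : H l l + Cw N0 + Q <= ln (eta * k%:R) / 2.
  have : ln (eta / 2) + l0%:R * 2 * L <= ln (eta * k%:R).
    have -> : l0%:R * 2 * L = ln y by rewrite lnrX natrM.
    have y0 : 0 < y by exact: ri.
    have eta2 : 0 < eta / 2 by rewrite divr_gt0.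
    have -> : ln (eta / 2) + ln y = ln (eta * (y / 2)).
      by rewrite -lnM ?posrE//; congr ln; rewrite mulrAC mulrA.
    have ey : eta * (y / 2) <= eta * k%:R by rewrite ler_pM2l.
    have ey0 : 0 < eta * (y / 2) by rewrite mulr_gt0// divr_gt0.
    by rewrite ler_ln// posrE; exact: lt_le_trans ey.
  have := Hup l; rewrite lE /Q; move: A3; rewrite /G; clear; lra.
pose N' := (Num.truncn (r ^- l)).+1.
have Nr' : 1 <= N'%:R * r ^+ l.
  by rewrite -ler_pdivrMr ?rX_gt0// mul1r; apply/ltW/truncnS_gt.
pose D : R := ln (N'.+1).*2.+1%:R.
(* The unit of the error budget per letter: the supposed excess of entropy yields [16 * kap], the
   errors together at most [5 * kap]. *)
pose kap := eps * Q / (64 * L).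
have kap0 : 0 < kap by rewrite divr_gt0 ?mulr_gt0.
have l_gt0 : 0 < l%:R :> R by rewrite lE addr_gt0.
have lk0 : 0 < l%:R * k%:R * (1 + P) by rewrite !mulr_gt0// addr_gt0.
pose del2 := kap / (l%:R * k%:R * (1 + P)).
have del20 : 0 < del2 by rewrite divr_gt0.
have [n2 n2P] := Hlow _ del20.
pose Cx : R := Cw N0 + ln 5 + ln 7; pose Ck : R := ln k.+2.*2.+1%:R + 3 * ln 5.
pose K : R := l%:R * (l%:R * h) + l%:R * C + l%:R * k%:R * (C + Cx) + l%:R * Ck.
have [n3 n3P] := nat_large K kap0.
have [n4 n4P] := nat_large (C + 2 * D) e4.
exists (maxn 1 (maxn n2 (maxn n3 (maxn n4 l)))) => n Nn.
rewrite leNgt; apply/negP => big.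
have n_gt0 : 0 < n%:R :> R by rewrite ltr0n; move: Nn; clear; lia.
have npn : (n <= p * n)%N by rewrite leq_pmull.
have lpn : (l <= p * n)%N by apply: leq_trans npn; move: Nn; clear; lia.
pose m := (p * n)%N; pose A := (m - l)%N.
have mE : (A + l)%N = m by rewrite subnK.
have mR : m%:R = P * n%:R by rewrite natrM.
have AR : A%:R = P * n%:R - l%:R by rewrite -mR -mE natrD addrK.
have := scale_gain_inequality I0 lam0 lam1 N0P n (erefl l) (esym mE) k0 (ltW Q0) eta0 kr Nr Nr' HQ.
rewrite -/NN -/D -/Cx -/Ck => ineq.
have B3 : K <= n%:R * kap by apply: n3P; move: Nn; clear; lia.
have B4 : C + 2 * D <= n%:R * (eps / 4) by apply: n4P; move: Nn; clear; lia.
have Hm1 := Hup m.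
have Hm2 : m%:R * (h - del2) <= H m m.
  by apply: n2P; rewrite /m; apply: leq_trans npn; move: Nn; clear; lia.
have Hn1 := Hup n; have Hn2 : n%:R * (h - del2) <= H n n by apply: n2P; move: Nn; clear; lia.
have Hnm := Hup (n + m)%N; rewrite natrD in Hnm.
have A0 : 0 <= A%:R :> R by [].
have T1 : P * n%:R * (l%:R * h) - l%:R * (l%:R * h) -
    P * n%:R * (l%:R * del + Cw N0 + Cb N0 + eta * Q) <=
    A%:R * (H l l - Cw N0 - Cb N0 - eta * Q).
  have u0 : 0 <= l%:R * del + Cw N0 + Cb N0 + eta * Q.
    have := mulr_gt0 l_gt0 del0; have := mulr_gt0 eta0 Q0.
    have := Cw_ge5 (R := R) N0; have := ln5_gt0 (R := R).
    have : 0 <= Cb N0 :> R.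
      by rewrite /Cb !addr_ge0 ?mulr_ge0 ?ln_ge0 ?ler1n.
    clear; lra.
  set u := l%:R * del + _ + _ + _ in u0 *.
  have h1 : A%:R * (l%:R * h - u) <= A%:R * (H l l - Cw N0 - Cb N0 - eta * Q).
    by apply: ler_wpM2l => //; rewrite /u; move: Hl; clear; lra.
  apply: le_trans h1; rewrite AR.
  have : 0 <= l%:R * u by rewrite mulr_ge0.
  clear; lra.
have T2 : 16 * (n%:R * kap) <=
  Q / NN * (l'%:R * (H n (n + m) - H n n - 2 * D) - A%:R * (ln 5 + ln 2)).
  have c10 : 0 <= ln 5 + ln 2 :> R by rewrite addr_ge0 ?ln_ge0 ?ler1n.
  have h1 : A%:R * (ln 5 + ln 2) <= n%:R * (l'%:R * (eps / 4)).
    apply: (@le_trans _ _ (n%:R * (P * (ln 5 + ln 2)))); last by rewrite ler_pM2l.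
    have := mulr_ge0 (ltW l_gt0) c10; rewrite AR; clear; lra.
  have h2 : l'%:R * (n%:R * (3 / 4 * eps)) <= l'%:R * (H n (n + m) - H n n - 2 * D).
    by rewrite ler_pM2l//; move: big Hn1 B4; rewrite -/m; clear; lra.
  have h3 : n%:R * l'%:R * (eps / 2) <=
      l'%:R * (H n (n + m) - H n n - 2 * D) - A%:R * (ln 5 + ln 2).
    by move: h1 h2; clear; lra.
  apply: (@le_trans _ _ (Q / NN * (n%:R * l'%:R * (eps / 2)))); last first.
    by rewrite ler_wpM2l// divr_ge0// ltW.
  rewrite mulrAC ler_pdivlMr//.
  apply: (@le_trans _ _ (16 * (n%:R * kap) * (2 * (l'%:R * L)))).
    by rewrite ler_wpM2l// mulr_ge0// mulr_ge0// ltW.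
  rewrite /kap le_eqVlt; apply/orP; left; apply/eqP.
  by move: (- ln r) (lt0r_neq0 L0) => x x0; field; rewrite ?x0.
have T3 : l%:R * (H m m + k%:R * (H (n + m) (n + m) - H m m - H n n + Cx) + Ck) <=
   l%:R * (P * n%:R * h) + l%:R * C + l%:R * k%:R * (1 + P) * del2 * n%:R +
   l%:R * k%:R * (C + Cx) + l%:R * Ck.
  have h1 : k%:R * (H (n + m) (n + m) - H m m - H n n + Cx) <=
     k%:R * ((1 + P) * n%:R * del2 + C + Cx).
    by apply: ler_wpM2l => //; move: Hm2 Hnm Hn2; rewrite mR; clear; lra.
  have h2 : l%:R * (H m m + k%:R * (H (n + m) (n + m) - H m m - H n n + Cx) + Ck) <=
     l%:R * (P * n%:R * h + C + k%:R * ((1 + P) * n%:R * del2 + C + Cx) + Ck).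
    by apply: ler_wpM2l => //; move: Hm1 h1; rewrite mR; clear; lra.
  by apply: le_trans h2 _; rewrite le_eqVlt; apply/orP; left; apply/eqP; ring.
have U : P * (l%:R * del + Cw N0 + Cb N0 + eta * Q) <= 3 * kap.
  have u1 : P * (l%:R * del) <= kap.
    apply: (@le_trans _ _ (P * (2 * l0%:R * del))).
      apply: ler_wpM2l; first exact: ltW.
      by rewrite ler_pM2r// lE; move: l0l'; clear; lra.
    rewrite /kap /del /Q le_eqVlt; apply/orP; left; apply/eqP.
    by move: (- ln r) (lt0r_neq0 L0) => x x0; field; rewrite ?x0 ?(lt0r_neq0 P0).
  have u2 : P * (Cw N0 + Cb N0) <= kap.
    apply: le_trans A4 _; rewrite /kap /Q le_eqVlt; apply/orP; left; apply/eqP.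
    by move: (- ln r) (lt0r_neq0 L0) => x x0; field; rewrite ?x0.
  have u3 : P * (eta * Q) = kap.
    rewrite /kap /eta.
    by move: (- ln r) (lt0r_neq0 L0) => x x0; field; rewrite ?x0 ?(lt0r_neq0 P0).
  by move: u1 u2 u3; clear; lra.
have V : l%:R * k%:R * (1 + P) * del2 = kap.
  by rewrite /del2 mulrCA divff ?mulr1// lt0r_neq0.
have U' := ler_wpM2l (ltW n_gt0) U.
have V' : l%:R * k%:R * (1 + P) * del2 * n%:R = n%:R * kap by rewrite V mulrC.
have nk := mulr_gt0 n_gt0 kap0.
move: ineq T1 T2 T3 U' B3 nk; rewrite V' /K; clear; lra.
Qed.

End FineScales.

(** * Liouville bounds *)

Section Liouville.
Context {R : realType}.

Definition pow_col (lam : R) (d : nat) : 'cV[R]_d := \col_i lam ^+ i.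

Local Notation toR := (map_mx (intr : int -> R)).

(* [a * lam] acts as an integer matrix on the column of powers of [lam], and
   these powers are linearly independent over the integers. *)
Lemma algebraic_matrix (lam : R) : algebraicOver (ratr : rat -> R) lam ->
  exists d : nat, exists a : int, exists B : 'M[int]_d.+1,
  [/\ a != 0, toR B *m pow_col lam d.+1 = (a%:~R * lam) *: pow_col lam d.+1 &
      forall u : 'rV[int]_d.+1, toR u *m pow_col lam d.+1 = 0 -> u = 0].
Proof.
move=> [p0 p0n0 rootp0].
pose good (q : {poly int}) := q != 0 /\ root (map_poly (intr : int -> R) q) lam.
have ratrE (q : {poly int}) : map_poly (ratr : rat -> R) (map_poly (intr : int -> rat) q) =
    map_poly (intr : int -> R) q.
  by apply/polyP => i; rewrite !coef_map/= ratr_int.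
have exg : exists n, `[< exists2 q, good q & size q = n >].
  have [q [b b0 pE]] := rat_poly_scale p0.
  exists (size q); apply/asboolP; exists q => //; split.
    by apply: contraNneq p0n0 => q0; rewrite pE q0 rmorph0 scaler0.
  move: rootp0; rewrite pE map_polyZ/= ratrE rootZ//.
  by rewrite fmorph_eq0 invr_eq0 intr_eq0.
have [n /asboolP[q [q0 rq] qn] nmin] := ex_minnP exg.
have n2 : (1 < n)%N.
  rewrite -qn ltnNge; apply/negP => /size1_polyC qc.
  move: rq q0; rewrite qc map_polyC/= rootC intr_eq0 => /eqP ->.
  by rewrite eqxx.
pose d := n.-2; have dn : n = d.+2 by rewrite /d; lia.
exists d, (lead_coef q); pose a := lead_coef q.
exists (\matrix_(i, j) if i == ord_max then - q`_j else a *+ (j == i.+1 :> nat)).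
have qE : lead_coef q = q`_d.+1 by rewrite lead_coefE qn dn.
split; first by rewrite lead_coef_eq0.
- apply/colP => i; rewrite !mxE; have [->|inmax] := eqVneq i ord_max.
    have : \sum_(j < d.+1) (q`_j)%:~R * lam ^+ j + (lead_coef q)%:~R * lam ^+ d.+1 = 0.
      move: rq; rewrite rootE horner_coef size_map_inj_poly//; last exact: intr_inj.
      rewrite qn dn big_ord_recr/= coef_map/= -qE => /eqP e; rewrite -[RHS]e; congr (_ + _).
      by apply: eq_bigr => j _; rewrite coef_map.
    rewrite exprS mulrA addrC => /eqP; rewrite addr_eq0 => /eqP ->.
    by rewrite -sumrN; apply: eq_bigr => j _; rewrite !mxE eqxx intrN mulNr.
  have id : (i.+1 < d.+1)%N.
    have := ltn_ord i; rewrite leq_eqVlt => /orP[/eqP[e]|//].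
    by case/eqP: inmax; apply/val_inj.
  rewrite (bigD1 (Ordinal id))//= !mxE (negbTE inmax) eqxx big1 ?addr0.
    by rewrite mulr1n exprS mulrA.
  move=> j /eqP ji; rewrite !mxE (negbTE inmax).
  have -> : (j == i.+1 :> nat) = false by apply/eqP => e; case: ji; exact/val_inj.
  by rewrite mulr0n mul0r.
- move=> u uv; apply/eqP; apply: contraT => u0.
  pose g : {poly int} := \poly_(i < d.+1) u 0 (inord i).
  have g0 : g != 0.
    apply: contraNneq u0 => g0; apply/eqP/rowP => i; rewrite mxE.
    have : g`_i = 0 by rewrite g0 coef0.
    by rewrite coef_poly ltn_ord inord_val.
  have rg : root (map_poly (intr : int -> R) g) lam.
    rewrite rootE; apply/eqP.
    have -> : map_poly (intr : int -> R) g = \poly_(i < d.+1) (u 0 (inord i))%:~R.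
      by apply/polyP => i; rewrite coef_map/= !coef_poly; case: ifP.
    rewrite horner_poly; have /matrixP/(_ 0 0) := uv; rewrite !mxE => e; rewrite -[RHS]e.
    by apply: eq_bigr => i _; rewrite !mxE inord_val.
  have : (n <= size g)%N by apply: nmin; apply/asboolP; exists g.
  have : (size g <= d.+1)%N by exact: size_poly.
  rewrite dn; clear; lia.
Qed.

Lemma det_bound (n : nat) (E : 'M[int]_n) (b : nat) :
  (forall i j, (absz (E i j) <= b)%N) -> (absz (\det E) <= n`! * b ^ n)%N.
Proof.
move=> Eb; rewrite -(@ler_nat int) natr_absz intz /determinant.
apply: le_trans (ler_norm_sum _ _ _) _.
apply: (@le_trans _ _ (\sum_(s : 'S_n) ((b ^ n)%N%:R : int))); last first.
  by rewrite sumr_const card_Sn natrM mulr_natl.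
apply: ler_sum => s _; rewrite normrM normr_sign mul1r normr_prod.
rewrite natrX -[n in leRHS]card_ord -prodr_const.
apply: ler_prod => i _; rewrite normr_ge0/=.
by have := Eb i (s i); lia.
Qed.

Section Representation.
Context (lam : R) (d : nat) (a : int) (B : 'M[int]_d.+1).
Context (a0 : a != 0)
  (BE : toR B *m pow_col lam d.+1 = (a%:~R * lam) *: pow_col lam d.+1)
  (indep : forall u : 'rV[int]_d.+1, toR u *m pow_col lam d.+1 = 0 -> u = 0).
Local Notation v := (pow_col lam d.+1).

(* [z] is the evaluation at [lam] of an integer polynomial of degree at most
   [D], recorded as an integer matrix acting as [a ^ D * z] with entries
   bounded by [b]. *)
Definition int_rep (D b : nat) (z : R) : Prop :=
  exists E : 'M[int]_d.+1, toR E *m v = (a%:~R ^+ D * z) *: v /\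
    forall i j, (absz (E i j) <= b)%N.

Lemma int_rep_le D b b' z : (b <= b')%N -> int_rep D b z -> int_rep D b' z.
Proof. by move=> bb [E [EE Eb]]; exists E; split=> // i j; apply: leq_trans bb. Qed.

Lemma int_rep_nat D (b : bool) : int_rep D (absz a ^ D) b%:R.
Proof.
exists ((a ^+ D * b%:R)%:M); split.
  by rewrite map_scalar_mx mul_scalar_mx/= rmorphM rmorphXn/=; case: b.
move=> i j; rewrite !mxE; case: (i == j); last by rewrite mulr0n.
rewrite mulr1n abszM abszX; case: b; first by rewrite muln1.
by rewrite muln0.
Qed.

Lemma int_repD D b b' z z' : int_rep D b z -> int_rep D b' z' ->
  int_rep D (b + b') (z + z').
Proof.
move=> [E [EE Eb]] [E' [EE' Eb']]; exists (E + E'); split.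
  by rewrite map_mxD mulmxDl EE EE' mulrDr scalerDl.
move=> i j; rewrite !mxE; move: (Eb i j) (Eb' i j); move: (E i j) (E' i j); clear => x y; lia.
Qed.

Lemma int_repN D b z : int_rep D b z -> int_rep D b (- z).
Proof.
move=> [E [EE Eb]]; exists (- E); split.
  by rewrite map_mxN mulNmx EE mulrN scaleNr.
by move=> i j; rewrite !mxE abszN.
Qed.

Lemma int_repM D D' b b' z z' : int_rep D b z -> int_rep D' b' z' ->
  int_rep (D + D') (d.+1 * (b * b')) (z * z').
Proof.
move=> [E [EE Eb]] [E' [EE' Eb']]; exists (E' *m E); split.
  rewrite map_mxM -mulmxA EE -scalemxAr EE' scalerA exprD; congr (_ *: _); ring.
move=> i j; rewrite !mxE -(@ler_nat int) natr_absz intz.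
apply: le_trans (ler_norm_sum _ _ _) _.
apply: (@le_trans _ _ (\sum_(k < d.+1) ((b * b')%N%:R : int))); last first.
  by rewrite sumr_const card_ord [leRHS]natrM mulr_natl.
apply: ler_sum => k _; rewrite normrM.
have h1 := Eb' i k; have h2 := Eb k j.
rewrite natrM mulrC; apply: ler_pM => //.
  by move: h2; move: (E k j); clear => x; lia.
by move: h1; move: (E' i k); clear => x; lia.
Qed.

Lemma int_rep_lam : exists b : nat, int_rep 1 b lam.
Proof.
exists (\sum_i \sum_j absz (B i j))%N, B; split; first by rewrite BE.
by move=> i j; rewrite (bigD1 i)//= (bigD1 j)//= -addnA leq_addr.
Qed.

Lemma int_rep_prod (r D b : nat) (z : 'I_r -> R) : (forall i, int_rep D b (z i)) ->
  int_rep (r * D) ((d.+1 * b) ^ r) (\prod_i z i).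
Proof.
elim: r z => [|r IH] z zP; first by rewrite big_ord0; exact: (int_rep_nat 0 true).
rewrite big_ord_recl mulSn expnS -mulnA; apply: int_repM => //.
exact: IH.
Qed.

Lemma int_rep_sum (T : finType) D b (z : T -> R) : (forall i, int_rep D b (z i)) ->
  int_rep D (#|T| * b) (\sum_i z i).
Proof.
move=> zP; suff H s : int_rep D (size s * b) (\sum_(i <- s) z i).
  by have := H (enum T); rewrite -cardE big_enum.
elim: s => [|x s IH]; last by rewrite big_cons /= mulSn; exact: int_repD.
rewrite big_nil /=; exists 0; split; first by rewrite map_mx0 mul0mx mulr0 scale0r.
by move=> i j; rewrite !mxE absz0.
Qed.

Lemma int_rep_det (r D b : nat) (A : 'M[R]_r) : (forall i j, int_rep D b (A i j)) ->
  int_rep (r * D) (r`! * (d.+1 * b) ^ r) (\det A).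
Proof.
move=> AP; rewrite /determinant -card_Sn; apply: int_rep_sum => s.
rewrite mulr_sign; case: (odd_perm s); first apply: int_repN.
  by apply: int_rep_prod => i; exact: AP.
by apply: int_rep_prod => i; exact: AP.
Qed.

(** Liouville's bound. A left kernel vector of [E] would be an integer relation between powers of
    [lam], so [\det E] is a nonzero integer. As the top entry of [v] is 1, it equals [a ^ D * z]
    times the top entry of [\adj E *m v]. *)
Lemma int_rep_gt (D b : nat) (z : R) : `|lam| <= 1 -> int_rep D b z -> z != 0 ->
  1 <= `|z| * ((absz a) ^ D * (d.+1 * (d`! * b ^ d)))%:R.
Proof.
move=> lam1 [E [EE Eb]] z0.
have detE : \det E != 0.
  apply/det0P => -[u u0 uE]; case/negP: u0; apply/eqP; apply: indep.
  have : toR (u *m E) *m v = 0 by rewrite uE map_mx0 mul0mx.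
  rewrite map_mxM -mulmxA EE -scalemxAr => /eqP.
  rewrite scaler_eq0 mulf_eq0 expf_eq0 intr_eq0 (negbTE a0) andbF (negbTE z0)/=.
  by move/eqP.
have : toR (\adj E) *m (toR E *m v) = (\det E)%:~R *: v.
  by rewrite mulmxA -map_mxM mul_adj_mx map_scalar_mx mul_scalar_mx.
rewrite EE -scalemxAr => /matrixP/(_ 0 0).
rewrite !mxE/= expr0 mulr1 => /(congr1 (fun x => `|x|)) detN.
have d1 : (1 : R) <= `|(\det E)%:~R|.
  by rewrite -intr_norm -[1]/(1%:~R) ler_int; move: detE; lia.
apply: (le_trans d1); rewrite -detN normrM normrM normrX -mulrA mulrCA natrM.
rewrite natrX natr_absz -intr_norm; apply: ler_wpM2l => //.
apply: ler_wpM2l; first by rewrite exprn_ge0.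
apply: le_trans (ler_norm_sum _ _ _) _.
apply: (@le_trans _ _ (\sum_(j < d.+1) (d`! * b ^ d)%:R)); last first.
  by rewrite sumr_const card_ord -[_ *+ _]mulr_natl -natrM.
apply: ler_sum => j _; rewrite !mxE normrM.
rewrite -[leRHS]mulr1; apply: ler_pM => //; last by rewrite normrX exprn_ile1.
rewrite -intr_norm -natr_absz ler_nat /cofactor abszM abszX.
rewrite exp1n mul1n; apply: det_bound => x y; rewrite !mxE; exact: Eb.
Qed.

End Representation.

Lemma real_det_bound (n : nat) (E : 'M[R]_n) (b : R) :
  (forall i j, `|E i j| <= b) -> `|\det E| <= n`!%:R * b ^+ n.
Proof.
move=> Eb; apply: le_trans (ler_norm_sum _ _ _) _.
apply: (@le_trans _ _ (\sum_(s : 'S_n) (b ^+ n))); last first.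
  by rewrite sumr_const card_Sn mulr_natl.
apply: ler_sum => s _; rewrite normrM normr_sign mul1r normr_prod.
rewrite -[n in leRHS]card_ord -prodr_const.
by apply: ler_prod => i _; rewrite normr_ge0/=.
Qed.

(* Cramer's rule on a maximal nonvanishing minor. *)
Lemma cramer_bound (k n : nat) (A : 'M[R]_(k, n)) (w : 'rV[R]_n) :
  (w <= A)%MS ->
  exists r : nat, exists f : 'I_r -> 'I_k, exists g : 'I_r -> 'I_n,
  [/\ (r <= n)%N, \det (mxsub f g A) != 0 &
   forall (t : 'cV[R]_n) (b e : R), (forall i j, `|A i j| <= b) ->
     (forall j, `|w 0 j| <= b) -> (forall i, `|(A *m t) i 0| <= e) ->
     `|\det (mxsub f g A)| * `|(w *m t) 0 0| <= r%:R * r`!%:R * b ^+ r * e].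
Proof.
move=> wA; set r := \rank A; pose f := maxrankfun A.
pose A1 := rowsub f A.
have A1free : row_free A1 by exact: maxrowsub_free.
have A1full : row_full A1^T by rewrite /row_full mxrank_tr.
pose g := fullrankfun A1full.
have gu : rowsub g A1^T \in unitmx := fullrowsub_unit A1full.
have UE : mxsub f g A = (rowsub g A1^T)^T by apply/matrixP => i j; rewrite !mxE.
have Uu : mxsub f g A \in unitmx by rewrite UE unitmx_tr.
exists r, f, g; split; first exact: rank_leq_col.
  by rewrite -unitfE -unitmxE.
move=> t b e Ab wb te.
have /submxP[x wE] : (w <= A1)%MS by rewrite eq_maxrowsub.
have xU : x *m mxsub f g A = colsub g w.
  rewrite wE; apply/rowP => j; rewrite !mxE; apply: eq_bigr => i _.
  by rewrite !mxE.
have xdet : \det (mxsub f g A) *: x = colsub g w *m \adj (mxsub f g A).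
  by rewrite -xU -mulmxA mul_mx_adj mul_mx_scalar.
have dwE : \det (mxsub f g A) * (w *m t) 0 0 =
    \sum_i (\sum_j w 0 (g j) * \adj (mxsub f g A) j i) * (A *m t) (f i) 0.
  have -> : \det (mxsub f g A) * (w *m t) 0 0 =
      (\det (mxsub f g A) *: (w *m t)) 0 0 by rewrite !mxE.
  rewrite wE -mulmxA scalemxAl xdet mxE; apply: eq_bigr => i _; congr (_ * _).
    by rewrite mxE; apply: eq_bigr => j _; rewrite [X in X * _ = _]mxE -wE.
  by rewrite !mxE; apply: eq_bigr => j _; rewrite !mxE.
rewrite -normrM dwE; apply: le_trans (ler_norm_sum _ _ _) _.
have -> : r%:R * r`!%:R * b ^+ r * e = \sum_(i < r) (r`!%:R * b ^+ r * e).
  by rewrite sumr_const card_ord -[RHS]mulr_natl !mulrA.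
apply: ler_sum => i _; rewrite normrM.
have r0 : (0 < r)%N by apply: leq_ltn_trans (ltn_ord i).
have b0 : 0 <= b by apply: le_trans (Ab (f i) (g i)).
apply: ler_pM => //.
apply: le_trans (ler_norm_sum _ _ _) _.
have -> : r`!%:R * b ^+ r = \sum_(j < r) (b * (r.-1`!%:R * b ^+ r.-1)).
  rewrite sumr_const card_ord -[RHS]mulr_natl -(prednK r0) factS exprS natrM /=.
  by rewrite -!mulrA; congr (_ * _); rewrite mulrCA.
apply: ler_sum => j _; rewrite normrM; apply: ler_pM => //.
rewrite mxE /cofactor normrM normr_sign mul1r.
by apply: real_det_bound => x' y'; rewrite !mxE; exact: Ab.
Qed.

End Liouville.

(** * Spans of nearly vanishing differences *)

Lemma expn_mono (m n e : nat) : (m <= n)%N -> (m ^ e <= n ^ e)%N.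
Proof. by case: e => [//|e mn]; rewrite leq_exp2r. Qed.

Section NearSpan.
Context {R : realType} {I : finType}.
Implicit Types (lam : R) (t : I -> R) (s : seq I).

(* The sum [rsum lam t s] as a linear form in the translations [t]. *)
Definition wvec lam s : 'rV[R]_#|I| :=
  \row_j rsum lam (fun i => (i == enum_val j)%:R) s.

Definition tcol t : 'cV[R]_#|I| := \col_j t (enum_val j).

Lemma wvec_cons lam a s :
  wvec lam (a :: s) = delta_mx 0 (enum_rank a) + lam *: wvec lam s.
Proof.
apply/rowP => j; rewrite !mxE /= ?eqxx /=; congr (_%:R + _).
by rewrite -(inj_eq enum_val_inj) enum_rankK eq_sym.
Qed.

Lemma wvec_cat lam s1 s2 :
  wvec lam (s1 ++ s2) = wvec lam s1 + lam ^+ size s1 *: wvec lam s2.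
Proof. by apply/rowP => j; rewrite !mxE rsum_cat. Qed.

Lemma wvec_tcol lam t s : (wvec lam s *m tcol t) 0 0 = rsum lam t s.
Proof.
elim: s => [|a s IH].
  have -> : wvec lam [::] = 0 by apply/rowP => j; rewrite !mxE.
  by rewrite mul0mx mxE.
rewrite wvec_cons mulmxDl -scalemxAl mxE [X in _ + X]mxE IH /=.
by rewrite -rowE !mxE enum_rankK.
Qed.

Definition word_diff lam (n : nat) (w : 'rV[R]_#|I|) : Prop :=
  exists s s', [/\ size s = n, size s' = n & w = wvec lam s - wvec lam s'].

(** The entries of [A] are integer polynomials in [lam] of degree at most [n], with representations
    of exponential size; a nonzero minor is therefore at least exponentially small in [n], and
    Cramer's rule loses only the factor [c * q ^ n]. What matters is that [c] and [q] do not depend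
    on [n], [k] or [A]. *)
Lemma near_span lam t : `|lam| < 1 -> algebraicOver (ratr : rat -> R) lam ->
  exists c q : nat, forall (n k : nat) (A : 'M[R]_(k, #|I|)) (w : 'rV[R]_#|I|) (e : R),
    (forall i, word_diff lam n (row i A)) -> word_diff lam n w -> (w <= A)%MS ->
    0 <= e -> (forall i, `|(A *m tcol t) i 0| <= e) ->
    `|(w *m tcol t) 0 0| <= c%:R * q%:R ^+ n * e.
Proof.
move=> lam1 /algebraic_matrix[d [a [B [a0 BE indep]]]].
have [b0 b0P] := int_rep_lam BE.
(* A new letter multiplies the size by at most [(d + 1) * b0] and adds a power of [|a|]; [gam]
   dominates both. *)
pose gam := (absz a + d.+1 * b0)%N.
have a1 : (0 < absz a)%N by rewrite absz_gt0.
have repE n s j : size s = n -> int_rep lam d a n (gam ^ n) (wvec lam s 0 j).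
  move=> <- {n}; elim: s => [|i s IH].
    by rewrite mxE /=; exact: (@int_rep_nat _ lam d a 0 false).
  rewrite mxE /=; have := IH; rewrite mxE => {}IH.
  have h := int_repD (@int_rep_nat _ lam d a (size s).+1 (i == enum_val j)) (int_repM b0P IH).
  apply: int_rep_le h; rewrite !expnS /gam mulnDl leq_add//.
    by rewrite leq_mul// expn_mono// leq_addr.
  by rewrite mulnA.
have repD n w j : word_diff lam n w -> int_rep lam d a n (2 * gam ^ n) (w 0 j).
  move=> [s [s' [ss ss' ->]]]; rewrite !mxE mul2n -addnn.
  apply: int_repD; first by have := repE n s j ss; rewrite mxE.
  by apply: int_repN; have := repE n s' j ss'; rewrite mxE.
have [Nf NfP] : exists Nf : 'I_#|I| -> nat, forall j s,
    `|rsum lam (fun i => (i == enum_val j)%:R) s| <= (Nf j)%:R.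
  have H (j : 'I_#|I|) : exists N : nat, forall s,
      `|rsum lam (fun i => (i == enum_val j)%:R) s| <= N%:R by exact: rsum_bounded.
  exact: (fin_all_exists H).
(* The summand 1 keeps [Bd] positive, so that its powers increase with the size of the minor. *)
pose Bd := (1 + 2 * \sum_j Nf j)%N.
have bdD n w j : word_diff lam n w -> `|w 0 j| <= Bd%:R.
  move=> [s [s' [ss ss' ->]]]; rewrite !mxE.
  apply: le_trans (ler_normB _ _) _.
  apply: (@le_trans _ _ ((Nf j)%:R + (Nf j)%:R)); first by apply: lerD; exact: NfP.
  by rewrite -natrD ler_nat /Bd (bigD1 j)//= ; lia.
pose n0 := #|I|.
exists (n0 * n0`! * Bd ^ n0 * (d.+1 * (d`! * (n0`! * (d.+1 * 2) ^ n0) ^ d)))%N.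
exists (absz a ^ n0 * gam ^ (n0 * d))%N.
move=> n k A w e Adiff wdiff wA e0 Ae.
have [r [f [g [rn det0 cr]]]] := cramer_bound wA.
have Aij i j : A i j = row i A 0 j by rewrite mxE.
have := cr (tcol t) Bd%:R e (fun i j => _) (fun j => bdD _ _ j wdiff) Ae.
set del := \det _ in det0 *; set y := (w *m _) 0 0 => cr1.
have crb : `|del| * `|y| <= (n0 * n0`! * Bd ^ n0)%:R * e.
  apply: le_trans (cr1 _) _; first by move=> i j; rewrite Aij; exact: bdD (Adiff i).
  rewrite -natrX -!natrM; apply: ler_wpM2r => //; rewrite ler_nat.
  by apply: leq_mul; [apply: leq_mul => //; exact: leq_fact | rewrite leq_pexp2l].
have delrep : int_rep lam d a (r * n) (r`! * (d.+1 * (2 * gam ^ n)) ^ r) del.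
  by apply: int_rep_det => i j; rewrite mxE Aij; exact: repD (Adiff _).
have := int_rep_gt a0 indep (ltW lam1) delrep det0.
set K1 := (_ * _)%N => K1P.
have K1le : (K1 <= (d.+1 * (d`! * (n0`! * (d.+1 * 2) ^ n0) ^ d)) *
    (absz a ^ n0 * gam ^ (n0 * d)) ^ n)%N.
  have gam1 : (0 < gam)%N by rewrite /gam addn_gt0 a1.
  have h1 : (absz a ^ (r * n) <= absz a ^ (n0 * n))%N.
    by rewrite leq_pexp2l// leq_mul2r rn orbT.
  have h2 : ((r`! * (d.+1 * (2 * gam ^ n)) ^ r) ^ d <=
      (n0`! * (d.+1 * 2) ^ n0) ^ d * gam ^ (n0 * d * n))%N.
    have -> : (gam ^ (n0 * d * n) = ((gam ^ n) ^ n0) ^ d)%N.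
      by rewrite -!expnM; congr (_ ^ _)%N; rewrite mulnC mulnA.
    rewrite -expnMn; apply: expn_mono; rewrite -mulnA -expnMn -mulnA.
    by apply: leq_mul; [exact: leq_fact | rewrite leq_pexp2l// !muln_gt0 expn_gt0 gam1].
  have -> : ((absz a ^ n0 * gam ^ (n0 * d)) ^ n = absz a ^ (n0 * n) * gam ^ (n0 * d * n))%N.
    by rewrite expnMn -!expnM.
  rewrite /K1; apply: leq_trans (leq_mul h1 (leq_mul (leqnn d.+1) (leq_mul (leqnn d`!) h2))) _.
  move: (_ ^ (n0 * n))%N (gam ^ _)%N (_ ^ d)%N => u1 u2 u3; rewrite leq_eqVlt; apply/orP; left.
  by apply/eqP; ring.
have y0 : 0 <= `|y| by [].
apply: (@le_trans _ _ (`|y| * (`|del| * K1%:R))).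
  by rewrite ler_peMr.
apply: (@le_trans _ _ ((n0 * n0`! * Bd ^ n0)%:R * e * K1%:R)).
  by rewrite mulrA [`|y| * _]mulrC; apply: ler_wpM2r.
set C1 := (n0 * n0`! * Bd ^ n0)%N; move: K1le; set C2 := (d.+1 * _)%N => K1le.
have -> (x : nat) : (C1 * C2)%:R * x%:R ^+ n * e = C1%:R * e * (C2 * x ^ n)%:R :> R.
  by rewrite (natrM _ C1 C2) (natrM _ C2 (x ^ n)) (natrX _ x n) -!mulrA; congr (_ * _); rewrite [RHS]mulrC -mulrA.
by apply: ler_wpM2l; [rewrite mulr_ge0 | rewrite ler_nat].
Qed.

End NearSpan.

(** The arithmetic of a rank drop: [3 * e] per letter is the difference between [h + e] and [h - e]
    increased by the rounding [l5], and the passage from rank [r1] to [r2] pays for it. *)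
Lemma drop_bound {R : realType} (n h e l5 x a b d f z M r1 r2 : R) :
  a + b <= d + f -> z <= b + l5 -> (n + n) * (h - e) <= z ->
  f <= (n + n) * (h + e) -> l5 <= (n + n) * e -> d <= x + x ->
  x <= n * (h + e * (1 + 3 * (M - r1))) ->
  (n + n) * e * (r2 + 1) <= (n + n) * e * r1 ->
  a <= (n + n) * (h + e * (1 + 3 * (M - r2))).
Proof. by move=> *; lra. Qed.

(** * Stabilization of the spans of close differences *)

Section RateLowerBound.
Context {R : realType} {I : finType}.
Context (lam : R) (t : I -> R) (N0 : nat).
Context (I0 : (0 < #|I|)%N) (lam0 : lam != 0) (lam1 : `|lam| < 1).
Context (N0P : forall s, `|rsum lam t s| <= N0%:R).
Local Notation r := `|lam|.
Local Notation X := (rsum lam t).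
Local Notation H := (went lam t).

Lemma pow_small (y : R) : 0 < y -> exists p : nat, forall n, (p <= n)%N -> r ^+ n <= y.
Proof.
move=> y0; have [p pP] := nat_large (ln y^-1) (L_gt0 lam0 lam1).
exists p => n /pP; rewrite -lnrX// ler_ln ?posrE ?invr_gt0 ?rX_gt0//.
by rewrite lef_pV2 ?posrE ?rX_gt0.
Qed.

Lemma ent_inj (Om : finType) (T : eqType) (f : Om -> T) : injective f ->
  (0 < #|Om|)%N -> ent f = ln #|Om|%:R :> R.
Proof.
move=> fi Om0; rewrite -[RHS](avg_cst _ Om0); apply: eq_avg => w.
have -> : fsize f w = 1%N; last by rewrite divr1.
by rewrite -(card1 w); apply: eq_card => w'; rewrite !inE (inj_eq fi).
Qed.

(** The entropy of words as linear forms modulo the row space of [V], which is the kernel of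
    multiplication by [cokermx V]. *)
Definition emod (n k : nat) (V : 'M[R]_(k, #|I|)) : R :=
  ent (fun s : n.-tuple I => wvec lam s *m cokermx V).

Lemma eq_modE (k : nat) (V : 'M[R]_(k, #|I|)) (w w' : 'rV[R]_#|I|) :
  w *m cokermx V = w' *m cokermx V <-> (w - w' <= V)%MS.
Proof.
rewrite submxE mulmxBl subr_eq0; split; [by move=> ->|by move/eqP].
Qed.

Lemma emod_le (n k k' : nat) (V : 'M[R]_(k, #|I|)) (V' : 'M[R]_(k', #|I|)) :
  (V <= V')%MS -> emod n V' <= emod n V.
Proof.
move=> VV'; apply: ent_det => s s' /eq_modE h; apply/eq_modE.
exact: submx_trans VV'.
Qed.

Lemma emod_add (n m k : nat) (V : 'M[R]_(k, #|I|)) :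
  emod (n + m) V <= emod n V + emod m V.
Proof.
rewrite /emod -ent_prod ?card_word// -(ent_comp_bij _ (catw_bij n m)).
apply: ent_det => -[s u] [s' u'] /= [e1 e2].
by rewrite !wvec_cat !size_tuple !mulmxDl -!scalemxAl e1 e2.
Qed.

Lemma emod_submod (n k k' : nat) (V : 'M[R]_(k, #|I|)) (V' : 'M[R]_(k', #|I|)) :
  emod n (V :&: V')%MS + emod n (V + V')%MS <= emod n V + emod n V'.
Proof.
apply: ent_submod => s s' /eq_modE h.
- by apply/eq_modE; apply: submx_trans h (addsmxSl _ _).
- by apply/eq_modE; apply: submx_trans h (addsmxSr _ _).
- by move=> /eq_modE h'; apply/eq_modE; rewrite sub_capmx h h'.
Qed.

Context (p : nat).

(** Pairs in different cells give a zero row, so that [near_mx] can be indexed by all pairs. *)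
Definition near_pair (n : nat) (w : n.-tuple I * n.-tuple I) : 'rV[R]_#|I| :=
  if cell (r ^+ (n + p * n)) (X w.1) == cell (r ^+ (n + p * n)) (X w.2)
  then wvec lam w.1 - wvec lam w.2 else 0.

Definition near_mx (n : nat) : 'M[R]_(#|{: n.-tuple I * n.-tuple I}|, #|I|) :=
  \matrix_i near_pair (enum_val i).

Lemma near_pair_diff n (w : n.-tuple I * n.-tuple I) : word_diff lam n (near_pair w).
Proof.
rewrite /near_pair; case: ifP => _.
  by exists w.1, w.2; rewrite !size_tuple.
by exists w.1, w.1; rewrite !size_tuple subrr.
Qed.

Lemma near_pair_le n (w : n.-tuple I * n.-tuple I) :
  `|(near_pair w *m tcol t) 0 0| <= r ^+ (n + p * n).
Proof.
have r0 := rX_gt0 lam0 (n + p * n).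
rewrite /near_pair; case: eqP => [/(eq_cell r0)/ltW h|_].
  by rewrite mulmxBl mxE [X in _ + X]mxE !wvec_tcol.
by rewrite mul0mx mxE normr0 ltW.
Qed.

Lemma emod_near n : emod n (near_mx n) <= H n (n + p * n).
Proof.
apply: ent_det => s s' ss; apply/eq_modE.
have -> : wvec lam s - wvec lam s' = row (enum_rank (s, s')) (near_mx n).
  by rewrite rowK enum_rankK /near_pair/= ss eqxx.
exact: row_sub.
Qed.

Lemma word_diff_ext n m (w : 'rV[R]_#|I|) : word_diff lam n w -> word_diff lam (n + m) w.
Proof.
move=> [s [s' [ss ss' ->]]]; have /card_gt0P[i _] := I0.
exists (s ++ nseq m i), (s' ++ nseq m i); rewrite !size_cat size_nseq ss ss'.
by split=> //; rewrite !wvec_cat ss ss' opprD addrACA subrr addr0.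
Qed.

Context (c q : nat).
Context (spanP : forall (n k : nat) (A : 'M[R]_(k, #|I|)) (w : 'rV[R]_#|I|) (e : R),
    (forall i, word_diff lam n (row i A)) -> word_diff lam n w -> (w <= A)%MS ->
    0 <= e -> (forall i, `|(A *m tcol t) i 0| <= e) ->
    `|(w *m tcol t) 0 0| <= c%:R * q%:R ^+ n * e).
Context (q0 : (0 < q)%N) (qp : q%:R ^+ 2 * r ^+ p <= r / 2).

(** The choice of [p] in [qp] leaves a factor [2 ^- n], which absorbs [c]. The first form serves
    words of length [n + n], the second words of length [n]. *)
Lemma near_small n : (c <= n)%N ->
  c%:R * q%:R ^+ (n + n) * r ^+ (n + p * n) <= r ^+ (n + n) /\
  c%:R * q%:R ^+ n * r ^+ (n + p * n) <= r ^+ (n + n).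
Proof.
move=> cn.
have h : c%:R * q%:R ^+ (n + n) * r ^+ (n + p * n) <= r ^+ (n + n).
  have -> : c%:R * q%:R ^+ (n + n) * r ^+ (n + p * n) =
      c%:R * (q%:R ^+ 2 * r ^+ p) ^+ n * r ^+ n.
    rewrite exprMn -!exprM mul2n -addnn [r ^+ (n + _)]exprD -!mulrA.
    by congr (_ * (_ * _)); rewrite mulrC.
  have : (q%:R ^+ 2 * r ^+ p) ^+ n <= (r / 2) ^+ n.
    by apply: lerXn2r => //; rewrite nnegrE ?mulr_ge0 ?exprn_ge0.
  rewrite [(r / 2) ^+ n]exprMn exprVn => hn.
  have c2 : c%:R <= 2 ^+ n :> R.
    rewrite -natrX ler_nat; apply: leq_trans cn _.
    exact/ltnW/ltn_expl.
  rewrite [leRHS]exprD; apply: ler_wpM2r; first by rewrite exprn_ge0.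
  apply: (le_trans (ler_wpM2l (ler0n R c) hn)).
  rewrite mulrCA ler_piMr ?exprn_ge0//.
  by rewrite ler_pdivrMr ?exprn_gt0// mul1r.
split=> //; apply: le_trans h; apply: ler_wpM2r; first by rewrite exprn_ge0.
apply: ler_wpM2l => //; apply: ler_weXn2l; last exact: leq_addr.
by rewrite ler1n.
Qed.

(** Two words that agree modulo [V] differ by an element of the span of near differences, hence by
    at most [r ^+ (n + n)] in value: the quotient by so large a space still sees the entropy at that
    scale. Differences of length [n] are padded to length [n + n]. *)
Lemma near_sum n k (V : 'M[R]_(k, #|I|)) : (c <= n)%N ->
  (V <= near_mx n + near_mx (n + n))%MS ->
  H (n + n) (n + n) <= emod (n + n) V + ln 5.
Proof.
move=> cn Vn; apply: (@ent_cell_le1 _ _ _ 1); first exact: rX_gt0.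
move=> s s' /eq_modE h.
have := submx_trans h Vn; rewrite addsmxE => hA.
have e0 : 0 <= r ^+ (n + p * n) by rewrite exprn_ge0.
have [ns _] := near_small cn.
have rowP i : word_diff lam (n + n) (row i (col_mx (near_mx n) (near_mx (n + n)))) /\
    `|(col_mx (near_mx n) (near_mx (n + n)) *m tcol t) i 0| <= r ^+ (n + p * n).
  have -> : (col_mx (near_mx n) (near_mx (n + n)) *m tcol t) i 0 =
      (row i (col_mx (near_mx n) (near_mx (n + n))) *m tcol t) 0 0.
    by rewrite -row_mul [RHS]mxE.
  case: (split_ordP i) => j ->.
    rewrite rowKu rowK; split; last exact: near_pair_le.
    exact/word_diff_ext/near_pair_diff.
  rewrite rowKd rowK; split; first exact: near_pair_diff.
  by apply: le_trans (near_pair_le _) _; apply: rX_le => //; lia.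
have wd : word_diff lam (n + n) (wvec lam s - wvec lam s').
  by exists s, s'; rewrite !size_tuple.
have := spanP (fun i => (rowP i).1) wd hA e0 (fun i => (rowP i).2).
rewrite mulmxBl mxE [X in _ + X]mxE !wvec_tcol mul1r => hh.
exact: le_trans hh ns.
Qed.

Context (h : R).
Context (Hlow : forall d, 0 < d ->
  exists N, forall n, (N <= n)%N -> n%:R * (h - d) <= H n n).
Context (HA : forall e, 0 < e ->
  exists N, forall n, (N <= n)%N -> H n (n + p * n) <= n%:R * (h + e)).
Context (noover : forall n (s s' : n.-tuple I), X s = X s' -> s = s').

Lemma rate_ge_log_card : ln #|I|%:R <= h.
Proof.
rewrite leNgt; apply/negP => hI.
pose M := #|I|; have M10 : 0 < 1 + 3 * M%:R :> R.
  by rewrite addr_gt0// mulr_gt0// ltr0n.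
pose eps := (ln #|I|%:R - h) / (2 * (1 + 3 * M%:R)).
have e0 : 0 < eps by rewrite divr_gt0 ?subr_gt0// mulr_gt0.
have [n1 n1P] := Hlow e0; have [n2 n2P] := HA e0.
have [n3 n3P] := nat_large (ln 5) e0.
pose n0 := (maxn 1 (maxn n1 (maxn n2 (maxn n3 c)))).
pose N k := (2 ^ k * n0)%N.
have NS k : N k.+1 = (N k + N k)%N by rewrite /N expnS -mulnA mul2n addnn.
have Nn0 k : (n0 <= N k)%N by rewrite /N leq_pmull// expn_gt0.
have Nk k : (k <= N k)%N.
  apply: leq_trans (_ : 2 ^ k <= _)%N; first exact/ltnW/ltn_expl.
  by rewrite /N leq_pmulr// /n0; clear; lia.
have Ngt k : 0 < (N k)%:R :> R.
  by rewrite ltr0n; apply: leq_trans (Nn0 k); rewrite /n0; clear; lia.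
have P1 k : (N k)%:R * (h - eps) <= H (N k) (N k).
  by apply: n1P; apply: leq_trans (Nn0 k); rewrite /n0; clear; lia.
have P2 k : emod (N k) (near_mx (N k)) <= (N k)%:R * (h + eps).
  apply: le_trans (emod_near _) _.
  by apply: n2P; apply: leq_trans (Nn0 k); rewrite /n0; clear; lia.
have P3 k : ln 5 <= (N k)%:R * eps.
  by apply: n3P; apply: leq_trans (Nn0 k); rewrite /n0; clear; lia.
have Pc k : (c <= N k)%N by apply: leq_trans (Nn0 k); rewrite /n0; clear; lia.
(* [<<_>>] makes the first matrix square, like the intersections that follow. *)
pose W := fix W k : 'M[R]_M := match k with
  | 0 => <<near_mx (N 0)>>%MS
  | k'.+1 => (W k' :&: near_mx (N k))%MS end.
have WN k : (W k <= near_mx (N k))%MS.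
  by case: k => [|k] /=; [rewrite genmxE | exact: capmxSr].
have WW k : (W k.+1 <= W k)%MS by exact: capmxSl.
(* If the rank is unchanged, concatenation keeps the bound per letter. If it drops, submodularity is
   applied to [W k] and the new span, whose sum carries at least [h - 2 * eps] per letter by
   [near_sum]. *)
have main k : emod (N k) (W k) <=
    (N k)%:R * (h + eps * (1 + 3 * (M%:R - (\rank (W k))%:R))).
  elim: k => [|k IH].
    apply: le_trans (emod_le _ (_ : near_mx (N 0) <= _)%MS) _; first by rewrite genmxE.
    apply: le_trans (P2 0%N) _; apply: ler_wpM2l => //; rewrite lerD2l.
    apply: ler_peMr; first exact: ltW.
    by rewrite lerDl mulr_ge0// subr_ge0 ler_nat rank_leq_col.
  have add2 : emod (N k.+1) (W k) <= emod (N k) (W k) + emod (N k) (W k).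
    by rewrite NS; exact: emod_add.
  have N2 : (N k.+1)%:R = (N k)%:R + (N k)%:R :> R by rewrite NS natrD.
  have [rk|rk] := eqVneq (\rank (W k.+1)) (\rank (W k)).
    have WeW : (W k <= W k.+1)%MS.
      by rewrite -(geq_leqif (mxrank_leqif_sup (WW k))) rk.
    rewrite rk; apply: le_trans (emod_le _ WeW) _.
    by apply: le_trans add2 _; rewrite N2 mulrDl; exact: lerD.
  have rk1 : (\rank (W k.+1)).+1%:R <= (\rank (W k))%:R :> R.
    by rewrite ler_nat ltn_neqAle rk mxrankS.
  have sm := emod_submod (N k.+1) (W k) (near_mx (N k.+1)).
  have ns : H (N k.+1) (N k.+1) <= emod (N k.+1) (W k + near_mx (N k.+1))%MS + ln 5.
    by rewrite NS; apply: near_sum => //; apply: addsmxS.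
  have p1 := P1 k.+1; have p2 := P2 k.+1; have p3 := P3 k.+1.
  rewrite -/(W k.+1) in sm.
  have Ne : 0 <= (N k.+1)%:R * eps by rewrite mulr_ge0// ltW.
  have rk2 := ler_wpM2l Ne rk1.
  move: rk2; rewrite -natr1 => rk2.
  rewrite N2 in p1 p2 p3 rk2 *.
  exact: drop_bound sm ns p1 p2 p3 add2 IH rk2.
have rkex : exists n, `[< exists k, \rank (W k) = n >].
  by exists (\rank (W 0)); apply/asboolP; exists 0%N.
have [d /asboolP[k0 k0d] dmin] := ex_minnP rkex.
have Wk i : (W (k0 + i)%N <= W k0)%MS.
  elim: i => [|i IH]; first by rewrite addn0.
  by rewrite addnS; exact: submx_trans (WW _) IH.
have Wst i : (W k0 <= W (k0 + i)%N)%MS.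
  rewrite -(geq_leqif (mxrank_leqif_sup (Wk i))) k0d.
  by apply: dmin; apply/asboolP; exists (k0 + i)%N.
have small : emod (N k0) (W k0) < (N k0)%:R * ln #|I|%:R.
  apply: le_lt_trans (main k0) _; rewrite ltr_pM2l//.
  have : eps * (1 + 3 * (M%:R - (\rank (W k0))%:R)) <= eps * (1 + 3 * M%:R).
    by rewrite ler_pM2l// lerD2l ler_pM2l// lerBlDr lerDl.
  have : eps * (1 + 3 * M%:R) = (ln #|I|%:R - h) / 2.
    by rewrite /eps; field; rewrite lt0r_neq0.
  by move: hI; lra.
have [s [s' [ss' nss']]] : exists s s' : (N k0).-tuple I,
    (wvec lam s - wvec lam s' <= W k0)%MS /\ s <> s'.
  apply: contrapT => none.
  have inj : injective (fun s : (N k0).-tuple I => wvec lam s *m cokermx (W k0)).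
    move=> s s' /eq_modE h1; apply: contrapT => h2.
    by apply: none; exists s, s'.
  move: small; rewrite /emod ent_inj ?card_word// card_tuple natrX lnXn ?ltr0n//.
  by rewrite -[ln _ *+ _]mulr_natl ltxx.
apply: nss'; apply: noover.
apply/eqP; rewrite -subr_eq0 -normr_le0 leNgt; apply/negP => pos.
have [p1 p1P] := pow_small (divr_gt0 pos (ltr0Sn R 1)).
(* A common tail does not change the difference of two words, so the same vector can be tested at
   every later level. *)
have wd i : word_diff lam (N (k0 + i)) (wvec lam s - wvec lam s').
  have le : (N k0 <= N (k0 + i)%N)%N by rewrite /N leq_mul// leq_pexp2l// leq_addr.
  rewrite -(subnKC le); apply: word_diff_ext.
  by exists s, s'; rewrite !size_tuple.
have bd : `|X s - X s'| <= r ^+ (N (k0 + p1) + N (k0 + p1))%N.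
  have sub := submx_trans (submx_trans ss' (Wst p1)) (WN _).
  set n := N (k0 + p1) in sub *.
  have e1 : 0 <= r ^+ (n + p * n) by rewrite exprn_ge0.
  have rd i : word_diff lam n (row i (near_mx n)) by rewrite rowK; exact: near_pair_diff.
  have rl i : `|(near_mx n *m tcol t) i 0| <= r ^+ (n + p * n).
    have -> : (near_mx n *m tcol t) i 0 = (row i (near_mx n) *m tcol t) 0 0.
      by rewrite -row_mul [RHS]mxE.
    by rewrite rowK; exact: near_pair_le.
  have := spanP rd (wd p1) sub e1 rl.
  rewrite mulmxBl mxE [X in _ + X]mxE !wvec_tcol => hh.
  by apply: le_trans hh _; case: (@near_small n (Pc _)).
have : `|X s - X s'| <= `|X s - X s'| / 2.
  apply: le_trans bd _; apply: p1P; apply: leq_trans (leq_addr _ _).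
  by apply: leq_trans (Nk _); exact: leq_addl.
by move: pos; lra.
Qed.

End RateLowerBound.

Section Homogeneous.
Context {R : realType} {I : finType}.
Context (lam : R) (t : I -> R).
Context (I0 : (0 < #|I|)%N) (lam0 : lam != 0) (lam1 : `|lam| < 1).
Context (lamalg : algebraicOver (ratr : rat -> R) lam).
Context (noover : forall n (s s' : n.-tuple I), rsum lam t s = rsum lam t s' -> s = s').
Local Notation r := `|lam|.
Local Notation X := (rsum lam t).
Local Notation H := (went lam t).
Local Notation L := (- ln `|lam|).

(** Otherwise the rate [h] is at most [kap], hence below both [L] and [ln #|I|]. The first
    inequality gives the bound at fine scales, from which [rate_ge_log_card] contradicts the
    second. *)
Lemma went_growth (kap : R) : kap < L -> kap < ln #|I|%:R ->
  exists N, forall n, (N <= n)%N -> n%:R * kap <= H n n.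
Proof.
move=> kL kI; have [N0 N0P] := rsum_bounded t lam1.
have [h h0 [C C0 [Hup Hlow]]] := went_rate I0 lam0 lam1 N0P.
suff hk : kap < h.
  have hk0 : 0 < h - kap by rewrite subr_gt0.
  by have [N NP] := Hlow _ hk0; exists N => n /NP; rewrite subKr.
rewrite ltNge; apply/negP => hk.
have hL : h < L by exact: le_lt_trans kL.
have [c [q0 spanP]] := near_span t lam1 lamalg.
pose q := q0.+1.
have spanQ n k (A : 'M[R]_(k, #|I|)) (w : 'rV[R]_#|I|) (e : R) :
    (forall i, word_diff lam n (row i A)) -> word_diff lam n w -> (w <= A)%MS ->
    0 <= e -> (forall i, `|(A *m tcol t) i 0| <= e) ->
    `|(w *m tcol t) 0 0| <= c%:R * q%:R ^+ n * e.
  move=> h1 h2 h3 h4 h5; apply: le_trans (spanP n k A w e h1 h2 h3 h4 h5) _.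
  apply: ler_wpM2r => //; apply: ler_wpM2l => //.
  by rewrite -!natrX ler_nat expn_mono.
have q2 : 0 < q%:R ^+ 2 :> R by rewrite exprn_gt0// ltr0n.
have r0 : 0 < r by rewrite normr_gt0.
have y0 : 0 < (r / 2) / q%:R ^+ 2 by rewrite !divr_gt0.
have [p pP] := pow_small lam0 lam1 y0.
have qp : q%:R ^+ 2 * r ^+ p.+1 <= r / 2.
  by rewrite mulrC -ler_pdivlMr//; apply: pP.
have HA e : 0 < e -> exists N, forall n, (N <= n)%N -> H n (n + p.+1 * n) <= n%:R * (h + e).
  by move=> e0; exact: (went_fine_le I0 lam0 lam1 N0P h0 C0 hL Hup Hlow).
have := rate_ge_log_card I0 lam0 lam1 spanQ (ltn0Sn q0) qp Hlow HA noover.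
by rewrite leNgt (le_lt_trans hk kI).
Qed.

(** A largest separated set is also a net. A nearby element of [T] leaves boundedly many choices for
    the cell of a word, so [H n n] is at most [ln #|T|] plus a constant. *)
Lemma separated_words (g : nat) (s' : R) : 0 <= s' -> s' < 1 -> s' * L < ln #|I|%:R ->
  exists n, (0 < n)%N /\ exists T : {set n.-tuple I},
    (forall s u, s \in T -> u \in T -> s != u -> g%:R * r ^+ n <= `|X s - X u|) /\
    n%:R * (s' * L) <= ln #|T|%:R.
Proof.
move=> s0 s1 sI; have L0 := L_gt0 lam0 lam1.
have sL : s' * L < L by rewrite gtr_pMl.
pose m := Num.min L (ln #|I|%:R).
have sm : s' * L < m by rewrite lt_min sL sI.
pose kap := (s' * L + m) / 2.
have kL : kap < L by have : m <= L by [rewrite ge_min lexx]; rewrite /kap; lra.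
have kI : kap < ln #|I|%:R.
  by have : m <= ln #|I|%:R by [rewrite ge_min lexx orbT]; rewrite /kap; lra.
have [N1 N1P] := went_growth kL kI.
have gap0 : 0 < (m - s' * L) / 2 by rewrite divr_gt0// subr_gt0.
have [N2 N2P] := nat_large (ln (g.*2.+1).*2.+1%:R) gap0.
pose n := (maxn 1 (maxn N1 N2)).
have grow : n%:R * kap <= H n n by apply: N1P; rewrite /n; clear; lia.
have cst : ln (g.*2.+1).*2.+1%:R <= n%:R * ((m - s' * L) / 2).
  by apply: N2P; rewrite /n; clear; lia.
exists n; split; first by rewrite /n; clear; lia.
have rn0 := rX_gt0 lam0 n.
pose P (T : {set n.-tuple I}) := [forall s in T, forall u in T,
  (s != u) ==> (g%:R * r ^+ n <= `|X s - X u|)].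
have P0 : P finset.set0 by apply/forallP => s; rewrite inE.
case: (arg_maxnP (fun T : {set n.-tuple I} => #|T|) P0) => T PT Tmax.
have sep s u : s \in T -> u \in T -> s != u -> g%:R * r ^+ n <= `|X s - X u|.
  move=> sT uT su; have /forallP/(_ s)/implyP/(_ sT) := PT.
  by move=> /forallP/(_ u)/implyP/(_ uT)/implyP; exact.
exists T; split; first exact: sep.
have near (s : n.-tuple I) : exists u : {u | u \in T}, `|X s - X (val u)| <= g%:R * r ^+ n.
  apply: contrapT => far.
  have farT u : u \in T -> g%:R * r ^+ n < `|X s - X u|.
    move=> uT; rewrite ltNge; apply/negP => h.
    by apply: far; exists (exist _ u uT).
  have sT : s \notin T.
    by apply/negP => /farT; rewrite subrr normr0 ltNge mulr_ge0// ltW.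
  suff /Tmax : P (s |: T) by rewrite /= cardsU1 sT /=; clear; lia.
  apply/forallP => a; apply/implyP => /setU1P[->|aT];
    apply/forallP => b; apply/implyP => /setU1P[->|bT]; apply/implyP => ab.
  - by rewrite eqxx in ab.
  - exact/ltW/farT.
  - by rewrite distrC; exact/ltW/farT.
  - exact: sep.
pose f (s : n.-tuple I) := projT1 (cid (near s)).
have fP (s : n.-tuple I) : `|X s - X (val (f s))| <= g%:R * r ^+ n by rewrite /f; case: cid.
have up : H n n <= ent f + ln (g.*2.+1).*2.+1%:R.
  apply: (@ent_cell_le1 _ _ _ g.*2) => // w w' ff.
  have := fP w; have := fP w'; rewrite -ff -addnn natrD.
  rewrite !ler_norml => /andP[a1 a2] /andP[a3 a4]; apply/andP; split; move: a1 a2 a3 a4; clear; lra.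
have T0 : (0 < #|{: {u | u \in T}}|)%N.
  have /card_gt0P[w _] := card_word n I0.
  by apply/card_gt0P; exists (f w).
have := ent_le_card (R := R) f T0; rewrite card_sig => cardT.
have -> : #|T|%:R = #|[pred x | x \in T]|%:R :> R.
  by congr (_%:R); apply: eq_card.
have kapE : kap = s' * L + (m - s' * L) / 2 by rewrite /kap; lra.
move: grow; rewrite kapE mulrDr; lra.
Qed.

End Homogeneous.

(** * Hausdorff dimension *)

Local Open Scope classical_set_scope.

Section SeparatedCopies.
Context {R : realType} {J : finType}.
Context (rho : R) (tau : J -> R) (K : set R) (x0 : R).
Context (rho0 : 0 < `|rho|) (rho1 : `|rho| < 1) (J0 : (0 < #|J|)%N).
Context (Kx0 : K x0) (Kstable : forall a x, K x -> K (rho * x + tau a)).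
Context (sep : forall a b x y, a != b -> K x -> K y ->
  `|rho| <= `|(rho * x + tau a) - (rho * y + tau b)|).

Definition copy_pt (w : seq J) : R := foldr (fun a x => rho * x + tau a) x0 w.

Lemma copy_pt_in w : K (copy_pt w).
Proof. by elim: w => [//|a w IH] /=; exact: Kstable. Qed.

Lemma copy_pt_agree (k : nat) (w w' : seq J) : size w = size w' ->
  (k <= size w)%N -> `|copy_pt w - copy_pt w'| < `|rho| ^+ k -> take k w = take k w'.
Proof.
elim: k w w' => [|k IH] [|a w] [|b w'] //= [ss] kw lt1.
have [ab|ab] := eqVneq a b; last first.
  have := sep ab (copy_pt_in w) (copy_pt_in w').
  move: lt1; rewrite exprS => lt1 ge1.
  have : `|rho| * `|rho| ^+ k <= `|rho|.
    by apply: ler_piMr; [exact: ltW | apply: exprn_ile1; exact: ltW].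
  by move: (le_lt_trans ge1 lt1); rewrite ltNge => /negbTE ->.
rewrite ab; congr (_ :: _); apply: IH => //.
move: lt1; rewrite ab.
have -> : rho * copy_pt w + tau b - (rho * copy_pt w' + tau b) =
  rho * (copy_pt w - copy_pt w') by rewrite mulrBr; lra.
by rewrite normrM exprS ltr_pM2l.
Qed.

(** Counting takes the place of a mass distribution: the words of length [m] whose points lie in
    [U i] share their first [k i] letters, so they are determined by the rest. *)
Lemma copy_count (m : nat) (D : seq nat) (k : nat -> nat) (U : nat -> set R) :
  (forall i, i \in D -> (k i <= m)%N) ->
  (forall i, i \in D -> forall x y, U i x -> U i y -> `|x - y| < `|rho| ^+ k i) ->
  (forall x, K x -> exists2 i, i \in D & U i x) ->
  (#|J| ^ m <= \sum_(i <- D) #|J| ^ (m - k i))%N.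
Proof.
move=> km Uk cov.
rewrite -card_tuple -sum1_card.
apply: (@leq_trans (\sum_(w : m.-tuple J) \sum_(i <- D) `[< U i (copy_pt w) >])%N).
  apply: leq_sum => w _; have [i iD Ui] := cov _ (copy_pt_in w).
  rewrite (big_rem i)//= (_ : `[< U i (copy_pt w) >] = true) ?leq_addr//.
  exact/asboolP.
rewrite exchange_big/= big_seq [leqRHS]big_seq; apply: leq_sum => i iD.
pose A := [set w : m.-tuple J | `[< U i (copy_pt w) >]]%SET.
have -> : (\sum_(w : m.-tuple J) `[< U i (copy_pt w) >] = #|A|)%N.
  rewrite -sum1_card [RHS]big_mkcond; apply: eq_bigr => w _; rewrite inE.
  by case: asboolP.
rewrite -card_tuple -(card_in_imset (f := fun w : m.-tuple J => [tuple of drop (k i) w])).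
  exact: max_card.
move=> w w'; rewrite !inE => Uw Uw' /(congr1 val)/= dd.
apply/val_inj; rewrite /= -(cat_take_drop (k i) w) -(cat_take_drop (k i) w') dd.
congr (_ ++ _); apply: copy_pt_agree; [by rewrite !size_tuple| |].
  by rewrite size_tuple km.
exact: (Uk _ iD _ _ Uw Uw').
Qed.

Lemma scale_index (d : R) : 0 < d -> d < 1 ->
  exists k, `|rho| ^+ k.+1 <= d /\ d < `|rho| ^+ k.
Proof.
move=> d0 d1; have rn0 : rho != 0 by rewrite -normr_gt0.
have ex : exists k, `|rho| ^+ k.+1 <= d.
  by have [p pP] := pow_small rn0 rho1 d0; exists p; apply: pP.
exists (ex_minn ex); case: ex_minnP => -[|k] h1 h2; split=> //.
by rewrite ltNge; apply/negP => /h2; rewrite ltnn.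
Qed.

Context (s : R) (s0 : 0 <= s) (Js : 1 <= #|J|%:R * `|rho| `^ s).

(** For [|rho| ^ (k i).+1 <= d i < |rho| ^ k i], the count divided by [#|J| ^ m] bounds the sum of
    [#|J| ^ (- k i)] from below by 1, and [Js] compares these terms with powers of [d i]. The factor
    [|rho| ^ s] comes from the index shift. *)
Lemma finite_cover_sum (D : seq nat) (U : nat -> set R) (d : nat -> R) :
  (forall i, i \in D -> 0 < d i /\ d i < 1) ->
  (forall i, i \in D -> forall x y, U i x -> U i y -> `|x - y| <= d i) ->
  (forall x, K x -> exists2 i, i \in D & U i x) ->
  `|rho| `^ s <= \sum_(i <- D) d i `^ s.
Proof.
move=> d01 Ud cov.
have [k kP] : exists k : nat -> nat, forall i, i \in D ->
    `|rho| ^+ (k i).+1 <= d i /\ d i < `|rho| ^+ k i.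
  have H i : exists k, i \in D -> `|rho| ^+ k.+1 <= d i /\ d i < `|rho| ^+ k.
    have [iD|iD] := boolP (i \in D); last by exists 0%N.
    by have [/scale_index h /h[k kP]] := d01 _ iD; exists k.
  by have [k kP] := choice H; exists k.
pose m := (\max_(i <- D) k i)%N.
have km i : i \in D -> (k i <= m)%N by move=> iD; rewrite /m (big_rem i)//= leq_maxl.
have cnt : (#|J| ^ m <= \sum_(i <- D) #|J| ^ (m - k i))%N.
  apply: (copy_count km _ cov) => i iD x y Ux Uy.
  by apply: le_lt_trans (Ud _ iD _ _ Ux Uy) _; case: (kP _ iD).
pose N : R := #|J|%:R; have N0 : 0 < N by rewrite ltr0n.
pose q := `|rho| `^ s; have q0 : 0 < q by exact: powR_gt0.
have qX n : (`|rho| ^+ n) `^ s = q ^+ n.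
  elim: n => [|n IH]; first by rewrite !expr0 powR1.
  by rewrite !exprS powRM ?exprn_ge0// IH.
have one : 1 <= \sum_(i <- D) N ^- k i.
  have : N ^+ m <= \sum_(i <- D) N ^+ m * N ^- k i.
    have : (#|J| ^ m)%N%:R <= (\sum_(i <- D) #|J| ^ (m - k i))%N%:R :> R by rewrite ler_nat.
    rewrite natr_sum natrX big_seq [in X in _ -> X]big_seq => /le_trans; apply.
    apply: ler_sum => i iD; rewrite natrX -/N exprB ?km//.
    by rewrite unitfE lt0r_neq0.
  by rewrite -mulr_sumr ler_pMr// exprn_gt0.
apply: (@le_trans _ _ (q * \sum_(i <- D) N ^- k i)).
  by rewrite ler_peMr// ltW.
rewrite mulr_sumr big_seq [leRHS]big_seq; apply: ler_sum => i iD.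
have [lo _] := kP _ iD; have [di0 _] := d01 _ iD.
apply: (@le_trans _ _ (q ^+ (k i).+1)); last first.
  rewrite -qX; apply: ge0_ler_powR => //; rewrite nnegrE ?exprn_ge0//.
  exact: ltW.
rewrite exprS ler_pM2l// -exprVn.
apply: lerXn2r; rewrite ?nnegrE ?invr_ge0; [exact: ltW | exact: ltW |].
by rewrite -[leLHS]mul1r ler_pdivrMr// mulrC.
Qed.

End SeparatedCopies.

Section HausdorffLower.
Context {R : realType}.

Lemma powR_perturb (d s eta : R) : 0 <= d -> 0 <= s -> 0 < eta ->
  exists2 e : R, 0 < e & (d + e) `^ s <= d `^ s + eta.
Proof.
move=> d0; rewrite le_eqVlt => /orP[/eqP <-|s0] eta0.
  by exists 1 => //; rewrite !powRr0 lerDl ltW.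
have y0 : 0 <= d `^ s + eta by rewrite addr_ge0 ?powR_ge0// ltW.
pose z := (d `^ s + eta) `^ s^-1.
have zs : z `^ s = d `^ s + eta by rewrite /z -powRrM mulVf ?lt0r_neq0// powRr1.
have dz : d < z.
  rewrite ltNge; apply/negP => zd.
  have := ge0_ler_powR (ltW s0) (_ : z \in Num.nneg) (_ : d \in Num.nneg) zd.
  rewrite zs !nnegrE powR_ge0 d0 => /(_ isT isT); lra.
exists (z - d); first by rewrite subr_gt0.
by rewrite addrC subrK zs.
Qed.

Lemma diam_ge0 (U : set R) : (0 <= diam U)%E.
Proof. by apply: ereal_sup_ubound; left. Qed.

Lemma diam_ub (U : set R) x y : U x -> U y -> (`|x - y|%:E <= diam U)%E.
Proof. by move=> Ux Uy; apply: ereal_sup_ubound; right; exists x => //; exists y. Qed.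

Lemma hausdorff_gauge_ge0 (s : R) (U : set R) : (0 <= hausdorff_gauge s U)%E.
Proof. by rewrite /hausdorff_gauge; case: ifP => // _; exact: poweR_ge0. Qed.

(* A countable cover of small gauge is thickened to an open one, from which
   compactness extracts a finite cover. *)
Lemma hausdorff_measure_neq0 (K : set R) (s c : R) : compact K -> 0 <= s -> 0 < c ->
  (forall (D : seq nat) (U : nat -> set R) (d : nat -> R),
    (forall i, i \in D -> 0 < d i /\ d i < 1) ->
    (forall i, i \in D -> forall x y, U i x -> U i y -> `|x - y| <= d i) ->
    (forall x, K x -> exists2 i, i \in D & U i x) ->
    c <= \sum_(i <- D) d i `^ s) ->
  hausdorff_measure s K <> 0%E.
Proof.
move=> Kc s0 c0 fin meas0.
have : (hausdorff_premeasure s 2^-1 K < (c / 2)%:E)%E.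
  apply: le_lt_trans (_ : 0%E < _)%E; last by rewrite lte_fin divr_gt0.
  by rewrite -meas0; apply: ereal_sup_ubound; exists 2^-1 => //=; rewrite invr_gt0.
move=> /ereal_inf_lt[_ [F [Fcov Fdiam] <-] Fsum].
have dfin i : exists2 d : R, 0 <= d <= 2^-1 & diam (F i) = d%:E.
  have := Fdiam i; have := diam_ge0 (F i); case: (diam (F i)) => [d| |] //.
  by rewrite !lee_fin => h1 h2; exists d => //; rewrite h1 h2.
have [d dP] : exists d : nat -> R, forall i, 0 <= d i <= 2^-1 /\ diam (F i) = (d i)%:E.
  have H i : exists d : R, 0 <= d <= 2^-1 /\ diam (F i) = d%:E.
    by have [d h1 h2] := dfin i; exists d.
  by have [d dP] := choice H; exists d.
pose eta i := c / 2 / (2 ^ i.+1)%:R.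
have eta0 i : 0 < eta i by rewrite !divr_gt0// ltr0n expn_gt0.
have [e eP] : exists e : nat -> R, forall i,
    0 < e i /\ (d i + e i) `^ s <= d i `^ s + eta i.
  have H i : exists e : R, 0 < e /\ (d i + e) `^ s <= d i `^ s + eta i.
    have [/andP[di0 _] _] := dP i.
    by have [e e0 ee] := powR_perturb di0 s0 (eta0 i); exists e.
  by have [e eP] := choice H; exists e.
(* Since [d i] is at most one half, the thickened sets keep diameter bounds below 1. *)
pose f i := Num.min (e i) (1 / 4).
have f0 i : 0 < f i by rewrite lt_min divr_gt0// andbT; case: (eP i).
pose U i := \bigcup_(x in F i) ball x (f i / 2).
have Uopen i : setT i -> open (U i).
  by move=> _; apply: bigcup_open => x _; exact: ball_open.
have Ucov : K `<=` cover setT U.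
  move=> x /Fcov[i _ Fix]; exists i => //; exists x => //.
  by apply: ballxx; rewrite divr_gt0.
have := Kc; rewrite compact_cover => /(_ nat setT U Uopen Ucov)[D' _ D'cov].
(* Indices of empty sets are discarded: their gauge is 0, while [d i + f i] has a positive power. *)
pose D := [seq i <- finmap.enum_fset D' | F i != set0].
have DF i : i \in D -> F i != set0 by rewrite mem_filter => /andP[].
have d1 i : 0 < d i + f i /\ d i + f i < 1.
  have [/andP[h1 h2] _] := dP i; have := f0 i.
  by have : f i <= 1 / 4 by [rewrite ge_min lexx orbT]; split; lra.
have Ud i x y : U i x -> U i y -> `|x - y| <= d i + f i.
  move=> [a Fa xa] [b Fb yb]; move: xa yb; rewrite -!ball_normE /= => xa yb.
  have := diam_ub Fa Fb; have [_ ->] := dP i; rewrite lee_fin => ab.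
  have -> : x - y = - (a - x) + (a - b) + (b - y) by lra.
  apply: le_trans (ler_normD _ _) _; apply: le_trans (lerD (ler_normD _ _) (lexx _)) _.
  by rewrite normrN; move: xa yb ab; lra.
have cov x : K x -> exists2 i, i \in D & U i x.
  move=> /D'cov[i /= iD' Uix]; exists i => //.
  rewrite mem_filter iD' andbT; case: Uix => a Fa _.
  by apply/eqP => F0; rewrite F0 in Fa.
have := fin D U (fun i => d i + f i) (fun i _ => d1 i) (fun i _ => @Ud i) cov.
apply/negP; rewrite -ltNge -lte_fin.
pose G i := (hausdorff_gauge s (F i) + (eta i)%:E)%E.
have G0 i : (0 <= G i)%E by rewrite adde_ge0 ?hausdorff_gauge_ge0// lee_fin ltW.
apply: (@le_lt_trans _ _ (\sum_(0 <= i <oo) G i)%E); last first.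
  apply: le_lt_trans (epsilon_trick _ _ _) _ => //.
  - by move=> i; exact: hausdorff_gauge_ge0.
  - by rewrite divr_ge0// ltW.
  by rewrite [in ltRHS](splitr c) EFinD lte_leD// ltW.
apply: (@le_trans _ _ (\sum_(i <- D) G i)%E).
  rewrite -sumEFin big_seq [leRHS]big_seq; apply: lee_sum => i iD.
  rewrite /G /hausdorff_gauge (negbTE (DF _ iD)).
  have [/andP[di0 _] ->] := dP i; rewrite poweR_EFin -EFinD lee_fin.
  have [_ ee] := eP i; apply: le_trans ee; apply: ge0_ler_powR => //.
  - by rewrite nnegrE addr_ge0// ltW.
  - by rewrite nnegrE addr_ge0// ltW//; case: (eP i).
  - by rewrite lerD2l ge_min lexx.
pose n := (\max_(i <- D) i).+1.
have Dn i : i \in D -> (i < n)%N by move=> iD; rewrite ltnS (big_rem i)//= leq_maxl.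
apply: le_trans (nneseries_lim_ge n (fun i _ _ => G0 i)).
rewrite [leRHS](bigID (mem D)) /=.
apply: (@le_trans _ _ (\sum_(0 <= i < n | i \in D) G i)%E); last first.
  by rewrite leeDl// sume_ge0.
have uD : uniq D by rewrite filter_uniq// finmap.fset_uniq.
rewrite -[leRHS]big_filter le_eqVlt; apply/orP; left; apply/eqP; apply: perm_big.
apply: uniq_perm => //; first by rewrite filter_uniq// iota_uniq.
move=> i; rewrite [RHS]mem_filter mem_index_iota.
by case: (boolP (i \in D)) => //= /Dn ->.
Qed.

End HausdorffLower.

Section HausdorffUpper.
Context {R : realType}.

Lemma hausdorff_premeasure_ge0 (s delta : R) (A : set R) :
  (0 <= hausdorff_premeasure s delta A)%E.
Proof.
apply/ereal_infP => _ [F _ <-].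
by apply: nneseries_ge0 => i _ _; exact: hausdorff_gauge_ge0.
Qed.

Lemma hausdorff_gauge_le (s d : R) (U : set R) : 0 <= s -> 0 <= d ->
  (forall x y, U x -> U y -> `|x - y| <= d) ->
  (diam U <= d%:E)%E /\ (hausdorff_gauge s U <= (d `^ s)%:E)%E.
Proof.
move=> s0 d0 Ud.
have du : (diam U <= d%:E)%E.
  apply: ge_ereal_sup => _ [->|[x Ux [y Uy <-]]]; first by rewrite lee_fin.
  by rewrite lee_fin; exact: Ud.
split=> //; rewrite /hausdorff_gauge; case: ifP => _.
  by rewrite lee_fin powR_ge0.
have := diam_ge0 U; move: du; case: (diam U) => [e| |] //.
rewrite poweR_EFin !lee_fin => ed e0.
by apply: ge0_ler_powR; rewrite ?nnegrE.
Qed.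

Lemma hausdorff_measure_eq0 (K : set R) (s : R) : 0 <= s ->
  (forall e : R, 0 < e -> exists (T : finType) (F : T -> set R) (d : T -> R),
    [/\ forall x, K x -> exists i, F i x,
        forall i, 0 <= d i <= e,
        forall i x y, F i x -> F i y -> `|x - y| <= d i &
        \sum_i d i `^ s <= e]) ->
  hausdorff_measure s K = 0%E.
Proof.
move=> s0 H; apply/eqP; rewrite eq_le; apply/andP; split; last first.
  apply: le_trans (hausdorff_premeasure_ge0 s 1 K) _.
  by apply: ereal_sup_ubound; exists 1 => //=; exact: ltr01.
apply: ge_ereal_sup => _ [delta /= delta0 <-].
apply/lee_addgt0Pr => e e0; rewrite add0e.
have me0 : 0 < Num.min e delta by rewrite lt_min e0 delta0.
have [T [F [d [cov dle Fd sum_le]]]] := H _ me0.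
pose G (i : nat) : set R := if insub i is Some o then F (enum_val (o : 'I_#|T|)) else set0.
have GE (o : 'I_#|T|) : G o = F (enum_val o).
  by rewrite /G insubT //= => h; congr (F (enum_val _)); exact/val_inj.
have G0 i : (#|T| <= i)%N -> G i = set0.
  by move=> Ti; rewrite /G insubN// -leqNgt.
have gz i : (#|T| <= i)%N -> hausdorff_gauge s (G i) = 0%E.
  by move=> Ti; rewrite /hausdorff_gauge G0// eqxx.
apply: (@le_trans _ _ (\sum_(0 <= i <oo) hausdorff_gauge s (G i))%E).
  apply: ereal_inf_lbound; exists G => //; split.
    move=> x /cov[i Fix]; exists (enum_rank i) => //.
    by rewrite GE enum_rankK.
  move=> i; have [Ti|Ti] := leqP #|T| i.
    have [du _] := hausdorff_gauge_le s0 (ltW delta0) (fun x y (h : set0 x) => False_ind _ h).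
    by rewrite G0//; apply: le_trans du _.
  rewrite (GE (Ordinal Ti)); set j := enum_val _.
  have /andP[d0 de] := dle j.
  have [du _] := hausdorff_gauge_le s0 d0 (@Fd j).
  apply: le_trans du _; rewrite lee_fin; apply: le_trans de _.
  by rewrite ge_min lexx orbT.
rewrite (nneseries_split 0 #|T|); last by move=> k _; exact: hausdorff_gauge_ge0.
rewrite add0n [X in (_ + X)%E]eseries0 ?adde0; last by move=> i Ti _; exact: gz.
rewrite big_mkord; apply: (@le_trans _ _ (\sum_(i < #|T|) (d (enum_val i) `^ s)%:E)%E).
  apply: lee_sum => i _; rewrite GE; have /andP[d0 _] := dle (enum_val i).
  by have [] := hausdorff_gauge_le s0 d0 (@Fd (enum_val i)).
rewrite sumEFin lee_fin -(big_enum_val (fun i : T => d i `^ s)) /=.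
by apply: le_trans sum_le _; rewrite ge_min lexx.
Qed.

Lemma hausdorff_measure_gt1 (K : set R) (s A : R) : 1 < s -> 0 < A ->
  (forall x, K x -> `|x| <= A) -> hausdorff_measure s K = 0%E.
Proof.
move=> s1 A0 KA; apply: hausdorff_measure_eq0; first lra.
move=> e e0; have s10 : 0 < s - 1 by rewrite subr_gt0.
have A2 : 0 < 2 * A by rewrite mulr_gt0.
(* The [N.+1] intervals of length [h] have total length [2 * A], so their gauges sum to
   [2 * A * h ^ (s - 1)], at most [e] when [h <= y]. *)
pose y := (e / (2 * A)) `^ (s - 1)^-1.
have y0 : 0 < y by rewrite powR_gt0 ?divr_gt0.
have me0 : 0 < Num.min e y by rewrite lt_min e0 y0.
have [N NP] := nat_large (2 * A) me0.
have N0 : 0 < (N.+1)%:R :> R by [].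
pose h := 2 * A / (N.+1)%:R.
have h0 : 0 < h by rewrite divr_gt0.
have hm : h <= Num.min e y.
  by rewrite ler_pdivrMr// [leRHS]mulrC; apply: NP.
have he : h <= e by apply: le_trans hm _; rewrite ge_min lexx.
have hy : h <= y by apply: le_trans hm _; rewrite ge_min lexx orbT.
exists 'I_N.+1, (fun i : 'I_N.+1 => [set x | - A + i%:R * h <= x <= - A + i%:R * h + h]%classic), (fun=> h).
split.
- move=> x /KA; rewrite ler_norml => /andP[x1 x2].
  have xA0 : 0 <= x + A by lra.
  pose k := Num.truncn ((x + A) / h).
  have k1 : k%:R * h <= x + A by rewrite -ler_pdivlMr// truncn_le// divr_ge0// ltW.
  have k2 : x + A < k%:R * h + h.
    have := truncnS_gt ((x + A) / h); rewrite -/k ltr_pdivrMr// -natr1 mulrDl mul1r.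
    by [].
  have [kN|kN] := ltnP k N.+1.
    by exists (Ordinal kN) => /=; apply/andP; split; lra.
  have Nh : (N.+1)%:R * h = 2 * A by rewrite /h mulrC divfK// lt0r_neq0.
  have kh : (N.+1)%:R * h <= k%:R * h by rewrite ler_pM2r// ler_nat.
  exists ord_max => /=; move: Nh kh; rewrite -natr1 mulrDl mul1r => *.
  by apply/andP; split; lra.
- by move=> i; rewrite he ltW.
- by move=> i x z /= /andP[? ?] /andP[? ?]; rewrite ler_norml; apply/andP; split; lra.
rewrite sumr_const card_ord -[_ *+ _]mulr_natl.
have -> : h `^ s = h * h `^ (s - 1).
  rewrite -{2}[h]powRr1 ?ltW// -powRD; first by congr (_ `^ _); lra.
  by rewrite lt0r_neq0// implybT.
rewrite mulrA {1}/h [_ * (_ / _)]mulrC divfK ?lt0r_neq0// mulrC -ler_pdivlMr//.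
have -> : e / (2 * A) = y `^ (s - 1).
  by rewrite /y -powRrM mulVf ?lt0r_neq0// powRr1// ltW// divr_gt0.
by apply: ge0_ler_powR; [exact: ltW | rewrite nnegrE ltW | rewrite nnegrE ltW |].
Qed.

End HausdorffUpper.

(** * The upper bound from cylinders *)

Section WordMaps.
Context {R : realType} {m : nat}.
Implicit Types (lambda t : 'I_m.+1 -> R) (w : seq 'I_m.+1).

Definition word_ratio lambda w : R := \prod_(j <- w) lambda j.

Lemma word_mapE lambda t w x :
  word_map lambda t w x = word_ratio lambda w * x + word_map lambda t w 0.
Proof.
rewrite /word_ratio; elim: w x => [|j w IH] x; first by rewrite big_nil /= mul1r addr0.
by rewrite big_cons /= /ifs_map IH mulrDr mulrA; lra.
Qed.

Lemma word_map_cat lambda t w w' x :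
  word_map lambda t (w ++ w') x = word_map lambda t w (word_map lambda t w' x).
Proof. by elim: w => [//|j w IH] /=; rewrite IH. Qed.

Lemma attractor_stable lambda t (K : set R) w x : is_attractor lambda t K ->
  K x -> K (word_map lambda t w x).
Proof.
move=> [_ _ KE] Kx; elim: w => [//|j w IH] /=.
by rewrite KE; exists j => //; exists (word_map lambda t w x).
Qed.

Lemma attractor_cover lambda t (K : set R) n x : is_attractor lambda t K ->
  K x -> exists w : n.-tuple 'I_m.+1, exists2 y, K y & x = word_map lambda t w y.
Proof.
move=> [_ _ KE]; elim: n x => [|n IH] x Kx.
  by exists [tuple]; exists x.
move: Kx; rewrite {1}KE => -[j _ [y Ky <-]].
have [w [z Kz ->]] := IH _ Ky.
by exists [tuple of j :: w]; exists z.
Qed.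

Lemma sum_tuple_prod (f : 'I_m.+1 -> R) (n : nat) :
  \sum_(w : n.-tuple 'I_m.+1) \prod_(j <- w) f j = (\sum_j f j) ^+ n.
Proof.
elim: n => [|n IH].
  rewrite expr0 (big_pred1 [tuple]) ?big_nil// => w /=.
  by apply/esym/eqP/val_inj; case: w => -[].
pose p (w : 'I_m.+1 * n.-tuple 'I_m.+1) := [tuple of w.1 :: w.2].
have pb : bijective p.
  exists (fun v : n.+1.-tuple 'I_m.+1 => (thead v, [tuple of behead v])) => [[j w]|w] /=.
    by rewrite /p theadE; congr (_, _); exact/val_inj.
  by rewrite /p -tuple_eta.
rewrite (reindex p)/=; last exact: onW_bij.
rewrite -(pair_bigA _ (fun j (v : n.-tuple 'I_m.+1) => \prod_(k <- [tuple of j :: v]) f k)) /=.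
rewrite exprS mulr_suml; apply: eq_bigr => j _; rewrite -IH mulr_sumr.
by apply: eq_bigr => w _; rewrite big_cons.
Qed.

Lemma powR_prod (f : 'I_m.+1 -> R) (s : R) w :
  `|\prod_(j <- w) f j| `^ s = \prod_(j <- w) `|f j| `^ s.
Proof.
elim: w => [|j w IH]; first by rewrite !big_nil normr1 powR1.
by rewrite !big_cons normrM powRM// IH.
Qed.

Lemma compact_bound (K : set R) : compact K -> exists2 A : R, 0 < A &
  forall x, K x -> `|x| <= A.
Proof.
move=> /compact_bounded[M [_ MP]].
exists (Num.max (M + 1) 1); first by rewrite lt_max ltr01 orbT.
by move=> x Kx; apply: MP => //; rewrite lt_max ltrDl ltr01.
Qed.

(** The sum over the cylinders of level [n] is at most [(2 * A) ^ s * th ^ n], where [th < 1]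
    because [s] exceeds the similarity dimension. *)
Lemma hausdorff_measure_gt_dim lambda t (K : set R) (s : R) :
  contraction_ratios lambda -> is_attractor lambda t K ->
  similarity_dim lambda < s -> hausdorff_measure s K = 0%E.
Proof.
move=> hl hK Ss; have [S0 S1] := similarity_dimP hl.
set S := similarity_dim lambda in Ss S0 S1.
have s0 : 0 < s by exact: le_lt_trans Ss.
have l0 j : 0 < `|lambda j| by have [_ _ h] := hl j; rewrite normr_gt0.
have l1 j : `|lambda j| < 1 by have [h1 h2 _] := hl j; rewrite ltr_norml h1 h2.
have [A A0 KA] := compact_bound (let: And3 h _ _ := hK in h).
pose th := \sum_j `|lambda j| `^ s.
have th0 : 0 <= th by apply: sumr_ge0 => j _; exact: powR_ge0.
have th1 : th < 1.
  rewrite -S1; apply: ltr_sum => [|j _].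
    by apply/hasP; exists ord0; rewrite ?mem_index_enum.
  by rewrite /powR gt_eqF// ltr_expR ltr_nM2r// ln_lt0// l0 l1.
pose mx := \big[Num.max/0]_j `|lambda j|.
have mx_ge j : `|lambda j| <= mx by rewrite /mx; exact: le_bigmax.
have mx0 : 0 < mx by apply: lt_le_trans (mx_ge ord0).
have mx1 : mx < 1 by apply/bigmax_ltP; split.
have small (x y : R) : 0 <= x -> x < 1 -> 0 < y -> exists p, forall n, (p <= n)%N -> x ^+ n <= y.
  rewrite le_eqVlt => /orP[/eqP <- _ y0|x0 x1 y0].
    by exists 1%N => -[//|n] _; rewrite expr0n /= ltW.
  have xn : `|x| = x by rewrite gtr0_norm.
  have := @pow_small R x; rewrite xn => /(_ (lt0r_neq0 x0) x1 _ y0)[p pP].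
  by exists p.
apply: hausdorff_measure_eq0; first exact: ltW.
move=> e e0; have A2 : 0 < 2 * A by rewrite mulr_gt0.
have A2s : 0 < (2 * A) `^ s by exact: powR_gt0.
have [p1 p1P] := small th (e / (2 * A) `^ s) th0 th1 (divr_gt0 e0 A2s).
have [p2 p2P] := small mx (e / (2 * A)) (ltW mx0) mx1 (divr_gt0 e0 A2).
pose n := maxn p1 p2.
exists {: n.-tuple 'I_m.+1},
  (fun w : n.-tuple 'I_m.+1 => word_map lambda t w @` K),
  (fun w : n.-tuple 'I_m.+1 => `|word_ratio lambda w| * (2 * A)).
have ratio_le (w : n.-tuple 'I_m.+1) : `|word_ratio lambda w| <= mx ^+ n.
  rewrite /word_ratio -[in leRHS](size_tuple w); elim: (tval w) => [|j v IH] /=.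
    by rewrite big_nil normr1.
  by rewrite big_cons normrM exprS; apply: ler_pM.
split.
- move=> x /(attractor_cover n hK)[w [y Ky ->]]; exists w; by exists y.
- move=> w; apply/andP; split; first by rewrite mulr_ge0// ltW.
  rewrite -ler_pdivlMr//; apply: le_trans (ratio_le w) _.
  by apply: p2P; rewrite leq_maxr.
- move=> w x y [x' Kx' <-] [y' Ky' <-]; rewrite (word_mapE _ _ _ x') (word_mapE _ _ _ y').
  have -> : word_ratio lambda w * x' + word_map lambda t w 0 -
    (word_ratio lambda w * y' + word_map lambda t w 0) =
    word_ratio lambda w * (x' - y') by rewrite mulrBr; lra.
  rewrite normrM ler_wpM2l//; apply: le_trans (ler_normB _ _) _.
  by have := KA _ Kx'; have := KA _ Ky'; lra.
rewrite (eq_bigr (fun w : n.-tuple 'I_m.+1 =>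
   (2 * A) `^ s * \prod_(j <- w) `|lambda j| `^ s)); last first.
  by move=> w _; rewrite (powRM _ (normr_ge0 _) (ltW A2)) [LHS]mulrC; congr (_ * _); exact: powR_prod.
rewrite -mulr_sumr sum_tuple_prod -/th mulrC -ler_pdivlMr//.
by apply: p1P; rewrite leq_maxl.
Qed.

Lemma hausdorff_dim_le lambda t (K : set R) :
  contraction_ratios lambda -> is_attractor lambda t K ->
  (hausdorff_dim K <= (Num.min 1 (similarity_dim lambda))%:E)%E.
Proof.
move=> hl hK; apply/lee_addgt0Pr => e e0; rewrite -EFinD.
have [S0 _] := similarity_dimP hl.
set D := Num.min 1 _; have D0 : 0 <= D by rewrite le_min ler01.
apply: ereal_inf_lbound; exists (D + e) => //; split; first by rewrite addr_ge0// ltW.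
have [S1|S1] := leP 1 (similarity_dim lambda).
  have [A A0 KA] := compact_bound (let: And3 h _ _ := hK in h).
  apply: (hausdorff_measure_gt1 _ A0) => //.
  by rewrite /D (min_idPl S1) ltrDl.
apply: hausdorff_measure_gt_dim hl hK _.
by rewrite /D (min_idPr (ltW S1)) ltrDl.
Qed.

End WordMaps.

(** * The lower bound by passage to a homogeneous subsystem *)

Section Reduction.
Context {R : realType} {m : nat}.
Context (lambda t : 'I_m.+1 -> R) (hl : contraction_ratios lambda).

Local Notation S := (similarity_dim lambda).

Lemma ratio_gt0 j : 0 < `|lambda j|.
Proof. by have [_ _ h] := hl j; rewrite normr_gt0. Qed.

Lemma ratio_lt1 j : `|lambda j| < 1.
Proof. by have [h1 h2 _] := hl j; rewrite ltr_norml h1 h2. Qed.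

Lemma word_ratio_neq0 w : word_ratio lambda w != 0.
Proof.
rewrite /word_ratio; elim: w => [|j w IH]; first by rewrite big_nil oner_eq0.
by rewrite big_cons mulf_neq0// -normr_gt0 ratio_gt0.
Qed.

Lemma word_ratio_algebraic w :
  (forall j, algebraicOver (ratr : rat -> R) (lambda j)) ->
  algebraicOver (ratr : rat -> R) (word_ratio lambda w).
Proof.
move=> halg; rewrite /word_ratio; elim: w => [|j w IH].
  by rewrite big_nil; exact: algebraic1.
by rewrite big_cons; exact: algebraic_mul.
Qed.

(** Pigeonhole on letter counts: the weights of all words of length [n] sum to 1, there are at most
    [(n + 1) ^ (m + 1)] count vectors, and the ratio of a word depends only on its counts. *)
Lemma exists_large_type (n : nat) :
  exists (w0 : n.-tuple 'I_m.+1) (W : {set n.-tuple 'I_m.+1}),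
    (forall w : n.-tuple 'I_m.+1, w \in W -> word_ratio lambda w = word_ratio lambda w0) /\
    1 <= (n.+1 ^ m.+1)%:R * (#|W|%:R * `|word_ratio lambda w0| `^ S).
Proof.
have [_ S1] := similarity_dimP hl.
pose F (w : n.-tuple 'I_m.+1) : R := \prod_(j <- w) `|lambda j| `^ S.
pose tc (w : n.-tuple 'I_m.+1) : {ffun 'I_m.+1 -> 'I_n.+1} :=
  [ffun j => inord (count_mem j w)].
pose M : R := (n.+1 ^ m.+1)%:R.
have M0 : 0 < M by rewrite ltr0n expn_gt0.
have tot : \sum_c \sum_(w | tc w == c) F w = 1.
  transitivity (\sum_w F w); first by rewrite (partition_big tc xpredT).
  rewrite /F sum_tuple_prod.
  by rewrite -[X in X ^+ _]/(\sum_j `|lambda j| `^ S) S1 expr1n.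
have [c cP] : exists c, 1 <= M * \sum_(w | tc w == c) F w.
  apply: contrapT => /forallNP h.
  have : \sum_(c : {ffun 'I_m.+1 -> 'I_n.+1}) \sum_(w | tc w == c) F w <
      \sum_(c : {ffun 'I_m.+1 -> 'I_n.+1}) M^-1.
    apply: ltr_sum => [|c _].
      by apply/hasP; exists [ffun=> ord0]; rewrite ?mem_index_enum.
    by rewrite -[ltRHS]mul1r ltr_pdivlMr// mulrC ltNge; apply/negP/h.
  by rewrite tot sumr_const card_ffun !card_ord -mulr_natr mulVf ?lt0r_neq0// ltxx.
have [w0 w0c] : exists w0, tc w0 == c.
  apply: contrapT => /forallNP h; move: cP; rewrite big_pred0 ?mulr0 ?ler10// => w.
  exact/negP/h.
have tcE (w : n.-tuple 'I_m.+1) : tc w == c -> perm_eq w w0.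
  move=> /eqP wc; rewrite /perm_eq; apply/allP => j _ /=.
  have := congr1 (fun f : {ffun 'I_m.+1 -> 'I_n.+1} => val (f j)) (etrans wc (esym (eqP w0c))).
  by rewrite !ffunE /= !inordK ?ltnS -?[X in (_ <= X)%N](size_tuple w)
    ?count_size// => [->//|]; rewrite size_tuple -[X in (_ <= X)%N](size_tuple w0) count_size.
exists w0, [set w | tc w == c]%SET; split.
  by move=> w; rewrite inE => /tcE; exact: perm_big.
suff <- : \sum_(w | tc w == c) F w = #|[set w | tc w == c]%SET|%:R * `|word_ratio lambda w0| `^ S by [].
rewrite (eq_bigr (fun=> `|word_ratio lambda w0| `^ S)) => [|w wc].
  by rewrite sumr_const cardsE -[LHS]mulr_natl.
by rewrite /word_ratio powR_prod /F; exact: perm_big (tcE _ wc).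
Qed.

Lemma homogeneous_subsystem (s : R) : 0 <= s -> s < S ->
  exists n (w0 : n.-tuple 'I_m.+1) (W : {set n.-tuple 'I_m.+1}), [/\ (0 < n)%N,
    (forall w : n.-tuple 'I_m.+1, w \in W -> word_ratio lambda w = word_ratio lambda w0),
    `|word_ratio lambda w0| < 1 &
    s * - ln `|word_ratio lambda w0| < ln #|W|%:R].
Proof.
move=> s0 sS.
pose mx := \big[Num.max/0]_j `|lambda j|.
have mx_ge j : `|lambda j| <= mx by rewrite /mx; exact: le_bigmax.
have mx0 : 0 < mx by apply: lt_le_trans (mx_ge ord0); exact: ratio_gt0.
have mx1 : mx < 1 by apply/bigmax_ltP; split => // j _; exact: ratio_lt1.
pose L0 := - ln mx.
have L00 : 0 < L0 by rewrite oppr_gt0 ln_lt0// mx0 mx1.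
have gap0 : 0 < (S - s) * L0 by rewrite mulr_gt0// subr_gt0.
pose q := 2 * m.+1%:R / ((S - s) * L0).
have [k k_gt1 kq] : exists2 k, (1 < k)%N & q + 1 < k%:R.
  exists (Num.truncn q).+2 => //.
  by rewrite -[ltRHS]natr1 ltrD2r; exact: truncnS_gt.
have k_gt0 : (0 < k)%N by exact: ltnW.
(* With [n + 1 = k ^ 2] the loss from the number of types is [2 * (m + 1) * ln k <= 2 * (m + 1) * (k
   - 1)], while [n = (k - 1) * (k + 1)]: the factor [k - 1] cancels and [k + 1 > q] is enough. *)
pose n := (k ^ 2).-1.
have nE : n.+1 = (k ^ 2)%N by rewrite prednK// expn_gt0 k_gt0.
have n0 : (0 < n)%N by rewrite -ltnS nE -{1}(exp1n 2) ltn_exp2r.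
have nk : (n%:R : R) = (k%:R - 1) * (k%:R + 1).
  have : (n.+1%:R : R) = k%:R ^+ 2 by rewrite nE natrX.
  by rewrite -natr1 => h; apply: (addIr 1); rewrite /= h; ring.
have k0 : (0 : R) < k%:R by rewrite ltr0n.
have [w0 [W [We]]] := exists_large_type n.
set rho := `|word_ratio lambda w0| => W1.
have rho0 : 0 < rho by rewrite normr_gt0 word_ratio_neq0.
have rho_le : rho <= mx ^+ n.
  rewrite /rho /word_ratio -[in leRHS](size_tuple w0); elim: (tval w0) => [|j v IH] /=.
    by rewrite big_nil normr1.
  by rewrite big_cons normrM exprS; apply: ler_pM.
have rho1 : rho < 1.
  by apply: le_lt_trans rho_le _; rewrite exprn_ilt1 ?(ltW mx0)// -lt0n.
have Lrho : n%:R * L0 <= - ln rho.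
  rewrite /L0 mulrN lerN2 mulr_natl -lnXn//.
  by rewrite ler_ln// posrE exprn_gt0.
have W0 : (0 : R) < #|W|%:R.
  rewrite ltr0n lt0n; apply/negP => /eqP h.
  by move: W1; rewrite h mul0r mulr0 ler10.
exists n, w0, W; split => //.
have := W1; rewrite -[X in X <= _]/(1) -ler_ln ?posrE ?ltr01//; last first.
  by rewrite !mulr_gt0// ?powR_gt0// ltr0n expn_gt0.
have Np : (0 : R) < (n.+1 ^ m.+1)%:R by rewrite ltr0n expn_gt0.
rewrite ln1 lnM ?posrE//; last by rewrite mulr_gt0// powR_gt0.
rewrite lnM ?posrE// ?powR_gt0// ln_powR natrX lnXn ?ltr0n// nE natrX lnXn// => lnW.
have lnk : ln k%:R <= (k%:R - 1 : R).
  have := @le_ln1Dx R (k%:R - 1); rewrite [1 + _]addrC subrK; apply.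
  by rewrite ltrBrDr addNr.
have kq2 : 2 * m.+1%:R < (k%:R + 1) * ((S - s) * L0).
  by rewrite -ltr_pdivrMr// -/q; lra.
have k1 : (0 : R) < k%:R - 1 by rewrite subr_gt0 ltr1n.
have h1 : (ln k%:R *+ 2) *+ m.+1 <= (k%:R - 1) * (2 * m.+1%:R) :> R.
  by rewrite -[leLHS]mulr_natr -[ln _ *+ 2]mulr_natr -mulrA ler_wpM2r// mulr_ge0.
have h2 : (k%:R - 1) * (2 * m.+1%:R) < (S - s) * (n%:R * L0).
  have -> : (S - s) * (n%:R * L0) = (k%:R - 1) * ((k%:R + 1) * ((S - s) * L0)).
    by rewrite nk; ring.
  by rewrite ltr_pM2l.
have h3 : (S - s) * (n%:R * L0) <= (S - s) * - ln rho.
  by apply: ler_wpM2l => //; rewrite subr_ge0 ltW.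
have h4 : (S - s) * - ln rho = - (S * ln rho) - s * - ln rho by ring.
by move: lnW h1 h2 h3; rewrite h4; clear; move: (ln _ *+ _ *+ _) => X; lra.
Qed.

Context (halg : forall j, algebraicOver (ratr : rat -> R) (lambda j)).
Context (hover : ~ exact_overlaps lambda t) (K : set R) (hK : is_attractor lambda t K).

Lemma hausdorff_measure_lt_dim (s : R) : 0 <= s -> s < 1 -> s < S ->
  hausdorff_measure s K <> 0%E.
Proof.
move=> s0 s1 sS.
have [n [w0 [W [n0 We rho1 sW]]]] := homogeneous_subsystem s0 sS.
pose I := {w : n.-tuple 'I_m.+1 | w \in W}.
set Lam := word_ratio lambda w0 in We rho1 sW.
have Lam0 : Lam != 0 by exact: word_ratio_neq0.
pose T (w : I) : R := word_map lambda t (val w) 0.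
(* Blocks have equal positive length, so flattening is injective and an overlap of the subsystem
   would be an exact overlap of the original system. *)
pose fl (v : seq I) : seq 'I_m.+1 := flatten [seq tval (val w) | w <- v].
have flE v x : word_map lambda t (fl v) x = Lam ^+ size v * x + rsum Lam T v.
  elim: v => [|w v IH]; first by rewrite /= mul1r addr0.
  rewrite /fl /= word_map_cat -/(fl v) IH word_mapE (We _ (valP w)) exprS -/Lam.
  by rewrite /T; ring.
have size_fl v : size (fl v) = (size v * n)%N.
  elim: v => [//|w v IH].
  by rewrite /fl /= size_cat -/(fl v) IH size_tuple mulSn.
have fl_inj v v' : fl v = fl v' -> v = v'.
  elim: v v' => [|w v IH] [|w' v'] //.
  - by move=> /(congr1 size)/eqP; rewrite !size_fl /= eq_sym muln_eq0 /= eqn0Ngt n0.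
  - by move=> /(congr1 size)/eqP; rewrite !size_fl /= muln_eq0 /= eqn0Ngt n0.
  rewrite /fl /= => /eqP; rewrite eqseq_cat ?size_tuple// => /andP[/eqP/val_inj/val_inj -> /eqP/IH ->].
  by [].
have noover N (u v : N.-tuple I) : rsum Lam T u = rsum Lam T v -> u = v.
  move=> uv; apply/val_inj/fl_inj; apply: contrapT => ne.
  have uN : size (fl u) == (N * n)%N by rewrite size_fl size_tuple.
  have vN : size (fl v) == (N * n)%N by rewrite size_fl size_tuple.
  apply: hover; exists (N * n)%N; split.
    rewrite lt0n; apply/negP => /eqP N0; apply: ne.
    by rewrite (size0nil (etrans (eqP uN) N0)) (size0nil (etrans (eqP vN) N0)).
  exists (Tuple uN), (Tuple vN); split; first by move=> /(congr1 val).
  by apply/funext => x; rewrite /= !flE !size_tuple uv.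
have Icard : #|{: I}| = #|W| by rewrite card_sig.
have W1 : (1 < #|W|)%N.
  rewrite ltnNge; apply/negP => W1.
  have : ln #|W|%:R <= 0 :> R by rewrite ln_le0// lern1.
  rewrite leNgt => /negP; apply; apply: le_lt_trans sW.
  by rewrite mulr_ge0// oppr_ge0 ln_le0// ltW.
have [Kc [x0 Kx0] _] := hK.
have [B B0 KB] := compact_bound Kc.
(* Two points of [K] are at most [2 * B] apart; the extra unit is the separation left between the
   copies of [K]. *)
pose g := (Num.truncn (2 * B + 1)).+1.
have gB : 2 * B + 1 < g%:R by exact: truncnS_gt.
have I0 : (0 < #|{: I}|)%N by rewrite Icard ltnW.
have sI : s * - ln `|Lam| < ln #|{: I}|%:R by rewrite Icard.
have [n1 [n10 [A [Asep Acard]]]] := separated_words (t := T) I0 Lam0 rho1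
  (word_ratio_algebraic w0 halg) noover g s0 s1 sI.
pose J := {v : n1.-tuple I | v \in A}.
have Jcard : #|{: J}| = #|A| by rewrite card_sig.
pose rho := Lam ^+ n1.
have rhoE : `|rho| = `|Lam| ^+ n1 by rewrite normrX.
have rho_gt0 : 0 < `|rho| by rewrite normr_gt0 expf_neq0.
have Lg : 0 < - ln `|Lam| by rewrite oppr_gt0 ln_lt0// normr_gt0 Lam0.
(* For [s = 0] the bound [Acard] reads [0 <= ln #|A|] and does not give two copies; there one set of
   the cover already contributes 1. *)
move: s0; rewrite le_eqVlt => /orP[/eqP <-|s0].
  apply: (hausdorff_measure_neq0 (c := 1) Kc) => // D U d _ _ /(_ _ Kx0)[i iD _].
  rewrite (big_rem i)//= powRr0 lerDl sumr_ge0// => j _; exact: powR_ge0.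
have Alarge : 1 < #|A|%:R :> R.
  rewrite ltNge; apply/negP => /ln_le0; rewrite leNgt => /negP; apply.
  by apply: lt_le_trans Acard; rewrite !mulr_gt0// ltr0n.
have A0 : (0 < #|A|)%N by rewrite -(ltr0n R); exact: lt_trans Alarge.
have J0 : (0 < #|{: J}|)%N by rewrite Jcard.
pose tau (v : J) := rsum Lam T (val v).
have Kstable (v : J) x : K x -> K (rho * x + tau v).
  by move=> Kx; rewrite /rho -{1}(size_tuple (val v)) -flE; exact: attractor_stable hK Kx.
have sep (u v : J) x y : u != v -> K x -> K y ->
    `|rho| <= `|(rho * x + tau u) - (rho * y + tau v)|.
  move=> uv /KB xB /KB yB.
  have := Asep _ _ (valP u) (valP v) uv; rewrite -rhoE -/(tau u) -/(tau v) => tuv.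
  have xy : `|rho * (x - y)| <= `|rho| * (2 * B).
    by rewrite normrM ler_wpM2l//; apply: le_trans (ler_normB _ _) _; lra.
  have gr : `|rho| * (2 * B + 1) <= g%:R * `|rho|.
    by rewrite mulrC; apply: ler_wpM2r => //; exact: ltW.
  have : `|tau u - tau v| <= `|rho * x + tau u - (rho * y + tau v)| + `|rho * (x - y)|.
    have -> : tau u - tau v = (rho * x + tau u - (rho * y + tau v)) - rho * (x - y) by ring.
    exact: ler_normB.
  by move: gr; rewrite mulrDr mulr1; lra.
have rho_lt1 : `|rho| < 1 by rewrite rhoE exprn_ilt1// -lt0n.
have Js : 1 <= #|{: J}|%:R * `|rho| `^ s.
  have Jr : 0 < #|{: J}|%:R * `|rho| `^ s by rewrite mulr_gt0// ?powR_gt0// ltr0n.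
  rewrite -ler_ln ?posrE ?ltr01// ln1 lnM ?posrE ?powR_gt0 ?ltr0n// ln_powR rhoE.
  rewrite lnXn ?normr_gt0// Jcard; move: Acard; rewrite -[_ *+ n1]mulr_natl.
  by rewrite mulrN mulrN mulrCA; lra.
apply: (hausdorff_measure_neq0 Kc (ltW s0) (powR_gt0 s rho_gt0)) => D U d.
exact: (finite_cover_sum rho_gt0 rho_lt1 J0 Kx0 Kstable sep (ltW s0) Js).
Qed.

End Reduction.

Theorem corollary3 (R : realType) (m : nat) (lambda t : 'I_m.+1 -> R)
    (hlambda : contraction_ratios lambda)
    (halg : forall j : 'I_m.+1, algebraicOver (ratr : rat -> R) (lambda j))
    (hover : ~ exact_overlaps lambda t)
    (K : set R) (hK : is_attractor lambda t K) :
  hausdorff_dim K = (Num.min 1 (similarity_dim lambda))%:E.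
Proof.
apply/eqP; rewrite eq_le (hausdorff_dim_le hlambda hK) /=.
apply: le_ereal_inf_tmp => _ [s [s0 meas0] <-]; rewrite lee_fin leNgt lt_min.
apply/negP => /andP[s1 sS].
exact: (hausdorff_measure_lt_dim hlambda halg hover hK s0 s1 sS).
Qed.
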